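(* The hyperspace $\mathrm{mpcc}(\mathbb R^\omega)$ of nonempty compact max-plus convex subsets of $\mathbb R^\omega$ is homeomorphic to $\mathbb R^\omega$.
   Context: For $x,y\in\mathbb R^\omega$ and $\lambda\in\mathbb R_{\max}=\mathbb R\cup\{-\infty\}$, $x\oplus y$ denotes the coordinatewise maximum and $\lambda\odot x$ the vector obtained by adding $\lambda$ to every coordinate. A subset $A\subset\mathbb R^\omega$ is max-plus convex if $\alpha\odot a\oplus\beta\odot b\in A$ for all $a,b\in A$ and $\alpha,\beta\in\mathbb R_{\max}$ with $\max(\alpha,\beta)=0$. $\mathrm{mpcc}(\mathbb R^\omega)$ is the set of all nonempty compact max-plus convex subsets of $\mathbb R^\omega$ (product topology), with the Vietoris topology (equivalently, the Hausdorff metric topology induced by any compatible metric on $\mathbb R^\omega$). *)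

(* Defs.v *)
From Stdlib Require Import Reals List.
Open Scope R_scope.

Definition generated_open {X : Type} (S : (X -> Prop) -> Prop) (U : X -> Prop) : Prop :=
  forall x, U x ->
    exists l : list (X -> Prop),
      Forall S l /\ (forall B, In B l -> B x) /\
      (forall y, (forall B, In B l -> B y) -> U y).

Definition compact_in {X : Type} (opn : (X -> Prop) -> Prop) (K : X -> Prop) : Prop :=
  forall (I : Type) (U : I -> X -> Prop),
    (forall i, opn (U i)) ->
    (forall x, K x -> exists i, U i x) ->
    exists l : list I, forall x, K x -> exists i, In i l /\ U i x.

Definition continuous_map {X Y : Type} (opnX : (X -> Prop) -> Prop)
  (opnY : (Y -> Prop) -> Prop) (f : X -> Y) : Prop :=
  forall V, opnY V -> opnX (fun x => V (f x)).

Definition homeomorphic {X Y : Type} (opnX : (X -> Prop) -> Prop)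
  (opnY : (Y -> Prop) -> Prop) : Prop :=
  exists (f : X -> Y) (g : Y -> X),
    continuous_map opnX opnY f /\ continuous_map opnY opnX g /\
    (forall x, g (f x) = x) /\ (forall y, f (g y) = y).

Definition Romega : Type := nat -> R.

Definition prod_subbase (W : Romega -> Prop) : Prop :=
  exists (n : nat) (V : R -> Prop), open_set V /\ (forall x, W x <-> V (x n)).

Definition prod_open : (Romega -> Prop) -> Prop := generated_open prod_subbase.

(** * Max-plus convexity.  R_max = R ∪ {-∞} is [option R], [None] = -∞. *)

Definition omax (a b : option R) : option R :=
  match a, b with
  | None, _ => b
  | _, None => a
  | Some x, Some y => Some (Rmax x y)
  end.

Definition oadd (a : option R) (x : R) : option R :=
  match a with None => None | Some l => Some (l + x) end.

Definition mp_comb (alpha beta : option R) (a b : Romega) : nat -> option R :=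
  fun n => omax (oadd alpha (a n)) (oadd beta (b n)).

Definition mp_convex (A : Romega -> Prop) : Prop :=
  forall a b alpha beta, A a -> A b -> omax alpha beta = Some 0 ->
    exists c, A c /\ forall n, Some (c n) = mp_comb alpha beta a b n.

Definition is_mpcc (A : Romega -> Prop) : Prop :=
  (exists x, A x) /\ compact_in prod_open A /\ mp_convex A.

Definition mpcc : Type := { A : Romega -> Prop | is_mpcc A }.

Definition vietoris_subbase (W : mpcc -> Prop) : Prop :=
  exists U : Romega -> Prop, prod_open U /\
    ((forall A, W A <-> (forall x, proj1_sig A x -> U x)) \/
     (forall A, W A <-> (exists x, proj1_sig A x /\ U x))).

Definition vietoris_open : (mpcc -> Prop) -> Prop := generated_open vietoris_subbase.

(* Main.v *)
Require Import Defs.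
From Stdlib Require Import Reals List.
From Stdlib Require Import Lra Lia Classical ClassicalEpsilon IndefiniteDescription
  FunctionalExtensionality PropExtensionality ProofIrrelevance.
From Stdlib Require Cantor.
From Corelib Require Import ssreflect ssrfun ssrbool.

(* Write E for R^omega.  Each A in mpcc(E) contains its coordinatewise maximum, so translations
   split mpcc(E) as X0 x E with X0 = {A | max A = 0}; hence mpcc(E) ~ mpcc(E) x E, and it is enough
   to show mpcc(E) x E ~ E.  Suprema of countably many functions embed mpcc(E) as a closed subset
   of E, and Dugundji's formula, with max-plus combinations of sets in place of convex ones, extends
   the inverse of this embedding to E.  So mpcc(E) is homeomorphic to a retract K of E.

   K x E ~ E for every continuous retraction r : E -> K (Torunczyk).  Let V be the space of
   sequences (x_n) in E converging to a point of K, with uniform convergence; subtracting the limit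
   gives V ~ K x c_0(E).  Add to (x_n) sequences N_0 > N_1 > ... of bounds for its oscillation after
   each time.  Choosing the bounds after the whole sequence shows that these data form V x E.  Choosing
   x_0, N_0, x_1, N_1, ... in turn, where x_{n+1} ranges over an open set star-shaped about r(x_n),
   shows that they form E.  Thus K x Z ~ E for some Z, and
   K x E ~ K x (K x Z)^omega ~ (K x Z)^omega ~ E.

   All the spaces are first countable, so the argument is carried out with convergent sequences. *)

(** * Limits of real sequences, finite maxima, suprema *)

(** Being a retract of E is not enough, since a point is one: the factor E to be absorbed must come
    from the hyperspace itself, which is why translations are split off. The obstacle in the
    absorption is that converging to a point of K concerns whole tails, and that V carries uniform
    convergence, while E sees finitely many coordinates at a time. The bounds N_n remove it: N_0
    alone controls a weighted oscillation so strongly that convergence to a point of K ([ctl_cv]),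
    and uniform convergence of such sequences ([ctl_ucv]), follow from coordinatewise data. In the
    step-by-step order, each choice must range over a copy of E depending continuously on the past.
    A bound ranges over an open interval; x_{n+1} ranges over a star-shaped set, straightened along
    rays. The centre r(x_n) must satisfy the bounds in force, and it does because replacing x_n by
    r(x_n) does not increase the oscillation; here r o r = r is used. *)

Lemma Rabs_leE x e : Rabs x <= e <-> - e <= x <= e.
Proof. by split=> [|[? ?]]; [rewrite /Rabs; case: Rcase_abs; lra | apply: Rabs_le]. Qed.

Lemma Rabs_ltE x e : Rabs x < e <-> - e < x < e.
Proof. by split=> [|[? ?]]; [rewrite /Rabs; case: Rcase_abs; lra | apply: Rabs_def1]. Qed.

Lemma div_lt_1 a b : 0 < b -> (a / b < 1 <-> a < b).
Proof.
move=> Hb; have E : a = a / b * b by field; lra.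
split=> H; first by rewrite E; have := Rmult_lt_compat_r b _ _ Hb H; lra.
by apply: (Rmult_lt_reg_r b) => //; rewrite -E; lra.
Qed.

Lemma div_unit a b : 0 < b -> 0 <= a <= b -> 0 <= a / b <= 1.
Proof.
move=> Hb H; have E : a = a / b * b by field; lra.
by split; apply: (Rmult_le_reg_r b) => //; rewrite -E; lra.
Qed.

Definition ev (P : nat -> Prop) := exists N, forall n, (N <= n)%nat -> P n.

Lemma ev_and P Q : ev P -> ev Q -> ev (fun n => P n /\ Q n).
Proof.
move=> [N HN] [M HM]; exists (N + M)%nat => n Hn; split; [apply: HN | apply: HM]; lia.
Qed.

Lemma ev_mono (P Q : nat -> Prop) : (forall n, P n -> Q n) -> ev P -> ev Q.
Proof. by move=> H [N HN]; exists N => n /HN /H. Qed.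

Lemma ev_all (P : nat -> Prop) : (forall n, P n) -> ev P.
Proof. by move=> H; exists 0%nat. Qed.

Lemma ev_lt k (P : nat -> nat -> Prop) :
  (forall i, (i < k)%nat -> ev (P i)) -> ev (fun n => forall i, (i < k)%nat -> P i n).
Proof.
elim: k => [|k IH] H; first by exists 0%nat => n _ i; lia.
have [N HN] := ev_and _ _ (IH (fun i Hi =>
  H i (Nat.lt_lt_succ_r _ _ Hi))) (H k (Nat.lt_succ_diag_r k)).
exists N => n Hn i Hi; have [H1 H2] := HN n Hn.
case: (Nat.eq_dec i k) => [->//|Hne]; apply: H1; lia.
Qed.

Lemma not_ev (P : nat -> Prop) : ~ ev P -> forall N, exists n, (N <= n)%nat /\ ~ P n.
Proof.
move=> H N; apply: NNPP => H'; apply: H; exists N => n Hn.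
by apply: NNPP => HP; apply: H'; exists n.
Qed.

Lemma cvE u l : Un_cv u l <-> forall e, 0 < e -> ev (fun n => Rabs (u n - l) < e).
Proof. by split=> H e He; have [N HN] := H e He; exists N => n Hn; apply: HN. Qed.

Lemma cv_ev u l e : Un_cv u l -> 0 < e -> ev (fun n => Rabs (u n - l) < e).
Proof. by move=> /cvE; apply. Qed.

Lemma cv_const c : Un_cv (fun _ => c) c.
Proof. by apply/cvE => e He; exists 0%nat => n _; rewrite Rminus_diag Rabs_R0. Qed.

Lemma cv_ext_ev u v l : ev (fun n => u n = v n) -> Un_cv u l -> Un_cv v l.
Proof.
move=> H /cvE Hu; apply/cvE => e He.
by apply: ev_mono (ev_and _ _ H (Hu e He)) => n [<-].
Qed.

Lemma cv_opp u a : Un_cv u a -> Un_cv (fun n => - u n) (- a).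
Proof. exact: CV_opp. Qed.

Lemma cv_inv u a : a <> 0 -> Un_cv u a -> Un_cv (fun n => / u n) (/ a).
Proof.
move=> Ha; apply: (continuity_seq (fun x => / x)).
by apply: (continuity_pt_inv (fun x => x)) => //; apply: derivable_continuous_pt;
  apply: derivable_pt_id.
Qed.

Lemma cv_div u v a b : b <> 0 -> Un_cv u a -> Un_cv v b -> Un_cv (fun n => u n / v n) (a / b).
Proof. by move=> Hb Hu Hv; apply: CV_mult => //; apply: cv_inv. Qed.

Lemma cv_exp u a : Un_cv u a -> Un_cv (fun n => exp (u n)) (exp a).
Proof. apply: continuity_seq; exact: derivable_continuous_pt (derivable_pt_exp a). Qed.

Lemma cv_ln u a : 0 < a -> Un_cv u a -> Un_cv (fun n => ln (u n)) (ln a).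
Proof.
move=> Ha; apply: continuity_seq; apply: derivable_continuous_pt.
by exists (/ a); apply: derivable_pt_lim_ln.
Qed.

Lemma Rmax_close a b c d e :
  Rabs (a - c) <= e -> Rabs (b - d) <= e -> Rabs (Rmax a b - Rmax c d) <= e.
Proof.
rewrite /Rmax; case: Rle_dec => ?; case: Rle_dec => ?; move=> /Rabs_leE ? /Rabs_leE ?;
  apply/Rabs_leE; lra.
Qed.

Lemma Rmin_close a b c d e :
  Rabs (a - c) <= e -> Rabs (b - d) <= e -> Rabs (Rmin a b - Rmin c d) <= e.
Proof.
rewrite /Rmin; case: Rle_dec => ?; case: Rle_dec => ?; move=> /Rabs_leE ? /Rabs_leE ?;
  apply/Rabs_leE; lra.
Qed.

Lemma cv_max u v a b : Un_cv u a -> Un_cv v b -> Un_cv (fun n => Rmax (u n) (v n)) (Rmax a b).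
Proof.
move=> /cvE Hu /cvE Hv; apply/cvE => e He; have He2 : 0 < e / 2 by lra.
apply: ev_mono (ev_and _ _ (Hu _ He2) (Hv _ He2)) => n [H1 H2].
have := Rmax_close (u n) (v n) a b (e / 2); lra.
Qed.

Lemma cv_min u v a b : Un_cv u a -> Un_cv v b -> Un_cv (fun n => Rmin (u n) (v n)) (Rmin a b).
Proof.
move=> /cvE Hu /cvE Hv; apply/cvE => e He; have He2 : 0 < e / 2 by lra.
apply: ev_mono (ev_and _ _ (Hu _ He2) (Hv _ He2)) => n [H1 H2].
have := Rmin_close (u n) (v n) a b (e / 2); lra.
Qed.

Lemma cv_le u v a b : ev (fun n => u n <= v n) -> Un_cv u a -> Un_cv v b -> a <= b.
Proof.
move=> H /cvE Hu /cvE Hv; apply: Rnot_lt_le => Hab.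
have He : 0 < (a - b) / 2 by lra.
have [N HN] := ev_and _ _ H (ev_and _ _ (Hu _ He) (Hv _ He)).
have [H1 [/Rabs_def2 H2 /Rabs_def2 H3]] := HN N (Nat.le_refl _); lra.
Qed.

Lemma cv_squeeze0 u v : ev (fun n => Rabs (u n) <= v n) -> Un_cv v 0 -> Un_cv u 0.
Proof.
move=> H /cvE Hv; apply/cvE => e He.
apply: ev_mono (ev_and _ _ H (Hv _ He)) => n [H1 /Rabs_def2 H2].
apply: Rabs_def1; move: H1 => /Rabs_leE; lra.
Qed.

Lemma cv_dist u a : Un_cv (fun n => u n - a) 0 <-> Un_cv u a.
Proof.
by split=> /cvE H; apply/cvE => e /H; apply: ev_mono => n; rewrite Rminus_0_r.
Qed.

Definition incr (s : nat -> nat) := forall n, (s n < s (S n))%nat.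

Lemma incr_ge s : incr s -> forall n, (n <= s n)%nat.
Proof. by move=> H; elim=> [|n IH]; [lia | have := H n; lia]. Qed.

Lemma ev_sub s P : incr s -> ev P -> ev (fun n => P (s n)).
Proof. by move=> /incr_ge Hs [N HN]; exists N => n Hn; apply: HN; have := Hs n; lia. Qed.

Lemma cv_sub s u l : incr s -> Un_cv u l -> Un_cv (fun n => u (s n)) l.
Proof. by move=> Hs /cvE H; apply/cvE => e /H; apply: (ev_sub s (fun n => Rabs (u n - l) < e)). Qed.

Lemma incr_comp s t : incr s -> incr t -> incr (fun n => s (t n)).
Proof.
move=> Hs Ht n; have mono : forall a b, (a < b)%nat -> (s a < s b)%nat.
  by move=> a b; elim: b => [|b IH] Hab; [lia | have := Hs b; case: (Nat.eq_dec a b) => [->//|?];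
    have := IH; lia].
by apply: mono.
Qed.

Lemma frequently_incr (P : nat -> nat -> Prop) :
  (forall k N, exists n, (N <= n)%nat /\ P k n) -> exists s, incr s /\ forall k, P k (s k).
Proof.
move=> H.
have [nx nxP] := functional_choice _ (fun k => functional_choice _ (H k)).
pose s := fix s n := match n with 0 => nx 0%nat 0%nat | S m => nx n (S (s m)) end.
exists s; split=> [n|[|n]] /=; by [case: (nxP (S n) (S (s n))) | case: (nxP 0%nat 0%nat) | case: (nxP (S n) (S (s n)))].
Qed.

Lemma cv_not_sub u l : ~ Un_cv u l ->
  exists e s, 0 < e /\ incr s /\ forall n, e <= Rabs (u (s n) - l).
Proof.
move=> H.
have [e [He Hn]] : exists e, 0 < e /\ ~ ev (fun n => Rabs (u n - l) < e).
  apply: NNPP => H'; apply: H; apply/cvE => e He.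
  by apply: NNPP => H2; apply: H'; exists e.
have [s [Hs1 Hs2]] := frequently_incr (fun _ n => ~ _) (fun _ => not_ev _ Hn).
by exists e, s; split=> //; split=> // n; apply: Rnot_lt_le.
Qed.

Lemma inv_S_pos n : 0 < / INR (S n).
Proof. apply: Rinv_0_lt_compat; apply: lt_0_INR; lia. Qed.

Lemma inv_S_small e : 0 < e -> exists N, forall n, (N <= n)%nat -> / INR (S n) < e.
Proof.
move=> He; have [N HN] := INR_unbounded (/ e).
have He' := Rinv_0_lt_compat _ He.
exists N => n Hn; rewrite -(Rinv_inv e); have := le_INR _ _ Hn => Hle; apply: Rinv_lt_contravar.
  by apply: Rmult_lt_0_compat => //; apply: lt_0_INR; lia.
by rewrite S_INR; lra.
Qed.

Lemma cv_invS : Un_cv (fun n => / INR (S n)) 0.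
Proof.
apply/cvE => e He; have [N HN] := inv_S_small e He; exists N => n Hn.
rewrite Rminus_0_r Rabs_pos_eq; [exact: Rlt_le (inv_S_pos n) | exact: HN].
Qed.

(** The floor [0] costs nothing for norms and weights, and [dug_weight] relies on it to cut off
    negative terms. *)
Fixpoint bmax n (f : nat -> R) : R :=
  match n with 0 => 0 | S n => Rmax (bmax n f) (f n) end.

Lemma bmax_pos n f : 0 <= bmax n f.
Proof. by elim: n => [|n IH] /=; [lra | apply: Rle_trans IH (Rmax_l _ _)]. Qed.

Lemma bmax_ub n f i : (i < n)%nat -> f i <= bmax n f.
Proof.
elim: n => [|n IH] Hi /=; first lia.
case: (Nat.eq_dec i n) => [->|Hne]; first exact: Rmax_r.
by apply: Rle_trans (Rmax_l _ _); apply: IH; lia.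
Qed.

Lemma bmax_le n f c : 0 <= c -> (forall i, (i < n)%nat -> f i <= c) -> bmax n f <= c.
Proof.
move=> Hc; elim: n => [//|n IH] H /=; apply: Rmax_lub; last by apply: H.
by apply: IH => i Hi; apply: H; lia.
Qed.

Lemma bmax_lt n f c : 0 < c -> (forall i, (i < n)%nat -> f i < c) -> bmax n f < c.
Proof.
move=> Hc; elim: n => [//|n IH] H /=; apply: Rmax_lub_lt; last by apply: H.
by apply: IH => i Hi; apply: H; lia.
Qed.

Lemma bmax_mono n f g : (forall i, (i < n)%nat -> f i <= g i) -> bmax n f <= bmax n g.
Proof.
move=> H; apply: bmax_le; first exact: bmax_pos.
by move=> i Hi; apply: Rle_trans (H i Hi) (bmax_ub _ _ _ Hi).
Qed.

Lemma bmax_ext n f g : (forall i, (i < n)%nat -> f i = g i) -> bmax n f = bmax n g.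
Proof. by elim: n => [//|n IH] H /=; rewrite IH ?H // => i Hi; apply: H; lia. Qed.

Lemma bmax_cv n (f : nat -> nat -> R) g :
  (forall i, (i < n)%nat -> Un_cv (fun s => f s i) (g i)) ->
  Un_cv (fun s => bmax n (f s)) (bmax n g).
Proof.
elim: n => [|n IH] H /=; first exact: cv_const.
by apply: cv_max; [apply: IH => i Hi; apply: H; lia | apply: H].
Qed.

Lemma bmax_close n f g e : 0 <= e ->
  (forall i, (i < n)%nat -> Rabs (f i - g i) <= e) -> Rabs (bmax n f - bmax n g) <= e.
Proof.
move=> He; elim: n => [|n IH] H /=; first by rewrite Rminus_diag Rabs_R0.
by apply: Rmax_close; [apply: IH => i Hi; apply: H; lia | apply: H].
Qed.

Lemma bmax_scale n f c : 0 <= c -> bmax n (fun i => c * f i) = c * bmax n f.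
Proof.
move=> Hc; elim: n => [|n IH] /=; first by rewrite Rmult_0_r.
by rewrite IH RmaxRmult.
Qed.

Lemma bmax_max n f g : bmax n (fun i => Rmax (f i) (g i)) = Rmax (bmax n f) (bmax n g).
Proof.
elim: n => [|n IH] /=; first by rewrite /Rmax; case: Rle_dec.
rewrite IH -!Rmax_assoc; congr Rmax; by rewrite Rmax_assoc (Rmax_comm (bmax n g)) -Rmax_assoc.
Qed.

Lemma bmax_stab n m f : (n <= m)%nat -> (forall i, (n <= i)%nat -> f i = 0) -> bmax m f = bmax n f.
Proof.
move=> Hnm H; elim: m Hnm => [|m IH] Hnm; first by have ->: n = 0%nat by lia.
case: (Nat.eq_dec n (S m)) => [->//|Hne] /=.
rewrite IH ?H; try lia; apply: Rmax_left; exact: bmax_pos.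
Qed.

(* Unspecified when [f] is unbounded above on [D] or [D] is empty. *)
Definition sup {I : Type} (D : I -> Prop) (f : I -> R) : R :=
  epsilon (inhabits 0) (is_lub (fun v => exists i, D i /\ v = f i)).

Lemma sup_lub I (D : I -> Prop) f M : (exists i, D i) -> (forall i, D i -> f i <= M) ->
  is_lub (fun v => exists i, D i /\ v = f i) (sup D f).
Proof.
move=> [i Hi] HM; apply: epsilon_spec.
have [||l Hl] := completeness (fun v => exists i, D i /\ v = f i).
- by exists M => v [j [Hj ->]]; apply: HM.
- by exists (f i), i.
- by exists l.
Qed.

Lemma sup_ub I (D : I -> Prop) f M i : (forall i, D i -> f i <= M) -> D i -> f i <= sup D f.
Proof.
move=> HM Hi; have [H _] := sup_lub I D f M (ex_intro _ i Hi) HM.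
by apply: H; exists i.
Qed.

Lemma sup_le I (D : I -> Prop) f M : (exists i, D i) -> (forall i, D i -> f i <= M) -> sup D f <= M.
Proof.
move=> Hi HM; have [_ H] := sup_lub I D f M Hi HM.
by apply: H => v [j [Hj ->]]; apply: HM.
Qed.



Lemma sup_near I (D : I -> Prop) f M e : (exists i, D i) -> (forall i, D i -> f i <= M) ->
  0 < e -> exists i, D i /\ sup D f - e < f i.
Proof.
move=> Hi HM He; apply: NNPP => H.
suff : sup D f <= sup D f - e by lra.
apply: sup_le => // i HDi; apply: Rnot_lt_le => Hlt; apply: H; by exists i.
Qed.

Lemma sup_ext I (D : I -> Prop) f g : (forall i, D i -> f i = g i) -> sup D f = sup D g.
Proof.
move=> H; rewrite /sup; congr epsilon; apply: f_equal.
apply: functional_extensionality => v; apply: propositional_extensionality.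
by split=> -[i [Hi ->]]; exists i; split=> //; rewrite H.
Qed.

Lemma sup_close I (D : I -> Prop) f g M e : (exists i, D i) -> (forall i, D i -> g i <= M) ->
  (forall i, D i -> Rabs (f i - g i) <= e) -> Rabs (sup D f - sup D g) <= e.
Proof.
move=> Hi HM H.
have HM' i : D i -> f i <= M + e by move=> HD; have := HM i HD; have := H i HD => /Rabs_leE; lra.
apply/Rabs_leE; split.
- suff : sup D g <= sup D f + e by lra.
  apply: sup_le => // i HD; have := sup_ub I D f _ i HM' HD.
  by have := H i HD => /Rabs_leE; lra.
- suff : sup D f <= sup D g + e by lra.
  apply: sup_le => // i HD; have := sup_ub I D g _ i HM HD.
  by have := H i HD => /Rabs_leE; lra.
Qed.

(** * Sequential convergence spaces *)

(** A bare convergence relation suffices for products, powers and homeomorphisms; open sets of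
    [mpcc] return only at the end. *)
Record cspace := CSpace { pt :> Type; cv : (nat -> pt) -> pt -> Prop }.
Arguments cv {_} _ _.

Definition scont (S T : cspace) (f : S -> T) :=
  forall u x, cv u x -> cv (fun n => f (u n)) (f x).

Definition homeo (S T : cspace) := exists (f : S -> T) (g : T -> S),
  scont S T f /\ scont T S g /\ (forall x, g (f x) = x) /\ (forall y, f (g y) = y).

Definition Rcs := CSpace R Un_cv.
Definition prodc (S T : cspace) := CSpace (S * T)
  (fun u x => cv (fun n => fst (u n)) (fst x) /\ cv (fun n => snd (u n)) (snd x)).
Definition powc (S : cspace) := CSpace (nat -> S)
  (fun u x => forall k, cv (fun n => u n k) (x k)).
Definition subc (S : cspace) (P : S -> Prop) := CSpace {x | P x}
  (fun u x => cv (fun n => proj1_sig (u n)) (proj1_sig x)).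
Definition Ec := powc Rcs.

Lemma sig_eq {T} {P : T -> Prop} (x y : {z | P z}) : proj1_sig x = proj1_sig y -> x = y.
Proof. by case: x y => [x Hx] [y Hy] /= E; subst y; rewrite (proof_irrelevance _ Hx Hy). Qed.

Lemma homeo_refl S : homeo S S.
Proof. by exists (fun x => x), (fun x => x); split; [move=> u x | split; [move=> u x |]]. Qed.

Lemma homeo_sym S T : homeo S T -> homeo T S.
Proof. by move=> [f [g [? [? [? ?]]]]]; exists g, f. Qed.

Lemma homeo_trans S T U : homeo S T -> homeo T U -> homeo S U.
Proof.
move=> [f [g [Hf [Hg [Hgf Hfg]]]]] [f' [g' [Hf' [Hg' [Hgf' Hfg']]]]].
exists (fun x => f' (f x)), (fun y => g (g' y)); split; [|split; [|split]].
- by move=> u x H; apply: (Hf' (fun n => f (u n))); apply: Hf.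
- by move=> u x H; apply: (Hg (fun n => g' (u n))); apply: Hg'.
- by move=> x; rewrite Hgf'.
- by move=> y; rewrite Hfg.
Qed.

Lemma homeo_prod S S' T T' : homeo S S' -> homeo T T' -> homeo (prodc S T) (prodc S' T').
Proof.
move=> [f [g [Hf [Hg [Hgf Hfg]]]]] [f' [g' [Hf' [Hg' [Hgf' Hfg']]]]].
exists (fun x => (f (fst x), f' (snd x))), (fun x => (g (fst x), g' (snd x))); split; [|split;
  [|split]].
- by move=> u x [H1 H2]; split=> /=; [apply: (Hf (fun n => fst (u n))) | apply: (Hf' (fun n =>
  snd (u n)))].
- by move=> u x [H1 H2]; split=> /=; [apply: (Hg (fun n => fst (u n))) | apply: (Hg' (fun n =>
  snd (u n)))].
- by move=> [x y] /=; rewrite Hgf Hgf'.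
- by move=> [x y] /=; rewrite Hfg Hfg'.
Qed.

Lemma homeo_assoc S T U : homeo (prodc (prodc S T) U) (prodc S (prodc T U)).
Proof.
exists (fun x => (fst (fst x), (snd (fst x), snd x))), (fun x => ((fst x, fst (snd x)),
  snd (snd x))).
by split; [move=> u x [[? ?] ?] | split; [move=> u x [? [? ?]] | split;
  [case=> [[? ?] ?] | case=> [? [? ?]]]]].
Qed.

Lemma homeo_pow S T : homeo S T -> homeo (powc S) (powc T).
Proof.
move=> [f [g [Hf [Hg [Hgf Hfg]]]]].
exists (fun x k => f (x k)), (fun x k => g (x k)); split; [|split; [|split]].
- by move=> u x H k; apply: (Hf (fun n => u n k)).
- by move=> u x H k; apply: (Hg (fun n => u n k)).
- by move=> x; apply: functional_extensionality => k; rewrite Hgf.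
- by move=> x; apply: functional_extensionality => k; rewrite Hfg.
Qed.

Lemma homeo_pow_prod S T : homeo (powc (prodc S T)) (prodc (powc S) (powc T)).
Proof.
exists (fun x => (fun k => fst (x k), fun k => snd (x k))), (fun x k => (fst x k, snd x k));
  split; [|split; [|split]].
- by move=> u x H; split=> k; have [] := H k.
- by move=> u x [H1 H2] k; split; [apply: H1 | apply: H2].
- by move=> x; apply: functional_extensionality => k; rewrite -surjective_pairing.
- by move=> [x y].
Qed.

Lemma homeo_pow_pow S : homeo (powc (powc S)) (powc S).
Proof.
exists (fun x k => x (fst (Cantor.of_nat k)) (snd (Cantor.of_nat k))), (fun x i j =>
  x (Cantor.to_nat (i, j)));
  split; [|split; [|split]].
- by move=> u x H k; apply: H.
- by move=> u x H i j; apply: H.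
- by move=> x; apply: functional_extensionality => i; apply: functional_extensionality => j;
  rewrite Cantor.cancel_of_to.
- by move=> x; apply: functional_extensionality => k;
  rewrite -surjective_pairing Cantor.cancel_to_of.
Qed.

Lemma homeo_cons T : homeo (prodc T (powc T)) (powc T).
Proof.
exists (fun x k => match k with 0 => fst x | S k => snd x k end), (fun x => (x 0%nat, fun k =>
  x (S k)));
  split; [|split; [|split]].
- by move=> u x [H1 H2] [|k] //; apply: H2.
- by move=> u x H; split=> [|k]; apply: H.
- by move=> [x y].
- by move=> x; apply: functional_extensionality => -[].
Qed.

Lemma homeo_Ec_pow : homeo Ec (powc Ec).
Proof. exact: homeo_sym (homeo_pow_pow Rcs). Qed.

Lemma homeo_Ec_prod : homeo (prodc Ec Ec) Ec.
Proof.
apply: homeo_trans (homeo_sym _ _ homeo_Ec_pow).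
apply: homeo_trans (homeo_cons Ec).
exact: homeo_prod (homeo_refl _) homeo_Ec_pow.
Qed.

Lemma factor_absorb K Z : homeo (prodc K Z) Ec -> homeo (prodc K Ec) Ec.
Proof.
move=> H.
have HE : homeo Ec (prodc (powc K) (powc Z)).
  apply: homeo_trans homeo_Ec_pow _; apply: homeo_trans (homeo_pow_prod K Z).
  exact: homeo_pow (homeo_sym _ _ H).
apply: homeo_trans (homeo_prod _ _ _ _ (homeo_refl K) HE) _.
apply: homeo_trans (homeo_sym _ _ (homeo_assoc _ _ _)) _.
apply: homeo_trans (homeo_prod _ _ _ _ (homeo_cons K) (homeo_refl _)) _.
exact: homeo_sym HE.
Qed.

(* [A n b y v] says that [v] may follow the first [n] entries of [y]; the admissible values [v]
   are parametrized by [Z] through [F n], with inverse [G n]. *)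
Section Tower.
Variables (B Y Z : cspace) (y0 : Y).
Variable A : nat -> B -> (nat -> Y) -> Y -> Prop.
Variable F : nat -> B -> (nat -> Y) -> Y -> Z.
Variable G : nat -> B -> (nat -> Y) -> Z -> Y.

Definition agree n (y y' : nat -> Y) := forall k, (k < n)%nat -> y k = y' k.
Definition adm n b y := forall k, (k < n)%nat -> A k b y (y k).
Definition cv_upto n (ys : nat -> nat -> Y) (y : nat -> Y) :=
  forall k, (k < n)%nat -> cv (fun s => ys s k) (y k).

Hypothesis G_ext : forall n b y y' z, agree n y y' -> G n b y z = G n b y' z.
Hypothesis G_adm : forall n b y z, adm n b y -> A n b y (G n b y z).
Hypothesis FG : forall n b y z, adm n b y -> F n b y (G n b y z) = z.
Hypothesis GF : forall n b y v, adm n b y -> A n b y v -> G n b y (F n b y v) = v.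
Hypothesis F_cv : forall n bs b ys y vs v,
  cv bs b -> cv_upto n ys y -> (forall s, adm n (bs s) (ys s)) -> adm n b y ->
  (forall s, A n (bs s) (ys s) (vs s)) -> A n b y v ->
  cv vs v -> cv (fun s => F n (bs s) (ys s) (vs s)) (F n b y v).
Hypothesis G_cv : forall n bs b ys y zs z,
  cv bs b -> cv_upto n ys y -> (forall s, adm n (bs s) (ys s)) -> adm n b y ->
  cv zs z -> cv (fun s => G n (bs s) (ys s) (zs s)) (G n b y z).

(** Only the entries below [n] are meaningful; [G_ext] makes the others harmless. *)
Fixpoint hist b (z : nat -> Z) n : nat -> Y :=
  match n with
  | 0 => fun _ => y0
  | S n => fun k => if Nat.ltb k n then hist b z n k else G n b (hist b z n) (z n)
  end.

Definition bld b z n := hist b z (S n) n.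

Lemma hist_bld b z n : agree n (hist b z n) (bld b z).
Proof.
elim: n => [|n IH] k Hk; first lia.
rewrite /=; case: Nat.ltb_spec => Hkn; first by apply: IH.
have -> : k = n by lia. by rewrite /bld /= Nat.ltb_irrefl.
Qed.

Lemma bldE b z n : bld b z n = G n b (bld b z) (z n).
Proof. by rewrite {1}/bld /= Nat.ltb_irrefl; apply: G_ext; apply: hist_bld. Qed.

Lemma bld_adm b z n : adm n b (bld b z).
Proof.
elim: n => [|n IH] k Hk; first lia.
case: (Nat.eq_dec k n) => [->|Hne]; last by apply: IH; lia.
by rewrite bldE; apply: G_adm.
Qed.

(** [F] and [G] form a triangular change of coordinates: entry [n] is transformed with the earlier
    entries as parameters. So the inverse is built, and its continuity proved, by induction on
    prefixes. *)
Lemma tower : homeo (subc (prodc B (powc Y)) (fun by_ => forall n,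
  A n (fst by_) (snd by_) (snd by_ n)))
  (prodc B (powc Z)).
Proof.
have Hb bz : forall n, A n (fst bz) (bld (fst bz) (snd bz)) (bld (fst bz) (snd bz) n).
  by move=> n; apply: (bld_adm _ _ (S n)); lia.
exists (fun x => (fst (proj1_sig x), fun n =>
  F n (fst (proj1_sig x)) (snd (proj1_sig x)) (snd (proj1_sig x) n))).
exists (fun bz => exist (fun by_ => forall n, A n (fst by_) (snd by_) (snd by_ n)) (fst bz,
  bld (fst bz) (snd bz)) (Hb bz)).
split; [|split; [|split]].
- move=> u [x Hx] [/= H1 H2]; split=> //= n.
  apply: F_cv => //.
  + by move=> s k _; apply: (proj2_sig (u s)).
  + by move=> s; apply: (proj2_sig (u s)).
- move=> u [b z] [/= H1 H2]; split=> //=.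
  suff H n : cv_upto n (fun s => bld (fst (u s)) (snd (u s))) (bld b z) by move=> n;
    apply: (H (S n)); lia.
  elim: n => [|n IH] k Hk; first lia.
  case: (Nat.eq_dec k n) => [->|Hne]; last by apply: IH; lia.
  rewrite bldE.
  have -> : (fun s => bld (fst (u s)) (snd (u s)) n) =
    (fun s => G n (fst (u s)) (bld (fst (u s)) (snd (u s))) (snd (u s) n)).
    by apply: functional_extensionality => s; exact: bldE.
  by apply: G_cv => //; [move=> s; apply: bld_adm | apply: bld_adm].
- move=> [[b y] Hy]; apply: sig_eq => /=; congr pair.
  have H n : agree n (bld b (fun n => F n b y (y n))) y.
    elim: n => [|n IH] k Hk; first lia.
    case: (Nat.eq_dec k n) => [->|Hne]; last by apply: IH; lia.
    by rewrite bldE (G_ext n b _ y) // GF // => j _; apply: Hy.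
  by apply: functional_extensionality => n; apply: (H (S n)); lia.
- move=> [b z] /=; congr pair; apply: functional_extensionality => n.
  by rewrite bldE FG //; apply: bld_adm.
Qed.

End Tower.

(** * Topology of [Romega] *)

Definition near k e (x y : Romega) := forall i, (i < k)%nat -> Rabs (x i - y i) < e.

Lemma near_sym k e x y : near k e x y -> near k e y x.
Proof. by move=> H i /H; rewrite Rabs_minus_sym. Qed.

Lemma near_refl k e x : 0 < e -> near k e x x.
Proof. by move=> He i _; rewrite Rminus_diag Rabs_R0. Qed.

Lemma near_trans k e e' x y z : near k e x y -> near k e' y z -> near k (e + e') x z.
Proof.
move=> H H' i Hi; have := H i Hi; have := H' i Hi => /Rabs_ltE ? /Rabs_ltE ?; apply/Rabs_ltE; lra.
Qed.

Lemma near_le k k' e e' x y : (k' <= k)%nat -> e <= e' -> near k e x y -> near k' e' x y.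
Proof. move=> Hk He H i Hi; apply: Rlt_le_trans He; apply: H; lia. Qed.

Lemma cv_near (u : nat -> Romega) (x : Romega) k e :
  @cv Ec u x -> 0 < e -> ev (fun n => near k e (u n) x).
Proof. by move=> H He; apply: ev_lt => i _; exact: cv_ev (H i) He. Qed.

Lemma near_cv (u : nat -> Romega) (x : Romega) :
  (forall k e, 0 < e -> ev (fun n => near k e (u n) x)) -> @cv Ec u x.
Proof.
move=> H i; apply/cvE => e He; apply: ev_mono (H (S i) e He) => n; apply; lia.
Qed.

Definition Eopen (U : Romega -> Prop) :=
  forall x, U x -> exists k e, 0 < e /\ forall y, near k e x y -> U y.

Lemma prod_openE U : prod_open U <-> Eopen U.
Proof.
split=> H x /H.
- move=> [l [Hl [Hx HU]]].
  suff [k [e [He Hn]]] : exists k e, 0 < e /\ forall y, near k e x y -> forall B, In B l -> B y.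
    by exists k, e; split=> // y Hy; apply: HU; apply: Hn.
  elim: l Hl Hx {HU} => [|C l IH] Hl Hx; first by exists 0%nat, 1; split; [lra|].
  have [|B HB|k [e [He Hn]]] := IH; [by inversion Hl | by apply: Hx; right |].
  have [n [V [HV HC]]] : prod_subbase C by inversion Hl.
  have [d Hd] := HV (x n) (proj1 (HC x) (Hx C (or_introl (Logic.eq_refl _)))).
  exists (S (k + n)), (Rmin e d); split; first by apply: Rmin_pos => //; apply: cond_pos.
  move=> y Hy B [<-|HB].
  + apply/HC; apply: Hd; rewrite /disc Rabs_minus_sym.
    by apply: Rlt_le_trans (Rmin_r e d); apply: Hy; lia.
  + by apply: Hn HB; apply: near_le Hy; [lia | apply: Rmin_l].
- move=> [k [e [He Hn]]].
  exists (map (fun i y => disc (x i) (mkposreal e He) (y i)) (seq 0 k)); split; [|split].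
  + apply/Forall_forall => B /in_map_iff [i [<- _]].
    by exists i, (disc (x i) (mkposreal e He)); split; [apply: disc_P1 | move=> y].
  + by move=> B /in_map_iff [i [<- _]]; rewrite /disc Rminus_diag Rabs_R0.
  + move=> y Hy; apply: Hn => i Hi.
    have := Hy _ (in_map (fun i (y : Romega) =>
      disc (x i) (mkposreal e He) (y i)) _ i (proj2 (in_seq k 0 i) _)).
    by rewrite /disc /= Rabs_minus_sym; apply; lia.
Qed.

Lemma Eopen_near k e x : Eopen (near k e x).
Proof.
move=> y Hy; exists k.
have [d [Hd Hdi]] : exists d, 0 < d /\ forall i, (i < k)%nat -> Rabs (x i - y i) + d <= e.
  elim: k Hy => [|k IH] Hy; first by exists 1; split; [lra | move=> i; lia].
  have [i Hi|d [Hd H]] := IH; first by apply: Hy; lia.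
  have Hk := Hy k (Nat.lt_succ_diag_r k).
  exists (Rmin d (e - Rabs (x k - y k))); split; first by apply: Rmin_pos => //; lra.
  move=> i Hi; case: (Nat.eq_dec i k) => [->|Hne].
    by have := Rmin_r d (e - Rabs (x k - y k)); lra.
  have := H i; have := Rmin_l d (e - Rabs (x k - y k)) => ? H'; have := H' ltac:(lia); lra.
exists d; split=> // z Hz i Hi.
have := Hdi i Hi; have := Hz i Hi; have := Rabs_triang (x i - y i) (y i - z i).
have -> : x i - y i + (y i - z i) = x i - z i by ring. lra.
Qed.

Definition Eclosed (A : Romega -> Prop) :=
  forall x, (forall k e, 0 < e -> exists a, A a /\ near k e a x) -> A x.
Definition Ebounded (A : Romega -> Prop) := forall i, exists b, forall a, A a -> Rabs (a i) <= b.

Lemma list_max_ub (l : list nat) n : In n l -> (n <= list_max l)%nat.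
Proof. by have := proj1 (list_max_le l _) (Nat.le_refl _) => /Forall_forall H /H. Qed.

(** If [x] were outside [A], the complements of the closed boxes shrinking to [x] would cover [A].
    They increase with [n], so a finite subcover reduces to its largest index, and [A] would miss a
    neighbourhood of [x]. *)
Lemma compact_closed A : compact_in prod_open A -> Eclosed A.
Proof.
move=> HA x Hx; apply: NNPP => HnA.
have [||l Hl] := HA nat (fun n y => exists i, (i < n)%nat /\ / INR (S n) < Rabs (y i - x i)).
- move=> n; apply/prod_openE => y [i [Hi Hy]].
  exists (S i), (Rabs (y i - x i) - / INR (S n)); split; first lra.
  move=> z Hz; exists i; split=> //.
  have := Hz i (Nat.lt_succ_diag_r i); have := Rabs_triang (y i - z i) (z i - x i).
  have -> : y i - z i + (z i - x i) = y i - x i by ring. lra.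
- move=> y Hy.
  have [i Hi] : exists i, y i <> x i.
    apply: NNPP => H; apply: HnA; suff <- : y = x by [].
    by apply: functional_extensionality => i; apply: NNPP => Hi; apply: H; exists i.
  have [N HN] := inv_S_small (Rabs (y i - x i)) ltac:(apply: Rabs_pos_lt; lra).
  by exists (S (N + i)), i; split; [lia | apply: HN; lia].
- set n := list_max l.
  have [a [Ha Hna]] := Hx n (/ INR (S n)) (inv_S_pos n).
  have [m [Hm [i [Hi Hai]]]] := Hl a Ha.
  have Hmn := list_max_ub _ _ Hm.
  have := Hna i ltac:(rewrite /n; lia).
  have : / INR (S n) <= / INR (S m).
    by apply: Rinv_le_contravar; [apply: lt_0_INR; lia | apply: le_INR; rewrite /n; lia].
  lra.
Qed.

Lemma compact_bounded A : compact_in prod_open A -> Ebounded A.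
Proof.
move=> HA i.
have [||l Hl] := HA nat (fun n y => Rabs (y i) < INR n).
- move=> n; apply/prod_openE => y Hy; exists (S i), (INR n - Rabs (y i)); split; first lra.
  move=> z Hz; have := Hz i (Nat.lt_succ_diag_r i); have := Rabs_triang (y i) (z i - y i).
  rewrite Rabs_minus_sym; have -> : y i + (z i - y i) = z i by ring. lra.
- by move=> y _; have [n Hn] := INR_unbounded (Rabs (y i)); exists n.
- exists (INR (list_max l)) => a /Hl [n [Hn Ha]].
  have := le_INR _ _ (list_max_ub _ _ Hn); lra.
Qed.

Definition upd (x : Romega) n t : Romega := fun i => if Nat.eqb i n then t else x i.

(* A point whose finite prefixes have no finitely coverable neighbourhood is built coordinate
  by coordinate. *)
Section Tychonoff.
Variables (A : Romega -> Prop) (I : Type) (U : I -> Romega -> Prop).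
Hypothesis HAc : Eclosed A.
Hypothesis HAb : Ebounded A.
Hypothesis HUo : forall i, Eopen (U i).
Hypothesis HUc : forall x, A x -> exists i, U i x.

Let FC (T : Romega -> Prop) := exists l : list I, forall x, A x -> T x -> exists i, In i l /\ U i x.

Let FC_cup T T1 T2 : (forall x, T x -> T1 x \/ T2 x) -> FC T1 -> FC T2 -> FC T.
Proof.
move=> H [l1 H1] [l2 H2]; exists (l1 ++ l2) => x Hx /H [/H1|/H2] /(_ Hx) [i [Hi HU]];
  exists i; split=> //; apply/in_app_iff; by [left | right].
Qed.

Let FC_sub T T1 : (forall x, T x -> T1 x) -> FC T1 -> FC T.
Proof. by move=> H [l Hl]; exists l => x Hx /H; apply: Hl. Qed.

Let bad n x := forall e, 0 < e -> ~ FC (near n e x).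

Let near_upd n e x t y : near (S n) e (upd x n t) y <-> near n e x y /\ Rabs (t - y n) < e.
Proof.
rewrite /upd; split=> [H|[H1 H2] i Hi].
- split; last by have := H n (Nat.lt_succ_diag_r n); rewrite Nat.eqb_refl.
  by move=> i Hi; have := H i (Nat.lt_lt_succ_r _ _ Hi); case: Nat.eqb_spec => [?|//]; lia.
- by case: Nat.eqb_spec => [->//|?]; apply: H1; lia.
Qed.

(** The supremum argument for compactness of an interval, applied to coordinate [n]: a finite cover
    of the part below the supremum [s] extends past [s] through the slab around [s]. *)
Let bad_next n x : bad n x -> exists t, bad (S n) (upd x n t).
Proof.
move=> Hb; apply: NNPP => Hno.
have Ht t : exists e, 0 < e /\ FC (near (S n) e (upd x n t)).
  apply: NNPP => H; apply: Hno; exists t => e He HF; apply: H; by exists e.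
have [b Hbd] := HAb n.
pose T t := t <= b /\ exists e, 0 < e /\ FC (fun y => near n e x y /\ y n <= t).
(* No point of [A] has its [n]-th coordinate this low, so the empty list covers. *)
have HT0 : T (- Rabs b - 1).
  split; first by rewrite /Rabs; case: Rcase_abs; lra.
  exists 1; split; first lra. exists nil => y /Hbd Hy [_ H]; exfalso.
  move: Hy H; rewrite /Rabs; case: Rcase_abs; case: Rcase_abs; lra.
have [|| s [Hs1 Hs2]] := completeness T; [by exists b => t [] | by exists (- Rabs b - 1) |].
have [e [He HF]] := Ht s.
have [t [Htb [e' [He' HF']]] Hts] : exists2 t, T t & s - e < t.
  apply: NNPP => H; suff : s <= s - e by lra.
  apply: Hs2 => t HTt; apply: Rnot_lt_le => Hlt; apply: H; by exists t.
have Hext : FC (fun y => near n (Rmin e e') x y /\ y n <= s + e / 2).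
{ apply: FC_cup HF HF' => y [Hy Hyn].
  case: (Rle_lt_dec (y n) t) => Hyt.
  - by right; split=> //; apply: near_le Hy => //; apply: Rmin_r.
  - left; apply/near_upd; split; first by apply: near_le Hy => //; apply: Rmin_l.
    by apply/Rabs_ltE; lra. }
have Hmin : 0 < Rmin e e' by apply: Rmin_pos.
(* Either [s + e / 2] belongs to [T], beyond its supremum, or it exceeds the bound [b] and the cover
   reaches all of [A] near [x], so that [x] is not bad. *)
case: (Rle_lt_dec (s + e / 2) b) => Hsb.
- suff : s + e / 2 <= s by lra.
  by apply: Hs1; split=> //; exists (Rmin e e').
- apply: (Hb _ Hmin); have [l Hl] := Hext; exists l => y Hy Hn; apply: Hl => //; split=> //.
  have := Hbd y Hy => /Rabs_leE; lra.
Qed.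

Let st := fix st n : Romega := match n with
  | 0 => fun _ => 0
  | S n => upd (st n) n (epsilon (inhabits 0) (fun t => bad (S n) (upd (st n) n t))) end.

Lemma tychonoff_cover : exists l : list I, forall x, A x -> exists i, In i l /\ U i x.
Proof.
apply: NNPP => Hno.
have Hst n : bad n (st n).
  elim: n => [|n IH] /=; last by exact: (epsilon_spec (inhabits 0) _ (bad_next n (st n) IH)).
  by move=> e He [l Hl]; apply: Hno; exists l => x Hx; apply: Hl => // i; lia.
pose x n := st (S n) n.
have Hx n i : (i < n)%nat -> st n i = x i.
  elim: n => [|n IH] Hi; first lia.
  rewrite /= {1}/upd; case: Nat.eqb_spec => [->|Hne]; last by apply: IH; lia.
  by rewrite /x /= /upd Nat.eqb_refl.
have Hbx n e : 0 < e -> ~ FC (near n e x).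
  move=> He HF; apply: (Hst n e He); apply: FC_sub HF => y Hy i Hi.
  by rewrite -(Hx n) //; apply: Hy.
have HAx : A x.
  apply: HAc => k e He; apply: NNPP => H; apply: (Hbx k e He).
  exists nil => y Hy Hn; exfalso; apply: H; exists y; split=> //; exact: near_sym.
have [i Hi] := HUc x HAx.
have [k [e [He Hn]]] := HUo i x Hi.
by apply: (Hbx k e He); exists (i :: nil) => y _ /Hn Hy; exists i; split=> //; left.
Qed.

End Tychonoff.

Lemma compactE A : compact_in prod_open A <-> Eclosed A /\ Ebounded A.
Proof.
split=> [H|[H1 H2] I U HU HA]; first by split; [apply: compact_closed | apply: compact_bounded].
by apply: tychonoff_cover => // i; apply/prod_openE.
Qed.

(** Without a cluster point, every point of [A] has a box that the sequence eventually leaves;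
    finitely many such boxes cover [A], and after the last leaving time the sequence has nowhere to
    be. *)
Lemma compact_subseq A (u : nat -> Romega) : compact_in prod_open A -> (forall n, A (u n)) ->
  exists s x, incr s /\ A x /\ @cv Ec (fun n => u (s n)) x.
Proof.
move=> HA Hu.
have [x [Hx Hfr]] : exists x, A x /\ forall k e N, 0 < e -> exists n, (N <= n)%nat /\
  near k e x (u n).
{ apply: NNPP => Hno.
  (* An index is a box, given by centre, number of coordinates and radius, with a time from which
     the sequence avoids it. *)
  pose I := {i : Romega * (nat * R * nat) | forall n, (snd (snd i) <= n)%nat ->
    ~ near (fst (fst (snd i))) (snd (fst (snd i))) (fst i) (u n)}.
  have [||l Hl] := HA I (fun i => near (fst (fst (snd (proj1_sig i)))) (snd (fst (snd (proj1_sig i)))) (fst (proj1_sig i))).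
  - by move=> i; apply/prod_openE; apply: Eopen_near.
  - move=> x Hx; apply: NNPP => H; apply: Hno; exists x; split=> // k e N He.
    apply: NNPP => H'; apply: H.
    have Hi : forall n, (N <= n)%nat -> ~ near k e x (u n) by move=> n Hn Hnr; apply: H'; exists n.
    by exists (exist _ (x, (k, e, N)) Hi); apply: near_refl.
  - set N := list_max (map (fun i : I => snd (snd (proj1_sig i))) l).
    have [i [Hi Hnr]] := Hl _ (Hu N).
    apply: (proj2_sig i N) => //.
    exact: list_max_ub (in_map (fun i : I => snd (snd (proj1_sig i))) l i Hi). }
have [s [Hs Hsn]] := frequently_incr (fun k n => near k (/ INR (S k)) x (u n))
  (fun k N => Hfr k _ N (inv_S_pos k)).
exists s, x; split=> //; split=> //; apply: near_cv => k e He.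
have [N HN] := inv_S_small e He; exists (k + N)%nat => n Hn.
apply: near_sym; apply: near_le (Hsn n); [lia | apply: Rlt_le; apply: HN; lia].
Qed.

Lemma closed_cv A u x : Eclosed A -> (forall n, A (u n)) -> @cv Ec u x -> A x.
Proof.
move=> HA Hu Hc; apply: HA => k e He.
have [N HN] := cv_near u x k e Hc He.
by exists (u N); split=> //; apply: HN.
Qed.

Lemma bounded_subseq (u : nat -> Romega) : (forall i, exists b, forall n, Rabs (u n i) <= b) ->
  exists s x, incr s /\ @cv Ec (fun n => u (s n)) x.
Proof.
move=> Hb.
have [b bP] := functional_choice _ Hb.
have HA : compact_in prod_open (fun x => forall i, Rabs (x i) <= b i).
  apply/compactE; split=> [x Hx i|i]; last by exists (b i).
  apply: Rnot_lt_le => Hlt.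
  have [a [Ha Hn]] := Hx (S i) (Rabs (x i) - b i) ltac:(lra).
  have := Ha i; have := Hn i (Nat.lt_succ_diag_r i); have := Rabs_triang (a i) (x i - a i).
  rewrite Rabs_minus_sym; have -> : a i + (x i - a i) = x i by ring. lra.
have [s [x [Hs [_ Hx]]]] := compact_subseq _ u HA (fun n i => bP i n).
by exists s, x.
Qed.

Lemma unit_interval_subseq (t : nat -> R) : (forall n, 0 <= t n <= 1) ->
  exists s x, incr s /\ 0 <= x <= 1 /\ Un_cv (fun n => t (s n)) x.
Proof.
move=> Ht.
have [|s [x [Hs Hx]]] := bounded_subseq (fun n _ => t n).
  by move=> i; exists 1 => n; apply/Rabs_leE; have := Ht n; lra.
exists s, (x 0%nat); split=> //; split; last exact: (Hx 0%nat).
split; [apply: cv_le _ (cv_const 0) (Hx 0%nat) | apply: cv_le _ (Hx 0%nat) (cv_const 1)];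
  by apply: ev_all => n; have := Ht (s n); lra.
Qed.

(** * Suprema under convergence of sets *)

(** The third and fourth premises are lower and upper Kuratowski convergence along subsequences. If
    the suprema stay [e] away along a subsequence, the lower one forces them above the limit, and
    then near-maximizers cluster at a point of [D] with too large a value. *)
Lemma sup_conv (T : cspace) (Ds : nat -> T -> Prop) (D : T -> Prop) fs f :
  (exists x, D x) -> (forall s, exists x, Ds s x) ->
  (forall σ x, incr σ -> D x -> exists τ xs, incr τ /\ (forall s, Ds (σ (τ s)) (xs s)) /\
    cv xs x) ->
  (forall σ xs, incr σ -> (forall s, Ds (σ s) (xs s)) ->
     exists τ x, incr τ /\ D x /\ cv (fun s => xs (τ s)) x) ->
  (forall σ xs x, incr σ -> (forall s, Ds (σ s) (xs s)) -> D x -> cv xs x ->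
     Un_cv (fun s => fs (σ s) (xs s)) (f x)) ->
  (forall s, exists M, forall x, Ds s x -> fs s x <= M) -> (exists M, forall x, D x -> f x <= M) ->
  Un_cv (fun s => sup (Ds s) (fs s)) (sup D f).
Proof.
move=> HD HDs Hlow Hup Hf Hbs [M HM]; apply: NNPP => /cv_not_sub [e [σ [He [Hσ Hne]]]].
have [x [Hx Hfx]] := sup_near _ D f M (e / 2) HD HM ltac:(lra).
have [τ [xs [Hτ [Hxs Hcx]]]] := Hlow σ x Hσ Hx.
have Hστ := incr_comp _ _ Hσ Hτ.
have [N HN] := cv_ev _ _ (e / 2) (Hf _ xs x Hστ Hxs Hx Hcx) ltac:(lra).
have Hbig n : (N <= n)%nat -> sup D f + e <= sup (Ds (σ (τ n))) (fs (σ (τ n))).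
  move=> /HN /Rabs_ltE H1; have [M' HM'] := Hbs (σ (τ n)).
  have := sup_ub _ _ _ M' _ HM' (Hxs n); have := Hne (τ n).
  rewrite /Rabs; case: Rcase_abs => ?; lra.
pose ρ n := σ (τ (N + n)%nat).
have Hρ : incr ρ.
  move=> n; rewrite /ρ Nat.add_succ_r; exact: Hστ.
have Hch n : exists y, Ds (ρ n) y /\ sup D f + e / 2 <= fs (ρ n) y.
  have [M' HM'] := Hbs (ρ n).
  have [y [Hy Hfy]] := sup_near _ _ _ M' (e / 2) (HDs (ρ n)) HM' ltac:(lra).
  exists y; split=> //; have := Hbig (N + n)%nat (Nat.le_add_r _ _); rewrite -/(ρ n); lra.
have [ys Hys] := functional_choice _ Hch.
have [τ' [y [Hτ' [Hy Hcy]]]] := Hup ρ ys Hρ (fun n => proj1 (Hys n)).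
have Hlim := Hf _ (fun n => ys (τ' n)) y (incr_comp _ _ Hρ Hτ') (fun n =>
  proj1 (Hys (τ' n))) Hy Hcy.
have : sup D f + e / 2 <= f y.
  by apply: cv_le _ (cv_const _) Hlim; apply: ev_all => n; exact: proj2 (Hys (τ' n)).
have := sup_ub _ D f M y HM Hy; lra.
Qed.

Definition I01 t := 0 <= t <= 1.

Lemma sup01_conv (fs : nat -> R -> R) f :
  (forall ts t, (forall s, I01 (ts s)) -> I01 t -> Un_cv ts t ->
     forall σ, incr σ -> Un_cv (fun s => fs (σ s) (ts s)) (f t)) ->
  (forall s, exists M, forall x, I01 x -> fs s x <= M) -> (exists M, forall x, I01 x -> f x <= M) ->
  Un_cv (fun s => sup I01 (fs s)) (sup I01 f).
Proof.
move=> Hf Hbs HM.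
have H0 : exists x, I01 x by exists 0; rewrite /I01; lra.
apply: (sup_conv Rcs (fun _ => I01) I01) => //.
- by move=> σ x _ Hx; exists (fun n => n), (fun _ => x); split; [move=> n; lia | split=> //;
  exact: cv_const].
- move=> σ xs _ Hxs; have [τ [x [H1 [H2 H3]]]] := unit_interval_subseq xs Hxs; by exists τ, x.
- by move=> σ xs x Hσ Hxs Hx Hc; apply: (Hf xs x Hxs Hx Hc).
Qed.

(** * Radial reparametrization of star-shaped sets *)

Definition scale (s : R) (d : Romega) : Romega := fun i => s * d i.
Definition eadd (x y : Romega) : Romega := fun i => x i + y i.
Definition esub (x y : Romega) : Romega := fun i => x i - y i.

Lemma eadd_cv (u v : nat -> Romega) (x y : Romega) : @cv Ec u x -> @cv Ec v y ->
  @cv Ec (fun n => eadd (u n) (v n)) (eadd x y).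
Proof. by move=> H H' i; exact: CV_plus (H i) (H' i). Qed.

Lemma esub_cv (u v : nat -> Romega) (x y : Romega) : @cv Ec u x -> @cv Ec v y ->
  @cv Ec (fun n => esub (u n) (v n)) (esub x y).
Proof. by move=> H H' i; exact: CV_minus (H i) (H' i). Qed.

Lemma scale_cv s t (u : nat -> Romega) (x : Romega) : Un_cv s t -> @cv Ec u x ->
  @cv Ec (fun n => scale (s n) (u n)) (scale t x).
Proof. by move=> H H' i; exact: CV_mult H (H' i). Qed.

Lemma eaddC x y : eadd x y = eadd y x.
Proof. by apply: functional_extensionality => i; rewrite /eadd Rplus_comm. Qed.
Lemma eadd_esub x y : eadd x (esub y x) = y.
Proof. by apply: functional_extensionality => i; rewrite /eadd /esub; ring. Qed.
Lemma esub_eadd x y : esub (eadd x y) x = y.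
Proof. by apply: functional_extensionality => i; rewrite /eadd /esub; ring. Qed.

Definition cconv (Qs : nat -> Romega -> R) (Q : Romega -> R) :=
  forall (ds : nat -> Romega) (d : Romega), @cv Ec ds d -> Un_cv (fun s => Qs s (ds s)) (Q d).

(** A weakened Minkowski functional: monotone along rays rather than homogeneous, so that [{Q < 1}]
    is an open star-shaped neighbourhood of [0]. *)
Definition gauge (Q : Romega -> R) :=
  cconv (fun _ => Q) Q /\ (forall d, 0 <= Q d) /\ Q (fun _ => 0) < 1 /\
  (forall d s t, 0 <= s <= t -> Q (scale s d) <= Q (scale t d)).

(* If [s = ray_root Q u] then [u] is the image of [s u] under [d -> d / (1 - Q d)],
  which maps [{Q < 1}] onto [Romega]. *)
Definition ray_root (Q : Romega -> R) (u : Romega) : R :=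
  sup (fun s => 0 <= s <= 1 /\ s + Q (scale s u) <= 1) (fun s => s).

Lemma scale0 u : scale 0 u = (fun _ => 0).
Proof. by apply: functional_extensionality => i; rewrite /scale Rmult_0_l. Qed.

(** [s + Q (scale s u)] is continuous and strictly increasing for [s >= 0], below [1] at [s = 0] and
    at least [1] at [s = 1], so it takes the value [1] exactly once on [(0, 1]]. *)
Lemma ray_root_spec Q u : gauge Q -> 0 < ray_root Q u <= 1 /\
  ray_root Q u + Q (scale (ray_root Q u) u) = 1.
Proof.
move=> [Qc [Qp [Q0 Qm]]].
pose D s := 0 <= s <= 1 /\ s + Q (scale s u) <= 1.
have D0 : exists s, D s by exists 0; rewrite /D scale0; lra.
have DM s : D s -> s <= 1 by move=> [? _]; lra.
set s := ray_root Q u.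
have Hs1 : s <= 1 by apply: sup_le.
have Hs0 : 0 <= s by apply: (sup_ub _ D (fun s => s) 1 0 DM); rewrite /D scale0; lra.
have Hlim v t : Un_cv v t -> Un_cv (fun n => v n + Q (scale (v n) u)) (t + Q (scale t u)).
  move=> H; apply: CV_plus => //.
  by apply: (Qc (fun n => scale (v n) u)); apply: (scale_cv v t (fun _ => u)) => // i;
    exact: cv_const.
have Hle : s + Q (scale s u) <= 1.
  have Hv n : exists t, D t /\ s - / INR (S n) < t.
    exact: (sup_near _ D (fun s => s) 1 _ D0 DM (inv_S_pos n)).
  have [v vP] := functional_choice _ Hv.
  have Hvs : Un_cv v s.
    apply/cv_dist; apply: cv_squeeze0 _ cv_invS; apply: ev_all => n.
    have [H1 H2] := vP n; have := sup_ub _ D (fun s => s) 1 _ DM H1;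
      rewrite -/(ray_root Q u) -/s => ?.
    by apply/Rabs_leE; have := inv_S_pos n; lra.
  by apply: cv_le _ (Hlim _ _ Hvs) (cv_const 1); apply: ev_all => n; have [[_ H] _] := vP n.
have Hge : 1 <= s + Q (scale s u).
  case: (Rle_lt_dec 1 s) => H1; first by have := Qp (scale s u); lra.
  have Hv : Un_cv (fun n => s + / INR (S n)) s.
    by rewrite -{2}(Rplus_0_r s); apply: CV_plus (cv_const s) cv_invS.
  apply: cv_le _ (cv_const 1) (Hlim _ _ Hv).
  have [N HN] := inv_S_small (1 - s) ltac:(lra).
  exists N => n /HN Hn; have := inv_S_pos n => Hp; apply: Rnot_lt_le => Hlt.
  have : s + / INR (S n) <= s by apply: (sup_ub _ D (fun s => s) 1 _ DM); rewrite /D; lra.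
  lra.
split; last lra.
split=> //; case: Hs0 => // E; move: Hge; rewrite -E scale0; lra.
Qed.

Lemma ray_root_lt Q u s : gauge Q -> 0 <= s -> s + Q (scale s u) < 1 -> s < ray_root Q u.
Proof.
move=> HQ Hs H; have [H1 H2] := ray_root_spec Q u HQ; apply: Rnot_le_lt => Hle.
have [_ [_ [_ Qm]]] := HQ; have := Qm u (ray_root Q u) s ltac:(lra); lra.
Qed.

Lemma ray_root_gt Q u s : gauge Q -> 0 <= s -> 1 < s + Q (scale s u) -> ray_root Q u < s.
Proof.
move=> HQ Hs H; have [H1 H2] := ray_root_spec Q u HQ; apply: Rnot_le_lt => Hle.
have [_ [_ [_ Qm]]] := HQ; have := Qm u s (ray_root Q u) ltac:(lra); lra.
Qed.

Lemma ray_root_unique Q u s : gauge Q -> 0 <= s -> s + Q (scale s u) = 1 -> ray_root Q u = s.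
Proof.
move=> HQ Hs H; have [H1 H2] := ray_root_spec Q u HQ; have [_ [_ [_ Qm]]] := HQ.
case: (Rtotal_order (ray_root Q u) s) => [Hlt|[//|Hlt]].
- have := Qm u (ray_root Q u) s ltac:(lra); lra.
- have := Qm u s (ray_root Q u) ltac:(lra); lra.
Qed.

Lemma ray_root_cv Qs Q (us : nat -> Romega) (u : Romega) : (forall s, gauge (Qs s)) -> gauge Q ->
  cconv Qs Q ->
  @cv Ec us u -> Un_cv (fun s => ray_root (Qs s) (us s)) (ray_root Q u).
Proof.
move=> HQs HQ Hc Hu; have [[Hp H1] H2] := ray_root_spec Q u HQ; have [_ [_ [_ Qm]]] := HQ.
set r0 := ray_root Q u in Hp H1 H2 *.
have Hlim t : Un_cv (fun s => t + Qs s (scale t (us s))) (t + Q (scale t u)).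
  apply: CV_plus (cv_const t) _; apply: (Hc (fun s => scale t (us s))).
  exact: (scale_cv (fun _ => t)) (cv_const t) Hu.
apply/cvE => e He.
(* Strict inequalities at one point on each side of the root persist for large [s] and trap the
   nearby roots. The [Rmax 0] keeps [a] in the range where [Q] is monotone along rays. *)
pose a := Rmax 0 (r0 - e / 2); pose b := r0 + e / 2.
have Ha : 0 <= a < r0 /\ r0 - e / 2 <= a by rewrite /a /Rmax; case: Rle_dec; lra.
have Ha1 : a + Q (scale a u) < 1 by have := Qm u a r0 ltac:(lra); lra.
have Hb1 : 1 < b + Q (scale b u) by have := Qm u r0 b ltac:(rewrite /b; lra); rewrite /b; lra.
have HA := cv_ev _ _ (1 - (a + Q (scale a u))) (Hlim a) ltac:(lra).
have HB := cv_ev _ _ (b + Q (scale b u) - 1) (Hlim b) ltac:(lra).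
apply: ev_mono (ev_and _ _ HA HB) => s [/Rabs_ltE Has /Rabs_ltE Hbs].
have := ray_root_lt (Qs s) (us s) a (HQs s) ltac:(lra) ltac:(lra).
have := ray_root_gt (Qs s) (us s) b (HQs s) ltac:(rewrite /b; lra) ltac:(lra).
by rewrite /b => ? ?; apply/Rabs_ltE; lra.
Qed.

(** * Coordinates on an open interval *)

(** The log-odds coordinate, jointly continuous in the point and both endpoints. *)
Definition enc L U v := ln ((v - L) / (U - v)).
Definition dec L U z := (L + exp z * U) / (1 + exp z).

Lemma dec_bd L U z : L < U -> L < dec L U z < U.
Proof.
move=> HLU; have Hz := exp_pos z; rewrite /dec.
have -> : (L + exp z * U) / (1 + exp z) = L + exp z * (U - L) / (1 + exp z) by field; lra.
have H : 0 < exp z * (U - L) / (1 + exp z).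
  by apply: Rdiv_lt_0_compat; [apply: Rmult_lt_0_compat |]; lra.
split; first lra.
have -> : U = L + exp z * (U - L) / (1 + exp z) + (U - L) / (1 + exp z) by field; lra.
have : 0 < (U - L) / (1 + exp z) by apply: Rdiv_lt_0_compat; lra.
have -> : (L + exp z * (U - L) / (1 + exp z) + (U - L) / (1 + exp z) - L) = U - L by field; lra.
lra.
Qed.

Lemma enc_dec L U z : L < U -> enc L U (dec L U z) = z.
Proof.
move=> HLU; have Hz := exp_pos z; rewrite /enc; transitivity (ln (exp z)); last exact: ln_exp.
congr ln.
rewrite /dec; field; split; [lra|].
have -> : U * (1 + exp z) - (L + exp z * U) = U - L by ring. lra.
Qed.

Lemma dec_enc L U v : L < v < U -> dec L U (enc L U v) = v.
Proof.
move=> H; rewrite /dec /enc exp_ln; last by field; lra.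
by apply: Rdiv_lt_0_compat; lra.
Qed.

Lemma enc_cv Ls L Us U vs v : L < v < U -> Un_cv Ls L -> Un_cv Us U -> Un_cv vs v ->
  Un_cv (fun s => enc (Ls s) (Us s) (vs s)) (enc L U v).
Proof.
move=> H HL HU Hv; apply: cv_ln; first by apply: Rdiv_lt_0_compat; lra.
by apply: cv_div; [lra | exact: CV_minus | exact: CV_minus].
Qed.

Lemma dec_cv Ls L Us U zs z : Un_cv Ls L -> Un_cv Us U -> Un_cv zs z ->
  Un_cv (fun s => dec (Ls s) (Us s) (zs s)) (dec L U z).
Proof.
move=> HL HU Hz; have He := cv_exp _ _ Hz; have := exp_pos z => ?.
apply: cv_div; [lra | | exact: CV_plus (cv_const 1) He].
by apply: CV_plus => //; apply: CV_mult.
Qed.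

Lemma Ecv_sub (u : nat -> Romega) (x : Romega) σ : incr σ -> @cv Ec u x -> @cv Ec (fun s =>
  u (σ s)) x.
Proof. by move=> Hσ H i; exact: cv_sub Hσ (H i). Qed.

Lemma Ecv_const (x : Romega) : @cv Ec (fun _ => x) x.
Proof. by move=> i; exact: cv_const. Qed.

(** * Absorbing a retract of [Romega] *)

Definition seg (p y : Romega) t : Romega := eadd p (scale t (esub y p)).

Lemma seg_self p t : seg p p t = p.
Proof. by apply: functional_extensionality => i; rewrite /seg /eadd /scale /esub; ring. Qed.

Lemma seg1 p y : seg p y 1 = y.
Proof. by apply: functional_extensionality => i; rewrite /seg /eadd /scale /esub; ring. Qed.

Lemma seg_cv (ps ys : nat -> Romega) (p y : Romega) ts t : @cv Ec ps p -> @cv Ec ys y ->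
  Un_cv ts t ->
  @cv Ec (fun s => seg (ps s) (ys s) (ts s)) (seg p y t).
Proof. by move=> Hp Hy Ht; apply: eadd_cv => //; apply: scale_cv => //; apply: esub_cv. Qed.

Definition clamp z := Rmin 1 (Rmax 0 z).

Lemma clamp_bd z : 0 <= clamp z <= 1.
Proof. rewrite /clamp /Rmin /Rmax; case: Rle_dec; case: Rle_dec; lra. Qed.

Lemma clamp_mono a b : a <= b -> clamp a <= clamp b.
Proof. by move=> H; apply: Rle_min_compat_l; apply: Rle_max_compat_l. Qed.

Lemma clamp_neg z : z <= 0 -> clamp z = 0.
Proof. move=> H; rewrite /clamp Rmax_left // Rmin_right; lra. Qed.

Lemma clamp_half z : clamp z < 1 / 2 -> z < 1 / 2.
Proof.
move=> H; apply: Rnot_le_lt => Hz; suff : 1 / 2 <= clamp z by lra.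
by apply: Rmin_glb; [lra | apply: Rle_trans Hz (Rmax_r _ _)].
Qed.

Lemma clamp_close a b e : 0 <= e -> Rabs (a - b) <= e -> Rabs (clamp a - clamp b) <= e.
Proof.
move=> He H; rewrite /clamp; apply: Rmin_close; first by rewrite Rminus_diag Rabs_R0.
by apply: Rmax_close => //; rewrite Rminus_diag Rabs_R0.
Qed.

Lemma clamp_cv u a : Un_cv u a -> Un_cv (fun n => clamp (u n)) (clamp a).
Proof. by move=> H; exact: cv_min (cv_const 1) (cv_max _ _ _ _ (cv_const 0) H). Qed.

Lemma one_minus_neq q : q < 1 -> 1 - q <> 0.
Proof. lra. Qed.

Lemma Rlt_plus_exp a b : a < a + exp b.
Proof. by have := exp_pos b; lra. Qed.

Section Retraction.
Variable r : Romega -> Romega.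
Hypothesis r_cont : scont Ec Ec r.
Hypothesis r_idem : forall x, r (r x) = r x.

(** The distance of [y] from the retract and the distance of [r y] from [p] are separate terms, so
    that passing from [y] to [r y] kills the first and keeps the second: the gap cannot grow, as
    [ray_osc_base] requires. *)
Definition gap m (y p : Romega) := bmax m (fun i => Rabs (y i - r y i) + Rabs (r y i - p i)).

Lemma gap_cv m (ys ps : nat -> Romega) (y p : Romega) : @cv Ec ys y -> @cv Ec ps p ->
  Un_cv (fun s => gap m (ys s) (ps s)) (gap m y p).
Proof.
move=> Hy Hp; apply: bmax_cv => i _; have Hr := r_cont ys y Hy.
apply: CV_plus; apply: cv_cvabs; [exact: CV_minus (Hy i) (Hr i) | exact: CV_minus (Hr i) (Hp i)].
Qed.

(* A bound [N] on the weighted gap forces the clamp below [1/2], hence [gap < 2/m], as soon as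
   [2 N <= j]; conversely, along a convergent sequence only finitely many [j] contribute. *)
Definition weighted_gap m n (x : nat -> Romega) y :=
  bmax (S n) (fun j => INR j * clamp (INR m * gap m y (r (x j)) - 1)).

Lemma weighted_gap_le m n x y : weighted_gap m n x y <= INR n.
Proof.
apply: bmax_le => [|j Hj]; first exact: pos_INR.
have [H1 H2] := clamp_bd (INR m * gap m y (r (x j)) - 1).
have := le_INR j n ltac:(lia) => ?; have := pos_INR j => ?.
apply: Rle_trans (_ : INR j * 1 <= _); last lra.
exact: Rmult_le_compat_l.
Qed.

Lemma weighted_gap_ext m n x x' y : (forall j, (j <= n)%nat -> x j = x' j) ->
  weighted_gap m n x y = weighted_gap m n x' y.
Proof. by move=> H; apply: bmax_ext => j Hj; rewrite H //; lia. Qed.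

Lemma weighted_gap_cv m n (xs : nat -> nat -> Romega) x (ys : nat -> Romega) (y : Romega) :
  (forall j, (j <= n)%nat -> @cv Ec (fun s => xs s j) (x j)) -> @cv Ec ys y ->
  Un_cv (fun s => weighted_gap m n (xs s) (ys s)) (weighted_gap m n x y).
Proof.
move=> Hx Hy; apply: bmax_cv => j Hj; apply: CV_mult (cv_const _) _; apply: clamp_cv.
apply: CV_minus (cv_const 1); apply: CV_mult (cv_const _) _; apply: gap_cv => //.
by apply: (r_cont (fun s => xs s j)); apply: Hx; lia.
Qed.

(* The supremum over the segment makes sublevel sets star-shaped about [r (x n)]; the floor [INR m]
   leaves only the finitely many levels [m < n] as actual constraints on [y]. *)
Definition ray_osc m n (x : nat -> Romega) y :=
  Rmax (INR m) (sup I01 (fun t => weighted_gap m n x (seg (r (x n)) y t))).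

Lemma I01_ex : exists t, I01 t.
Proof. by exists 0; rewrite /I01; lra. Qed.

Lemma ray_osc_ge m n x y : INR m <= ray_osc m n x y.
Proof. exact: Rmax_l. Qed.

Lemma ray_osc_ub m n x y t : I01 t -> weighted_gap m n x (seg (r (x n)) y t) <= ray_osc m n x y.
Proof.
move=> Ht; apply: Rle_trans (Rmax_r _ _).
by apply: (sup_ub _ I01 (fun t => weighted_gap m n x (seg (r (x n)) y t)) (INR n)) => // *;
  exact: weighted_gap_le.
Qed.

Lemma ray_osc_le m n x y c : INR m <= c -> (forall t, I01 t ->
  weighted_gap m n x (seg (r (x n)) y t) <= c) -> ray_osc m n x y <= c.
Proof. by move=> Hc H; apply: Rmax_lub => //; apply: sup_le => //; exact: I01_ex. Qed.

Lemma ray_osc_big m n x y : (n <= m)%nat -> ray_osc m n x y = INR m.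
Proof.
move=> Hnm; apply: Rle_antisym; last exact: ray_osc_ge.
apply: ray_osc_le => [|t _]; first lra.
by apply: Rle_trans (weighted_gap_le _ _ _ _) (le_INR _ _ Hnm).
Qed.

Lemma ray_osc_ext m n x x' y : (forall j, (j <= n)%nat -> x j = x' j) ->
  ray_osc m n x y = ray_osc m n x' y.
Proof.
by move=> H; rewrite /ray_osc (H n) //; congr Rmax; apply: sup_ext => t _; apply: weighted_gap_ext.
Qed.

Lemma ray_osc_cv m n (xs : nat -> nat -> Romega) x (ys : nat -> Romega) (y : Romega) :
  (forall j, (j <= n)%nat -> @cv Ec (fun s => xs s j) (x j)) -> @cv Ec ys y ->
  Un_cv (fun s => ray_osc m n (xs s) (ys s)) (ray_osc m n x y).
Proof.
move=> Hx Hy; apply: cv_max (cv_const _) _; apply: sup01_conv.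
- move=> ts t Hts Ht Hc σ Hσ; apply: (weighted_gap_cv m n (fun s => xs (σ s))) => [j Hj|].
    exact: (Ecv_sub (fun s => xs s j)) (Hx j Hj).
  apply: seg_cv => //; last exact: Ecv_sub.
  by apply: (r_cont (fun s => xs (σ s) n)); apply: (Ecv_sub (fun s => xs s n)) => //; apply: Hx.
- by move=> s; exists (INR n) => t _; exact: weighted_gap_le.
- by exists (INR n) => t _; exact: weighted_gap_le.
Qed.

Lemma seg_ray p d s t : seg p (eadd p (scale s d)) t = eadd p (scale (t * s) d).
Proof. by apply: functional_extensionality => i; rewrite /seg /eadd /scale /esub; ring. Qed.

Lemma ray_osc_ray m n x d s s' : 0 <= s <= s' ->
  ray_osc m n x (eadd (r (x n)) (scale s d)) <= ray_osc m n x (eadd (r (x n)) (scale s' d)).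
Proof.
move=> Hs; apply: ray_osc_le => [|t Ht]; first exact: ray_osc_ge.
(* The segment to the nearer point is part of the segment to the farther one. Its parameter
   [t * s / s'] needs [s' > 0], hence the case of equal points. *)
rewrite seg_ray; case: (Rle_lt_dec s' 0) => Hs'.
  have -> : t * s = t * s' by have -> : s = s' by lra.
  rewrite -seg_ray; exact: ray_osc_ub.
have -> : t * s = (t * s / s') * s' by field; lra.
rewrite -seg_ray; apply: ray_osc_ub; rewrite /I01 in Ht *.
have H1 := div_unit s s' Hs' Hs.
have -> : t * s / s' = t * (s / s') by field; lra.
split; first by apply: Rmult_le_pos; lra.
by rewrite -(Rmult_1_r 1); apply: Rmult_le_compat; lra.
Qed.

Lemma gap_fix m p p' : r p = p -> gap m p p' = bmax m (fun i => Rabs (p i - p' i)).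
Proof. by move=> Hp; apply: bmax_ext => i _; rewrite Hp Rminus_diag Rabs_R0 Rplus_0_l. Qed.

Lemma ray_osc_base0 m x : ray_osc m 0 x (r (x 0%nat)) = INR m.
Proof. by apply: ray_osc_big; lia. Qed.

(** At the centre the segment is constant. The new term [j = S n] vanishes, as its gap is [0], and
    each older term is at most the one for [x (S n)] itself. So the centre of the next star inherits
    the bounds already met. *)
Lemma ray_osc_base m n x : ray_osc m (S n) x (r (x (S n))) <= ray_osc m n x (x (S n)).
Proof.
apply: ray_osc_le => [|t _]; first exact: ray_osc_ge.
rewrite seg_self; set p := r (x (S n)).
have Hge0 : 0 <= ray_osc m n x (x (S n)) by apply: Rle_trans (pos_INR m) (ray_osc_ge _ _ _ _).
apply: bmax_le => // j Hj; rewrite gap_fix; first exact: r_idem.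
case: (Nat.eq_dec j (S n)) => [->|Hne].
  rewrite clamp_neg ?Rmult_0_r //.
  have -> : bmax m (fun i => Rabs (p i - r (x (S n)) i)) = 0; last lra.
  apply: Rle_antisym; last exact: bmax_pos.
  by apply: bmax_le => [|i _]; [lra | rewrite /p Rminus_diag Rabs_R0; lra].
have H1 := ray_osc_ub m n x (x (S n)) 1 ltac:(rewrite /I01; lra).
rewrite seg1 in H1; apply: Rle_trans H1.
have Hjn : (j < S n)%nat by lia.
apply: Rle_trans (bmax_ub (S n) (fun j => INR j * clamp (INR m * gap m (x (S n)) (r (x j)) - 1)) j Hjn).
apply: Rmult_le_compat_l; first exact: pos_INR.
apply: clamp_mono; apply: Rplus_le_compat_r; apply: Rmult_le_compat_l; first exact: pos_INR.
by apply: bmax_mono => i _; rewrite /p; have := Rabs_pos (x (S n) i - r (x (S n)) i); lra.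
Qed.

Definition ray_gauge n (x : nat -> Romega) (N : Romega) (d : Romega) :=
  bmax n (fun m => ray_osc m n x (eadd (r (x n)) d) / N m).

(** A maximum over [m < n] captures infinitely many constraints, because at a level [m >= n] the
    oscillation is exactly [INR m], below [N m] by hypothesis. *)
Lemma ray_gauge_lt n x N d : (forall m, INR m < N m) ->
  ray_gauge n x N d < 1 <-> forall m, ray_osc m n x (eadd (r (x n)) d) < N m.
Proof.
move=> HN; have HNp m : 0 < N m by have := HN m; have := pos_INR m; lra.
split=> [H m|H].
- case: (Nat.lt_ge_cases m n) => Hmn; last by rewrite ray_osc_big.
  have H1 := bmax_ub n (fun m => ray_osc m n x (eadd (r (x n)) d) / N m) m Hmn.
  have H2 : ray_osc m n x (eadd (r (x n)) d) / N m < 1 by rewrite /ray_gauge in H; lra.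
  by apply/div_lt_1.
- by apply: bmax_lt => [|m _]; [lra | apply/div_lt_1].
Qed.

Lemma ray_gauge_gauge n x N : (forall m, INR m < N m) -> (forall m,
  ray_osc m n x (r (x n)) < N m) ->
  gauge (ray_gauge n x N).
Proof.
move=> HN Hb; have HNp m : 0 < N m by have := HN m; have := pos_INR m; lra.
split; [|split; [|split]].
- move=> ds d Hd; apply: bmax_cv => m _; apply: cv_div (cv_const _); first by have := HNp m; lra.
  apply: (ray_osc_cv m n (fun _ => x)) => [j _|]; first exact: Ecv_const.
  exact: eadd_cv (Ecv_const _) Hd.
- by move=> d; exact: bmax_pos.
- apply/ray_gauge_lt => // m; rewrite (_ : eadd _ _ = r (x n)) //.
  by apply: functional_extensionality => i; rewrite /eadd Rplus_0_r.
- move=> d s t Hst; apply: bmax_mono => m _; apply: Rmult_le_compat_r.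
    by apply: Rlt_le; apply: Rinv_0_lt_compat.
  exact: ray_osc_ray.
Qed.

Lemma ray_gauge_cconv n xs x (Ns : nat -> Romega) (N : Romega) :
  (forall j, (j <= n)%nat -> @cv Ec (fun s => xs s j) (x j)) -> @cv Ec Ns N -> (forall m,
    0 < N m) ->
  cconv (fun s => ray_gauge n (xs s) (Ns s)) (ray_gauge n x N).
Proof.
move=> Hx HN HNp ds d Hd; apply: bmax_cv => m _; apply: cv_div (HN m); first by have := HNp m; lra.
apply: ray_osc_cv => //; apply: eadd_cv => //.
by apply: (r_cont (fun s => xs s n)); apply: Hx.
Qed.

(** * Choosing the points and their bounds in turn *)

Definition Yc := prodc Ec Ec.

(* [y n] is the pair of [x_n] and of the bounds [N_n]; given the past, [x_{n+1}] must keep the new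
   oscillation below [N_n], and then [N_{n+1}] is squeezed between the two. *)
Definition stepA n (b : unit) (y : nat -> Yc) (v : Yc) : Prop :=
  match n with
  | 0 => forall m, INR m < snd v m
  | S k => forall m, ray_osc m k (fun j => fst (y j)) (fst v) < snd v m < snd (y k) m
  end.

Definition step_gauge k (y : nat -> Yc) := ray_gauge k (fun j => fst (y j)) (snd (y k)).

Definition stepF n (b : unit) (y : nat -> Yc) (v : Yc) : Yc :=
  match n with
  | 0 => (fst v, fun m => ln (snd v m - INR m))
  | S k => let d := esub (fst v) (r (fst (y k))) in
      (scale (/ (1 - step_gauge k y d)) d,
       fun m => enc (ray_osc m k (fun j => fst (y j)) (fst v)) (snd (y k) m) (snd v m))
  end.

Definition stepG n (b : unit) (y : nat -> Yc) (z : Yc) : Yc :=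
  match n with
  | 0 => (fst z, fun m => INR m + exp (snd z m))
  | S k => let x := eadd (r (fst (y k))) (scale (ray_root (step_gauge k y) (fst z)) (fst z)) in
      (x, fun m => dec (ray_osc m k (fun j => fst (y j)) x) (snd (y k) m) (snd z m))
  end.

(** [tower] asks for a base space; nothing precedes the choice of [x_0], so the base is a point. *)
Definition unitc := CSpace unit (fun _ _ => True).

Definition step_space := subc (prodc unitc (powc Yc)) (fun by_ => forall n,
  stepA n (fst by_) (snd by_) (snd by_ n)).

Notation sadm := (adm unitc Yc stepA).

Lemma sadm_N n b y : sadm (S n) b y -> forall m, INR m < snd (y n) m.
Proof.
move=> H m; have := H n (Nat.lt_succ_diag_r n); case: n H => [|n] _ /=; first by apply.
by move=> /(_ m) [H1 _]; exact: Rle_lt_trans (ray_osc_ge _ _ _ _) H1.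
Qed.

Lemma sadm_base n b y : sadm (S n) b y ->
  forall m, ray_osc m n (fun j => fst (y j)) (r (fst (y n))) < snd (y n) m.
Proof.
move=> H m; have HN := sadm_N n b y H m; have := H n (Nat.lt_succ_diag_r n); case: n H HN =>
  [|n] H HN.
  by move=> _; rewrite (ray_osc_base0 m (fun j => fst (y j))).
by move=> /= /(_ m) [H1 _]; exact: Rle_lt_trans (ray_osc_base m n (fun j => fst (y j))) H1.
Qed.

Lemma step_gaugeP n b y : sadm (S n) b y -> gauge (step_gauge n y).
Proof. by move=> H; apply: ray_gauge_gauge; [apply: sadm_N H | apply: sadm_base H]. Qed.

Lemma step_space_homeo : homeo step_space (prodc unitc (powc Yc)).
Proof.
apply: (tower unitc Yc Yc (fun _ => 0, fun _ => 0) stepA stepF stepG).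
- case=> [//|k] b y y' z Hag /=; rewrite -(Hag k); first lia.
  have Hw m v : ray_osc m k (fun j => fst (y' j)) v = ray_osc m k (fun j => fst (y j)) v.
    by apply: ray_osc_ext => j Hj; rewrite Hag //; lia.
  have -> : step_gauge k y' = step_gauge k y.
    apply: functional_extensionality => d; rewrite /step_gauge /ray_gauge -(Hag k); first lia.
    by apply: bmax_ext => m _; rewrite Hw.
  by congr pair; apply: functional_extensionality => m; rewrite Hw.
- case=> [|k] b y z Hadm /= m; first exact: Rlt_plus_exp.
  (* At the root [s] the gauge is [1 - s < 1]. By [ray_gauge_lt] the new point then meets all bounds
     in force, and the interval for each next bound is nonempty. *)
  apply: dec_bd; move: m; apply/ray_gauge_lt; first exact: sadm_N Hadm.
  have [H1 H2] := ray_root_spec _ (fst z) (step_gaugeP k b y Hadm).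
  by change (step_gauge k y (scale (ray_root (step_gauge k y) (fst z)) (fst z)) < 1); lra.
- case=> [|k] b y [u h] Hadm /=.
    by congr pair; apply: functional_extensionality => m; rewrite -{2}(ln_exp (h m)); congr ln; ring.
  have Hg := step_gaugeP k b y Hadm; have [H1 H2] := ray_root_spec _ u Hg.
  set s := ray_root (step_gauge k y) u in H1 H2 *; rewrite esub_eadd.
  have -> : 1 - step_gauge k y (scale s u) = s by lra.
  congr pair; first by apply: functional_extensionality => i; rewrite /scale; field; lra.
  apply: functional_extensionality => m; apply: enc_dec.
  move: m; apply/ray_gauge_lt; first exact: sadm_N Hadm.
  by change (step_gauge k y (scale s u) < 1); lra.
- case=> [|k] b y [x N] Hadm /= HA.
    by congr pair; apply: functional_extensionality => m; rewrite exp_ln; have := HA m; lra.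
  have Hg := step_gaugeP k b y Hadm; set d := esub x (r (fst (y k))).
  have Hq : step_gauge k y d < 1.
    by apply/ray_gauge_lt; [exact: sadm_N Hadm | move=> m; rewrite eadd_esub; case: (HA m) =>
      H1 H2; exact: Rlt_trans H1 H2].
  have Hq0 : 0 <= step_gauge k y d by exact: bmax_pos.
  have Hsd : scale (1 - step_gauge k y d) (scale (/ (1 - step_gauge k y d)) d) = d.
    by apply: functional_extensionality => i; rewrite /scale; field; lra.
  (* For [u = d / (1 - Q d)] the number [s = 1 - Q d] solves [s + Q (s u) = 1], since [s u = d]. *)
  rewrite (ray_root_unique _ _ (1 - step_gauge k y d) Hg); [lra | rewrite Hsd; lra |].
  rewrite Hsd eadd_esub; congr pair; apply: functional_extensionality => m.
  exact: dec_enc.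
- case=> [|k] bs b ys y vs v _ Hy Hadms Hadm HAs HA [Hv1 Hv2].
    split=> // m; apply: cv_ln; first by have := HA m; lra.
    exact: CV_minus (Hv2 m) (cv_const _).
  have Hyk := Hy k (Nat.lt_succ_diag_r k).
  have Hx j : (j <= k)%nat -> @cv Ec (fun s => fst (ys s j)) (fst (y j)) by move=> Hj; have [] :=
    Hy j ltac:(lia).
  have HN := sadm_N k b y Hadm.
  have Hd : @cv Ec (fun s => esub (fst (vs s)) (r (fst (ys s k)))) (esub (fst v) (r (fst (y k)))).
    by apply: esub_cv => //; apply: (r_cont (fun s => fst (ys s k))); case: Hyk.
  have Hqc : cconv (fun s => step_gauge k (ys s)) (step_gauge k y).
    by apply: ray_gauge_cconv => //; [case: Hyk | move=> m; have := HN m; have := pos_INR m; lra].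
  split=> [|m] /=.
  + apply: scale_cv => //; apply: cv_inv; last exact: CV_minus (cv_const 1) (Hqc _ _ Hd).
    apply: one_minus_neq.
    by apply/ray_gauge_lt => // m; rewrite eadd_esub; case: (HA m) => H1 H2; exact: Rlt_trans H1 H2.
  + apply: enc_cv; [exact: HA | exact: ray_osc_cv | by case: Hyk => _ H; apply: H | exact: Hv2].
- case=> [|k] bs b ys y zs z _ Hy Hadms Hadm [Hz1 Hz2].
    by split=> // m; apply: CV_plus (cv_const _) _; apply: cv_exp; apply: Hz2.
  have Hyk := Hy k (Nat.lt_succ_diag_r k).
  have Hx j : (j <= k)%nat -> @cv Ec (fun s => fst (ys s j)) (fst (y j)) by move=> Hj; have [] :=
    Hy j ltac:(lia).
  have HN := sadm_N k b y Hadm.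
  have Hqc : cconv (fun s => step_gauge k (ys s)) (step_gauge k y).
    by apply: ray_gauge_cconv => //; [case: Hyk | move=> m; have := HN m; have := pos_INR m; lra].
  have Hnew : @cv Ec (fun s => eadd (r (fst (ys s k))) (scale (ray_root (step_gauge k (ys s)) (fst (zs s))) (fst (zs s))))
      (eadd (r (fst (y k))) (scale (ray_root (step_gauge k y) (fst z)) (fst z))).
    apply: eadd_cv; first by apply: (r_cont (fun s => fst (ys s k))); case: Hyk.
    apply: scale_cv => //; apply: ray_root_cv => //; [| exact: step_gaugeP Hadm].
    by move=> s; apply: step_gaugeP (Hadms s).
  split=> [//|m] /=; apply: dec_cv; [exact: ray_osc_cv | by case: Hyk => _ H;
    apply: H | exact: Hz2].
Qed.

End Retraction.

Lemma scont_near (r : Romega -> Romega) p m e : scont Ec Ec r -> 0 < e ->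
  exists k d, 0 < d /\ forall y, near k d y p -> near m e (r y) (r p).
Proof.
move=> Hr He; apply: NNPP => Hno.
have H k : exists y, near k (/ INR (S k)) y p /\ ~ near m e (r y) (r p).
  apply: NNPP => H; apply: Hno; exists k, (/ INR (S k)); split; first exact: inv_S_pos.
  by move=> y Hy; apply: NNPP => Hn; apply: H; exists y.
have [y yP] := functional_choice _ H.
have Hy : @cv Ec y p.
  apply: near_cv => k d Hd; have [N HN] := inv_S_small d Hd.
  exists (k + N)%nat => n Hn; apply: near_le (proj1 (yP n)); [lia | apply: Rlt_le; apply: HN; lia].
have [N HN] := cv_near _ _ m e (Hr _ _ Hy) He.
by apply: (proj2 (yP N)); apply: HN.
Qed.

(** * Sequences converging to points of the retract *)

Definition ucv (xs : nat -> nat -> Romega) (x : nat -> Romega) :=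
  forall i e, 0 < e -> ev (fun s => forall n, Rabs (xs s n i - x n i) < e).

Lemma ucv_const x : ucv (fun _ => x) x.
Proof. by move=> i e He; apply: ev_all => _ n; rewrite Rminus_diag Rabs_R0. Qed.

Lemma ucv_cv xs x j : ucv xs x -> @cv Ec (fun s => xs s j) (x j).
Proof. by move=> H i; apply/cvE => e He; apply: ev_mono (H i e He). Qed.

Lemma Rabs_sub_half a b c d e : Rabs (a - b) < e / 2 -> Rabs (c - d) < e / 2 ->
  Rabs (a - c - (b - d)) < e.
Proof. by move=> /Rabs_ltE ? /Rabs_ltE ?; apply/Rabs_ltE; lra. Qed.

Lemma Rabs_add_half a b c d e : Rabs (a - b) < e / 2 -> Rabs (c - d) < e / 2 ->
  Rabs (a + c - (b + d)) < e.
Proof. by move=> /Rabs_ltE ? /Rabs_ltE ?; apply/Rabs_ltE; lra. Qed.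

Lemma eadd_cv0 p (d : nat -> Romega) : @cv Ec d (fun _ => 0) -> @cv Ec (fun n => eadd p (d n)) p.
Proof.
move=> Hd i; have := CV_plus _ _ _ _ (cv_const (p i)) (Hd i).
by rewrite Rplus_0_r.
Qed.

Definition c0E := CSpace {d : nat -> Romega | @cv Ec d (fun _ => 0)}
  (fun u x => ucv (fun s => proj1_sig (u s)) (proj1_sig x)).

Section Factor.
Variable r : Romega -> Romega.
Hypothesis r_cont : scont Ec Ec r.
Hypothesis r_idem : forall x, r (r x) = r x.

Definition Kc := subc Ec (fun x => r x = x).

Definition Vc := CSpace {x : nat -> Romega | exists p : Romega, r p = p /\ @cv Ec x p}
  (fun u x => ucv (fun s => proj1_sig (u s)) (proj1_sig x)).

Definition vlim (x : Vc) : Romega := epsilon (inhabits (fun _ => 0)) (fun p => r p = p /\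
  @cv Ec (proj1_sig x) p).

Lemma vlim_spec x : r (vlim x) = vlim x /\ @cv Ec (proj1_sig x) (vlim x).
Proof. exact: epsilon_spec (inhabits (fun _ => 0)) _ (proj2_sig x). Qed.

Lemma vlim_cv (u : nat -> Vc) (x : Vc) : cv u x -> @cv Ec (fun s => vlim (u s)) (vlim x).
Proof.
move=> H i; apply/cvE => e He.
apply: ev_mono (H i (e / 2) ltac:(lra)) => s Hs.
have [_ H1] := vlim_spec (u s); have [_ H2] := vlim_spec x.
have H3 := cv_cvabs _ _ (CV_minus _ _ _ _ (H1 i) (H2 i)).
suff : Rabs (vlim (u s) i - vlim x i) <= e / 2 by lra.
by apply: cv_le _ H3 (cv_const _); apply: ev_all => n; apply: Rlt_le; apply: Hs.
Qed.

Lemma V_homeo : homeo Vc (prodc Kc c0E).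
Proof.
have Hc x : @cv Ec (fun n => esub (proj1_sig x n) (vlim x)) (fun _ => 0).
  by move=> i; have [_ H] := vlim_spec x; exact: (proj2 (cv_dist _ _) (H i)).
have HV (pd : prodc Kc c0E) : exists p : Romega, r p = p /\ @cv Ec (fun n =>
  eadd (proj1_sig (fst pd)) (proj1_sig (snd pd) n)) p.
  exists (proj1_sig (fst pd)); split; first exact: (proj2_sig (fst pd)).
  exact: eadd_cv0 (proj2_sig (snd pd)).
exists (fun x => (exist (fun p => r p = p) (vlim x) (proj1 (vlim_spec x)),
  exist (fun d => @cv Ec d (fun _ => 0)) (fun n => esub (proj1_sig x n) (vlim x)) (Hc x))).
exists (fun pd => exist (fun x : nat -> Romega => exists p : Romega, r p = p /\ @cv Ec x p)
  (fun n => eadd (proj1_sig (fst pd)) (proj1_sig (snd pd) n)) (HV pd)).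
split; [|split; [|split]].
- move=> u x Hu; have Hl := vlim_cv u x Hu; split=> //= i e He.
  apply: ev_mono (ev_and _ _ (Hu i (e / 2) ltac:(lra)) (cv_ev _ _ (e / 2) (Hl i) ltac:(lra))) =>
    s [H1 H2] n.
  exact: Rabs_sub_half (H1 n) H2.
- move=> u x [H1 H2] i e He.
  apply: ev_mono (ev_and _ _ (H2 i (e / 2) ltac:(lra)) (cv_ev _ _ (e / 2) (H1 i) ltac:(lra))) =>
    s [H3 H4] n.
  exact: Rabs_add_half H4 (H3 n).
- move=> x; apply: sig_eq => /=; apply: functional_extensionality => n; exact: eadd_esub.
- move=> pd; pose x : Vc := exist (fun x : nat -> Romega => exists p : Romega, r p = p /\
  @cv Ec x p) _ (HV pd).
  have E : vlim x = proj1_sig (fst pd).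
    apply: functional_extensionality => i; have [_ H] := vlim_spec x.
    exact: UL_sequence (H i) (eadd_cv0 _ _ (proj2_sig (snd pd)) i).
  rewrite [RHS]surjective_pairing; congr pair; apply: sig_eq; first exact: E.
  apply: functional_extensionality => n /=; rewrite -/x E; exact: esub_eadd.
Qed.

Section Tail.
Variables (xs : nat -> nat -> Romega) (x : nat -> Romega) (p : Romega).
Hypothesis Hxs : ucv xs x.
Hypothesis Hx : @cv Ec x p.
Hypothesis Hp : r p = p.

Lemma tail_close m e : 0 < e ->
  exists j0, forall s j, (j0 <= s)%nat -> (j0 <= j)%nat -> near m e (xs s j) p.
Proof.
move=> He.
have H1 : ev (fun s => forall i, (i < m)%nat -> forall n, Rabs (xs s n i - x n i) < e / 2).
  by apply: ev_lt => i _; apply: Hxs; lra.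
have [a Ha] := H1; have [b Hb] := cv_near x p m (e / 2) Hx ltac:(lra).
exists (a + b)%nat => s j Hs Hj i Hi.
have := Ha s ltac:(lia) i Hi j; have := Hb j ltac:(lia) i Hi => /Rabs_ltE ? /Rabs_ltE ?;
  apply/Rabs_ltE; lra.
Qed.

Lemma tail_r m e : 0 < e ->
  exists j0, forall s j, (j0 <= s)%nat -> (j0 <= j)%nat -> near m e (r (xs s j)) p.
Proof.
move=> He; have [k [d [Hd H]]] := scont_near r p m e r_cont He.
have [j0 Hj] := tail_close k d Hd.
by exists j0 => s j H1 H2; rewrite -Hp; apply: H; apply: Hj.
Qed.

Lemma tail_seg m e : 0 < e -> exists j0, forall s j t, (j0 <= s)%nat -> (j0 <= j)%nat -> I01 t ->
  near m e (seg (r (xs s j)) (xs s (S j)) t) p /\ near m e (r (seg (r (xs s j)) (xs s (S j)) t)) p.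
Proof.
have key k d : 0 < d -> exists j0, forall s j t, (j0 <= s)%nat -> (j0 <= j)%nat -> I01 t ->
  near k d (seg (r (xs s j)) (xs s (S j)) t) p.
{ move=> Hd; have [a Ha] := tail_close k d Hd; have [b Hb] := tail_r k d Hd.
  exists (a + b)%nat => s j t Hs Hj [Ht0 Ht1] i Hi.
  have := Ha s (S j) ltac:(lia) ltac:(lia) i Hi; have := Hb s j ltac:(lia) ltac:(lia) i Hi.
  move=> /Rabs_ltE H1 /Rabs_ltE H2; apply/Rabs_ltE; rewrite /seg /eadd /scale /esub.
  have -> : r (xs s j) i + t * (xs s (S j) i - r (xs s j) i) - p i =
    (1 - t) * (r (xs s j) i - p i) + t * (xs s (S j) i - p i) by ring.
  split.
  - case: (Rle_lt_dec t 0) => Ht; first by (have -> : t = 0 by lra); lra.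
    have := Rmult_lt_compat_l t _ _ Ht (proj1 H2).
    have := Rmult_le_compat_l (1 - t) _ _ ltac:(lra) (Rlt_le _ _ (proj1 H1)); lra.
  - case: (Rle_lt_dec t 0) => Ht; first by (have -> : t = 0 by lra); lra.
    have := Rmult_lt_compat_l t _ _ Ht (proj2 H2).
    have := Rmult_le_compat_l (1 - t) _ _ ltac:(lra) (Rlt_le _ _ (proj2 H1)); lra. }
move=> He; have [k [d [Hd H]]] := scont_near r p m e r_cont He.
have [a Ha] := key m e He; have [b Hb] := key k d Hd.
exists (a + b)%nat => s j t Hs Hj Ht; split; first by apply: Ha => //; lia.
by rewrite -Hp; apply: H; apply: Hb => //; lia.
Qed.

(** Far out, all segments and all [r (xs s j)] are so close to [p] that the clamp is [0]: at each
    level only finitely many [j] ever contribute. *)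
Lemma tail_vanish m : exists J, forall s j k t, (J <= s)%nat -> (J <= j)%nat -> (j <= k)%nat ->
  I01 t ->
  INR m * gap r m (seg (r (xs s k)) (xs s (S k)) t) (r (xs s j)) - 1 <= 0.
Proof.
(* [gap] adds two distances, each at most two radii, so a quarter of [/ INR (S m)] per radius
   suffices. *)
have He : 0 < / INR (S m) / 4 by have := inv_S_pos m; lra.
have [a Ha] := tail_r m _ He; have [b Hb] := tail_seg m _ He.
exists (a + b)%nat => s j k t Hs Hj Hjk Ht.
set y := seg _ _ _.
have Hg : gap r m y (r (xs s j)) <= / INR (S m).
  apply: bmax_le => [|i Hi]; first exact: Rlt_le (inv_S_pos m).
  have [H1 H2] := Hb s k t ltac:(lia) ltac:(lia) Ht.
  have H3 := Ha s j ltac:(lia) ltac:(lia) i Hi.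
  have := H1 i Hi; have := H2 i Hi; rewrite -/y; move: H3 => /Rabs_ltE H3 /Rabs_ltE H4 /Rabs_ltE H5.
  have : Rabs (y i - r y i) <= / INR (S m) / 2 by apply/Rabs_leE; lra.
  have : Rabs (r y i - r (xs s j) i) <= / INR (S m) / 2 by apply/Rabs_leE; lra.
  lra.
have := Rmult_le_compat_l (INR m) _ _ (pos_INR m) Hg.
suff : INR m * / INR (S m) <= 1 by lra.
have Hm : 0 < INR (S m) by apply: lt_0_INR; lia.
rewrite -(Rinv_r (INR (S m))); first lra.
apply: Rmult_le_compat_r; first by apply: Rlt_le; apply: inv_S_pos.
by apply: le_INR; lia.
Qed.

End Tail.

(** At time [0] there is no past, so only the floor of [ray_osc] remains. *)
Definition osc m k (x : nat -> Romega) :=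
  match k with 0 => INR m | S k => ray_osc r m k x (x (S k)) end.

Lemma osc_bounded x p m : @cv Ec x p -> r p = p -> exists M, forall k, osc m k x <= M.
Proof.
move=> Hx Hp; have [J HJ] := tail_vanish (fun _ => x) x p (ucv_const x) Hx Hp m.
exists (Rmax (INR m) (INR J)) => -[|k] /=; first exact: Rmax_l.
apply: ray_osc_le => [|t Ht]; first exact: Rmax_l.
apply: Rle_trans (Rmax_r _ _); apply: bmax_le => [|j Hj]; first exact: pos_INR.
case: (Nat.le_gt_cases J j) => HJj.
  rewrite clamp_neg ?Rmult_0_r; [by apply: (HJ J j k t) => //; lia | exact: pos_INR].
have := clamp_bd (INR m * gap r m (seg (r (x k)) (x (S k)) t) (r (x j)) - 1) => -[H1 H2].
have := le_INR j J ltac:(lia); have := pos_INR j => ? ?.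
have := Rmult_le_compat_l (INR j) _ _ (pos_INR j) H2; lra.
Qed.

Lemma r_unif xs x p m e : ucv xs x -> @cv Ec x p -> r p = p -> 0 < e ->
  ev (fun s => forall j, near m e (r (xs s j)) (r (x j))).
Proof.
move=> Hxs Hx Hp He.
have [a Ha] := tail_r xs x p Hxs Hx Hp m (e / 2) ltac:(lra).
have [b Hb] := tail_r (fun _ => x) x p (ucv_const x) Hx Hp m (e / 2) ltac:(lra).
have [c Hc] : ev (fun s => forall j, (j < a + b)%nat -> near m e (r (xs s j)) (r (x j))).
  by apply: ev_lt => j _; apply: cv_near => //; apply: (r_cont (fun s => xs s j)); apply: ucv_cv.
exists (a + b + c)%nat => s Hs j.
case: (Nat.lt_ge_cases j (a + b)) => Hj; first by apply: Hc => //; lia.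
have -> : e = e / 2 + e / 2 by lra.
apply: near_trans (Ha s j ltac:(lia) ltac:(lia)) _; apply: near_sym; apply: (Hb b); lia.
Qed.

(** Finitely many times [k] are settled by pointwise convergence. For later [k], the terms with
    [j >= J] vanish on both sides, and those with [j < J] have bounded weights while their gaps are
    uniformly close. *)
Lemma osc_unif xs x p m e : ucv xs x -> @cv Ec x p -> r p = p -> 0 < e ->
  ev (fun s => forall k, Rabs (osc m k (xs s) - osc m k x) <= e).
Proof.
move=> Hxs Hx Hp He.
have [J1 HJ1] := tail_vanish xs x p Hxs Hx Hp m.
have [J2 HJ2] := tail_vanish (fun _ => x) x p (ucv_const x) Hx Hp m.
pose J := (J1 + J2)%nat; pose C := INR (S J) * INR (S m).
have HC : 0 < C by apply: Rmult_lt_0_compat; apply: lt_0_INR; lia.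
(* Below, the two parts of the gap change by at most [2 d] and [3 d], and the factors [INR j] and
   [INR m] are absorbed in [C]; [C * (5 * d) = e]. *)
have Hd : 0 < e / C / 5 by have := Rdiv_lt_0_compat e C He HC; lra.
set d := e / C / 5 in Hd.
have [a Ha] := tail_seg xs x p Hxs Hx Hp m d Hd.
have [b Hb] := tail_seg (fun _ => x) x p (ucv_const x) Hx Hp m d Hd.
have [c Hc] := r_unif xs x p m d Hxs Hx Hp Hd.
have [f Hf] : ev (fun s => forall k, (k < S (a + b))%nat -> Rabs (osc m k (xs s) - osc m k x) < e).
  apply: ev_lt => -[|k] _ /=; first by apply: ev_all => _; rewrite Rminus_diag Rabs_R0.
  by apply: cv_ev He; apply: ray_osc_cv => // [j _|]; apply: ucv_cv.
exists (a + b + c + f + J)%nat => s Hs k.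
case: (Nat.lt_ge_cases k (S (a + b))) => Hk; first by apply: Rlt_le; apply: Hf => //; lia.
case: k Hk => [|k] Hk; first lia.
rewrite /osc /ray_osc; apply: Rmax_close; first by rewrite Rminus_diag Rabs_R0; lra.
apply: (sup_close _ I01 _ _ (INR k)) => [|t _|t Ht]; [exact: I01_ex | exact: weighted_gap_le |].
apply: bmax_close => [|j Hj]; first lra.
case: (Nat.le_gt_cases J j) => HJj.
  have H1 := HJ1 s j k t ltac:(lia) ltac:(lia) ltac:(lia) Ht.
  have H2 := HJ2 J2 j k t ltac:(lia) ltac:(lia) ltac:(lia) Ht.
  by rewrite !clamp_neg // Rminus_diag Rabs_R0; lra.
have [H1 H2] := Ha s k t ltac:(lia) ltac:(lia) Ht.
have [H3 H4] := Hb b k t ltac:(lia) ltac:(lia) Ht.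
have H5 := Hc s ltac:(lia) j.
move: H1 H2 H3 H4; set y := seg _ _ _; set y' := seg _ _ _ => H1 H2 H3 H4.
have Hgap : Rabs (gap r m y (r (xs s j)) - gap r m y' (r (x j))) <= 5 * d.
  apply: bmax_close => [|i Hi]; first lra.
  move: (H1 i Hi) (H2 i Hi) (H3 i Hi) (H4 i Hi) (H5 i Hi).
  move=> /Rabs_ltE ? /Rabs_ltE ? /Rabs_ltE ? /Rabs_ltE ? /Rabs_ltE ?.
  have A1 : Rabs (y i - r y i) <= 2 * d by apply/Rabs_leE; lra.
  have A2 : Rabs (y' i - r y' i) <= 2 * d by apply/Rabs_leE; lra.
  have A3 := Rabs_triang_inv2 (r y i - r (xs s j) i) (r y' i - r (x j) i).
  have A4 : Rabs (r y i - r (xs s j) i - (r y' i - r (x j) i)) <= 3 * d by apply/Rabs_leE; lra.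
  have A5 := Rabs_pos (y i - r y i); have A6 := Rabs_pos (y' i - r y' i).
  have : Rabs (Rabs (r y i - r (xs s j) i) - Rabs (r y' i - r (x j) i)) <= 3 * d by lra.
  by move=> /Rabs_leE ?; apply/Rabs_leE; lra.
rewrite -Rmult_minus_distr_l Rabs_mult (Rabs_pos_eq (INR j)); first exact: pos_INR.
have Hm0 := pos_INR m.
have Hcl : Rabs (clamp (INR m * gap r m y (r (xs s j)) - 1) - clamp (INR m * gap r m y' (r (x j)) - 1)) <= INR m * (5 * d).
  apply: clamp_close; first by apply: Rmult_le_pos; lra.
  have -> : INR m * gap r m y (r (xs s j)) - 1 - (INR m * gap r m y' (r (x j)) - 1) =
    INR m * (gap r m y (r (xs s j)) - gap r m y' (r (x j))) by ring.
  by rewrite Rabs_mult (Rabs_pos_eq (INR m)) //; apply: Rmult_le_compat_l.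
apply: Rle_trans (_ : INR (S J) * (INR (S m) * (5 * d)) <= _).
  apply: Rmult_le_compat => //; [exact: pos_INR | exact: Rabs_pos | by apply: le_INR; lia |].
  by apply: Rle_trans Hcl _; apply: Rmult_le_compat_r; [lra | apply: le_INR; lia].
have -> : INR (S J) * (INR (S m) * (5 * d)) = e; last lra.
rewrite -Rmult_assoc -/C /d; field; lra.
Qed.

(** * Bounds chosen after the whole sequence *)

Definition tail_osc n m (x : nat -> Romega) := sup (fun k => (n <= k)%nat) (fun k => osc m k x).

Lemma tail_osc_ub n m x k p : @cv Ec x p -> r p = p -> (n <= k)%nat -> osc m k x <= tail_osc n m x.
Proof.
move=> Hx Hp Hk; have [M HM] := osc_bounded x p m Hx Hp.
by apply: (sup_ub _ (fun k => (n <= k)%nat) (fun k => osc m k x) M k).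
Qed.

Lemma tail_osc_le n m x c : (forall k, (n <= k)%nat -> osc m k x <= c) -> tail_osc n m x <= c.
Proof. by move=> H; apply: sup_le => //; exists n. Qed.

Lemma tail_osc_cv n m (u : nat -> Vc) (x : Vc) : cv u x ->
  Un_cv (fun s => tail_osc n m (proj1_sig (u s))) (tail_osc n m (proj1_sig x)).
Proof.
move=> H; have [p [Hp Hx]] := proj2_sig x; apply/cvE => e He.
have [M HM] := osc_bounded _ p m Hx Hp.
apply: ev_mono (osc_unif _ _ p m (e / 2) H Hx Hp ltac:(lra)) => s Hs.
apply: Rle_lt_trans (_ : e / 2 < e); last lra.
by apply: (sup_close _ _ _ _ M) => //; exists n.
Qed.

(* The bounds must decrease with [n]: a single bound exceeding every [osc m k] could equal their
   supremum, whereas each term of a decreasing sequence strictly exceeds the remaining tail. *)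
Definition ctlA n (x : Vc) (N : nat -> Ec) (v : Ec) : Prop :=
  match n with
  | 0 => forall m, tail_osc 0 m (proj1_sig x) < v m
  | S k => forall m, tail_osc (S k) m (proj1_sig x) < v m < N k m
  end.

Definition ctlF n (x : Vc) (N : nat -> Ec) (v : Ec) : Ec :=
  match n with
  | 0 => fun m => ln (v m - tail_osc 0 m (proj1_sig x))
  | S k => fun m => enc (tail_osc (S k) m (proj1_sig x)) (N k m) (v m)
  end.

Definition ctlG n (x : Vc) (N : nat -> Ec) (z : Ec) : Ec :=
  match n with
  | 0 => fun m => tail_osc 0 m (proj1_sig x) + exp (z m)
  | S k => fun m => dec (tail_osc (S k) m (proj1_sig x)) (N k m) (z m)
  end.

Definition tail_space := subc (prodc Vc (powc Ec)) (fun xN => forall n,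
  ctlA n (fst xN) (snd xN) (snd xN n)).

(** Tails decrease with [k], so the interval left for the next bound is nonempty. *)
Lemma ctl_room k x N : adm Vc Ec ctlA (S k) x N -> forall m, tail_osc (S k) m (proj1_sig x) < N k m.
Proof.
move=> H m; apply: Rle_lt_trans (_ : tail_osc k m (proj1_sig x) < _).
  have [p [Hp Hx]] := proj2_sig x.
  by apply: tail_osc_le => j Hj; apply: (tail_osc_ub _ _ _ _ p) => //; lia.
by have := H k (Nat.lt_succ_diag_r k); case: k {H} => [|k] /= /(_ m) // [].
Qed.

Lemma tail_space_homeo : homeo tail_space (prodc Vc (powc Ec)).
Proof.
apply: (tower Vc Ec Ec (fun _ => 0) ctlA ctlF ctlG).
- case=> [//|k] b y y' z Hag /=; apply: functional_extensionality => m; rewrite -(Hag k) //; lia.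
- case=> [|k] x N z Hadm /= m; first exact: Rlt_plus_exp.
  by apply: dec_bd; apply: ctl_room.
- case=> [|k] x N z Hadm /=; apply: functional_extensionality => m.
    transitivity (ln (exp (z m))); last exact: ln_exp. by congr ln; ring.
  by apply: enc_dec; apply: ctl_room.
- case=> [|k] x N v Hadm /= HA; apply: functional_extensionality => m.
    rewrite exp_ln; last ring. exact: (proj2 (Rlt_0_minus _ _) (HA m)).
  exact: dec_enc.
- case=> [|k] xs x Ns N vs v Hx HN _ _ HAs HA Hv m /=.
    apply: cv_ln; first exact: (proj2 (Rlt_0_minus _ _) (HA m)).
    by apply: CV_minus; [exact: Hv | exact: tail_osc_cv].
  by apply: enc_cv; [exact: HA | exact: tail_osc_cv | apply: HN; lia | exact: Hv].
- case=> [|k] xs x Ns N zs z Hx HN _ _ Hz m /=.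
    by apply: CV_plus; [exact: tail_osc_cv | apply: cv_exp; apply: Hz].
  by apply: dec_cv; [exact: tail_osc_cv | apply: HN; lia | exact: Hz].
Qed.

End Factor.

Lemma homeo_unit T : homeo (prodc unitc T) T.
Proof.
exists (fun x => snd x), (fun y => (tt, y)); split; [by move=> u x [] | split; [|split=> //]].
- by move=> u x H; split.
- by move=> [[] y].
Qed.

Lemma small_level e i : 0 < e -> exists m, (i < m)%nat /\ 0 < INR m /\ 2 / INR m < e.
Proof.
move=> He; have [N HN] := inv_S_small (e / 2) ltac:(lra).
exists (S (N + i)); split; [lia | split; first by apply: lt_0_INR; lia].
by have := HN (N + i)%nat ltac:(lia); rewrite /Rdiv; lra.
Qed.

(** * The two orders of choice describe the same space *)

Section Absorb.
Variable r : Romega -> Romega.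
Hypothesis r_cont : scont Ec Ec r.
Hypothesis r_idem : forall x, r (r x) = r x.

(** The common form of both admissibility conditions: [ctlAE] recovers it when the sequence is given
    first, [stepAE] when points and bounds alternate. *)
Definition ctl_ok (x : nat -> Romega) (N : nat -> Romega) :=
  forall m k, osc r m k x < N k m /\ N (S k) m < N k m.

Lemma ctl_decr x N m k : ctl_ok x N -> N k m <= N 0%nat m.
Proof. by move=> H; elim: k => [|k IH]; [lra | have [_ ?] := H m k; lra]. Qed.

(** The oscillation at time [S n] is below [B <= j / 2], so the clamp at [j] is below [1 / 2] and
    the gap below [2 / m]. A bound [B] in place of [N 0 m] lets one [j] serve a whole convergent
    family of bounds. *)
Lemma ctl_bound x N B m j n i : ctl_ok x N -> N 0%nat m <= B -> 2 * B <= INR j -> 0 < INR j ->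
  0 < INR m -> (i < m)%nat -> (j <= n)%nat ->
  Rabs (x (S n) i - r (x (S n)) i) + Rabs (r (x (S n)) i - r (x j) i) < 2 / INR m.
Proof.
move=> H HB Hj Hj0 Hm Hi Hjn.
have [Hw _] := H m (S n); have HNn := ctl_decr x N m (S n) H.
have H1 := ray_osc_ub r m n x (x (S n)) 1 ltac:(rewrite /I01; lra).
rewrite seg1 in H1; rewrite /= in Hw.
have H2 := bmax_ub (S n) (fun j => INR j * clamp (INR m * gap r m (x (S n)) (r (x j)) - 1)) j ltac:(lia).
rewrite -/(weighted_gap r m n x (x (S n))) in H2.
have Hcl : INR j * clamp (INR m * gap r m (x (S n)) (r (x j)) - 1) < INR j * (1 / 2) by lra.
have /clamp_half Hg := Rmult_lt_reg_l _ _ _ Hj0 Hcl.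
have H3 := bmax_ub m (fun i => Rabs (x (S n) i - r (x (S n)) i) + Rabs (r (x (S n)) i - r (x j) i)) i Hi.
rewrite -/(gap r m (x (S n)) (r (x j))) in H3.
apply: Rle_lt_trans H3 _; apply: (Rmult_lt_reg_l (INR m)) => //.
have -> : INR m * (2 / INR m) = 2 by field; lra.
lra.
Qed.

Lemma big_index B : exists j, 2 * B <= INR j /\ 0 < INR j.
Proof.
have [n Hn] := INR_unbounded (2 * B); exists (S n).
by rewrite S_INR; have := pos_INR n; lra.
Qed.

(** By [ctl_bound] the points [r (x n)] form a Cauchy sequence in each coordinate and
    [x n - r (x n)] tends to [0]. Both sequences thus have the same limit, which [r] fixes by
    continuity. *)
Lemma ctl_cv x N : ctl_ok x N -> exists p, r p = p /\ @cv Ec x p.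
Proof.
move=> H.
have Hc i : {l | Un_cv (fun n => r (x n) i) l}.
  apply: R_complete => e He.
  have [m [Hi [Hm Hme]]] := small_level (e / 2) i ltac:(lra).
  have [j [Hj Hj0]] := big_index (N 0%nat m).
  have key n : (S j <= n)%nat -> Rabs (r (x n) i - r (x j) i) < e / 2.
    case: n => [|n] Hn; first lia.
    have := ctl_bound x N _ m j n i H (Rle_refl _) Hj Hj0 Hm Hi ltac:(lia).
    by have := Rabs_pos (x (S n) i - r (x (S n)) i); lra.
  exists (S j) => a b Ha Hb; rewrite /Rdist.
  have := key a Ha; have := key b Hb => /Rabs_ltE ? /Rabs_ltE ?; apply/Rabs_ltE; lra.
pose p : Romega := fun i => proj1_sig (Hc i).
have Hrp : @cv Ec (fun n => r (x n)) p by move=> i; exact: (proj2_sig (Hc i)).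
have Hx : @cv Ec x p.
  move=> i; apply/cvE => e He.
  have [m [Hi [Hm Hme]]] := small_level (e / 2) i ltac:(lra).
  have [j [Hj Hj0]] := big_index (N 0%nat m).
  have [n0 Hn0] := cv_ev _ _ (e / 2) (Hrp i) ltac:(lra).
  exists (n0 + S j)%nat => -[|n] Hn; first lia.
  have := ctl_bound x N _ m j n i H (Rle_refl _) Hj Hj0 Hm Hi ltac:(lia).
  have := Rabs_pos (r (x (S n)) i - r (x j) i); have := Hn0 (S n) ltac:(lia) => /Rabs_ltE ? ? ?.
  have : Rabs (x (S n) i - r (x (S n)) i) < e / 2 by lra.
  by move=> /Rabs_ltE ?; apply/Rabs_ltE; lra.
exists p; split=> //; apply: functional_extensionality => i.
exact: UL_sequence (r_cont _ _ Hx i) (Hrp i).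
Qed.

(** Eventually [Ns s 0 m <= N 0 m + 1], so one [j] works for all large [s]: every later term is
    within [e / 3] of [r (xs s j)], resp. [r (x j)], and these two are [e / 3] close. Pointwise
    convergence handles the terms up to [j]. *)
Lemma ctl_ucv xs Ns x N : (forall s, ctl_ok (xs s) (Ns s)) -> ctl_ok x N ->
  (forall n, @cv Ec (fun s => xs s n) (x n)) -> (forall n, @cv Ec (fun s => Ns s n) (N n)) ->
    ucv xs x.
Proof.
move=> Hs H Hx HN i e He.
have [m [Hi [Hm Hme]]] := small_level (e / 3) i ltac:(lra).
have [a Ha] := cv_ev _ _ 1 (HN 0%nat m) ltac:(lra).
have [j [Hj Hj0]] := big_index (N 0%nat m + 1).
have [b Hb] := cv_ev _ _ (e / 3) (r_cont _ _ (Hx j) i) ltac:(lra).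
have [c Hc] : ev (fun s => forall n, (n < S j)%nat -> Rabs (xs s n i - x n i) < e).
  by apply: ev_lt => n _; exact: cv_ev (Hx n i) He.
exists (a + b + c)%nat => s Hsn n.
case: (Nat.lt_ge_cases n (S j)) => Hn; first by apply: Hc => //; lia.
case: n Hn => [|n] Hn; first lia.
have HB : Ns s 0%nat m <= N 0%nat m + 1 by have := Ha s ltac:(lia) => /Rabs_ltE; lra.
have := ctl_bound _ _ _ m j n i (Hs s) HB Hj Hj0 Hm Hi ltac:(lia).
have := ctl_bound _ _ (N 0%nat m + 1) m j n i H ltac:(lra) Hj Hj0 Hm Hi ltac:(lia).
have := Hb s ltac:(lia); move: (x (S n) i) (xs s (S n) i) (r (x (S n)) i) (r (xs s (S n)) i) =>
  X Xs P Ps.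
move=> /Rabs_ltE ? H1 H2.
have H3 : Rabs (X - r (x j) i) < e / 3.
  by apply: Rle_lt_trans (Rlt_trans _ _ _ H1 Hme); have := Rabs_triang (X - P) (P - r (x j) i);
    have -> : X - P + (P - r (x j) i) = X - r (x j) i by ring.
have H4 : Rabs (Xs - r (xs s j) i) < e / 3.
  by apply: Rle_lt_trans (Rlt_trans _ _ _ H2 Hme);
    have := Rabs_triang (Xs - Ps) (Ps - r (xs s j) i);
    have -> : Xs - Ps + (Ps - r (xs s j) i) = Xs - r (xs s j) i by ring.
by move: H3 H4 => /Rabs_ltE ? /Rabs_ltE ?; apply/Rabs_ltE; lra.
Qed.

Lemma ctlAE (xN : prodc (Vc r) (powc Ec)) : (forall n, ctlA r n (fst xN) (snd xN) (snd xN n)) <->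
  ctl_ok (proj1_sig (fst xN)) (snd xN).
Proof.
case: xN => x N /=; have [p [Hp Hx]] := proj2_sig x; split=> H.
- move=> m k; split; last by have /= /(_ m) [] := H (S k).
  apply: Rle_lt_trans (tail_osc_ub r r_cont k m _ k p Hx Hp (Nat.le_refl k)) _.
  by have := H k; case: k => [|k] /= /(_ m) // [].
- have HW k m : tail_osc r k m (proj1_sig x) < N k m.
    (* A supremum of values below [N k m] might equal it. Here all oscillations after time [k] stay
       below [N (S k) m], so the supremum is at most the larger of two numbers that are strictly
       below [N k m]. *)
    apply: Rle_lt_trans (_ : Rmax (osc r m k (proj1_sig x)) (N (S k) m) < _).
      apply: tail_osc_le => j Hj; case: (Nat.eq_dec j k) => [->|Hne]; first exact: Rmax_l.
      apply: Rle_trans (Rmax_r _ _); apply: Rle_trans (Rlt_le _ _ (proj1 (H m j))) _.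
      have : (S k <= j)%nat by lia.
      elim: j {Hj Hne} => [|j IH] Hj; first lia.
      case: (Nat.eq_dec j k) => [->|Hne]; first lra.
      by have := IH ltac:(lia); have [_ ?] := H m j; lra.
    by have [H1 H2] := H m k; apply: Rmax_lub_lt.
  by case=> [|k] /= m; [exact: HW | split; [exact: HW | exact: proj2 (H m k)]].
Qed.

Lemma stepAE (y : nat -> Yc) : (forall n, stepA r n tt y (y n)) <->
  ctl_ok (fun n => fst (y n)) (fun n => snd (y n)).
Proof.
split=> H.
- move=> m k; split; last by have /= /(_ m) [] := H (S k).
  by have := H k; case: k => [|k] /= /(_ m) // [].
- by case=> [|k] /= m; [have [] := H m 0%nat | split; [have [] := H m (S k) | have [] := H m k]].
Qed.

Lemma tail_step_homeo : homeo (tail_space r) (step_space r).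
Proof.
have Hf (xN : tail_space r) : forall n, stepA r n tt (fun n => (proj1_sig (fst (proj1_sig xN)) n,
  snd (proj1_sig xN) n) : Yc)
    (proj1_sig (fst (proj1_sig xN)) n, snd (proj1_sig xN) n).
  by apply/(stepAE (fun n => (proj1_sig (fst (proj1_sig xN)) n, snd (proj1_sig xN) n))) => /=;
    apply/ctlAE; exact: (proj2_sig xN).
have Hok (y : step_space r) : ctl_ok (fun n => fst (snd (proj1_sig y) n)) (fun n =>
  snd (snd (proj1_sig y) n)).
  by apply/stepAE; move: (proj2_sig y); case: (fst (proj1_sig y)).
pose toV (y : step_space r) : Vc r := exist (fun x : nat -> Romega => exists p : Romega,
  r p = p /\ @cv Ec x p)
  (fun n => fst (snd (proj1_sig y) n)) (ctl_cv _ _ (Hok y)).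
have Hg (y : step_space r) : forall n, ctlA r n (toV y) (fun n =>
  snd (snd (proj1_sig y) n)) (snd (snd (proj1_sig y) n)).
  exact: (proj2 (ctlAE (toV y, fun n => snd (snd (proj1_sig y) n))) (Hok y)).
exists (fun xN => exist (fun by_ : prodc unitc (powc Yc) => forall n,
  stepA r n (fst by_) (snd by_) (snd by_ n))
  (tt, fun n => (proj1_sig (fst (proj1_sig xN)) n, snd (proj1_sig xN) n)) (Hf xN)).
exists (fun y => exist (fun xN : prodc (Vc r) (powc Ec) => forall n,
  ctlA r n (fst xN) (snd xN) (snd xN n))
  (toV y, fun n => snd (snd (proj1_sig y) n)) (Hg y)).
split; [|split; [|split]].
- move=> u xN [H1 H2]; split=> // n; split; last exact: H2.
  exact: (ucv_cv (fun s => proj1_sig (fst (proj1_sig (u s)))) _ n H1).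
- move=> u y [_ H2]; split; last by move=> n; have [] := H2 n.
  apply: (ctl_ucv _ (fun s n => snd (snd (proj1_sig (u s)) n)) _ _ (fun s =>
    Hok (u s)) (Hok y)) => n; by have [] := H2 n.
- move=> [[x N] H]; apply: sig_eq => /=; congr pair; exact: sig_eq.
- move=> [[[] y] H]; apply: sig_eq => /=; congr pair.
  by apply: functional_extensionality => n; rewrite -surjective_pairing.
Qed.

Lemma retract_absorb : homeo (prodc (Kc r) Ec) Ec.
Proof.
apply: (factor_absorb _ (prodc c0E Ec)).
apply: homeo_trans (homeo_sym _ _ (homeo_assoc _ _ _)) _.
apply: homeo_trans (homeo_prod _ _ _ _ (homeo_sym _ _ (V_homeo r)) homeo_Ec_pow) _.
apply: homeo_trans (homeo_sym _ _ (tail_space_homeo r r_cont)) _.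
apply: homeo_trans tail_step_homeo _.
apply: homeo_trans (step_space_homeo r r_cont r_idem) _.
apply: homeo_trans (homeo_unit _) _.
apply: homeo_trans (homeo_pow _ _ homeo_Ec_prod) _.
exact: homeo_sym homeo_Ec_pow.
Qed.

End Absorb.

(** * The hyperspace of compact max-plus convex sets *)

Definition elt (A : mpcc) (x : Romega) : Prop := proj1_sig A x.

Lemma mpcc_ext A B : (forall x, elt A x <-> elt B x) -> A = B.
Proof.
move=> H; apply: sig_eq; apply: functional_extensionality => x.
exact: propositional_extensionality.
Qed.

(** The normal form of a max-plus combination: one coefficient is [0], and the other is a finite
    [l <= 0], as -oo would just return [a]. *)
Definition mpc (l : R) (a b : Romega) : Romega := fun i => Rmax (a i) (l + b i).

Lemma mp_convexE (A : Romega -> Prop) :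
  mp_convex A <-> (forall a b l, l <= 0 -> A a -> A b -> A (mpc l a b)).
Proof.
split=> [H a b l Hl Ha Hb|H a b [al|] [be|] Ha Hb //= E].
- have [|c [Hc Hcn]] := H a b (Some 0) (Some l) Ha Hb; first by rewrite /= Rmax_left.
  suff <- : c = mpc l a b by [].
  by apply: functional_extensionality => i; have := Hcn i; rewrite /mp_comb /= Rplus_0_l => -[].
- have {}E : Rmax al be = 0 by case: E.
  case: (Rle_lt_dec be al) => Hle.
  + have E0 : al = 0 by rewrite -E Rmax_left.
    exists (mpc be a b); split; first by apply: H => //; lra.
    by move=> n; rewrite /mp_comb /= E0 Rplus_0_l.
  + have E0 : be = 0 by rewrite -E Rmax_right; lra.
    exists (mpc al b a); split; first by apply: H => //; lra.
    by move=> n; rewrite /mp_comb /= E0 Rplus_0_l Rmax_comm.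
- exists a; split=> // n; case: E => ->; by rewrite /mp_comb /= Rplus_0_l.
- exists b; split=> // n; case: E => ->; by rewrite /mp_comb /= Rplus_0_l.
Qed.

Lemma is_mpccE A : is_mpcc A <-> (exists x, A x) /\ Eclosed A /\ Ebounded A /\
  (forall a b l, l <= 0 -> A a -> A b -> A (mpc l a b)).
Proof.
rewrite /is_mpcc compactE mp_convexE; tauto.
Qed.

Lemma elt_ex A : exists x, elt A x.
Proof. by have [] := proj2_sig A. Qed.

Lemma elt_compact A : compact_in prod_open (elt A).
Proof. by have [? []] := proj2_sig A. Qed.

Lemma elt_closed A : Eclosed (elt A).
Proof. by have /is_mpccE [? []] := proj2_sig A. Qed.

Lemma elt_bounded A : Ebounded (elt A).
Proof. by have /is_mpccE [? [? []]] := proj2_sig A. Qed.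

Lemma elt_mpc A a b l : l <= 0 -> elt A a -> elt A b -> elt A (mpc l a b).
Proof. by have /is_mpccE [? [? [? H]]] := proj2_sig A; apply: H. Qed.

Lemma singleton_mpcc x : is_mpcc (fun y => y = x).
Proof.
apply/is_mpccE; split; [by exists x | split; [|split]].
- move=> y Hy; apply: functional_extensionality => i; apply: cond_eq => e He.
  by have [a [-> Hn]] := Hy (S i) e He; rewrite Rabs_minus_sym; apply: Hn; lia.
- by move=> i; exists (Rabs (x i)) => a ->; lra.
- by move=> a b l Hl -> ->; apply: functional_extensionality => i; rewrite /mpc Rmax_left; lra.
Qed.

Definition single x : mpcc := exist _ _ (singleton_mpcc x).

(** * Hausdorff convergence of sets and continuity of suprema *)

Definition hnear k e (A B : mpcc) :=
  (forall a, elt A a -> exists b, elt B b /\ near k e a b) /\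
  (forall b, elt B b -> exists a, elt A a /\ near k e a b).

Definition Xc := CSpace mpcc (fun u A => forall k e, 0 < e -> ev (fun s => hnear k e (u s) A)).

Lemma hnear_eq A B : (forall k e, 0 < e -> hnear k e A B) -> A = B.
Proof.
move=> H; apply: mpcc_ext => x; split=> Hx.
- apply: elt_closed => k e He; have [b [Hb Hn]] := proj1 (H k e He) x Hx.
  by exists b; split=> //; apply: near_sym.
- by apply: elt_closed => k e He; have [b [Hb Hn]] := proj2 (H k e He) x Hx; exists b.
Qed.

Lemma ev_bounded (u : nat -> R) b : ev (fun s => Rabs (u s) <= b) -> exists c, forall s,
  Rabs (u s) <= c.
Proof.
move=> [N HN]; exists (Rmax b (bmax N (fun s => Rabs (u s)))) => s.
case: (Nat.lt_ge_cases s N) => Hs; last exact: Rle_trans (HN s Hs) (Rmax_l _ _).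
apply: Rle_trans (Rmax_r _ _); exact: (bmax_ub N (fun s => Rabs (u s))).
Qed.

Lemma Xcv_low (u : nat -> Xc) (A : Xc) σ x : cv u A -> incr σ -> elt A x ->
  exists τ xs, incr τ /\ (forall s, elt (u (σ (τ s))) (xs s)) /\ @cv Ec xs x.
Proof.
move=> Hu Hσ Hx.
have [|τ [Hτ Hτn]] := frequently_incr (fun k n => exists y, elt (u (σ n)) y /\
  near k (/ INR (S k)) y x).
  move=> k N; have [M HM] := Hu k _ (inv_S_pos k).
  exists (N + M)%nat; split; first lia.
  have := incr_ge σ Hσ (N + M)%nat => ?.
  have [_ H] := HM (σ (N + M)%nat) ltac:(lia); by have [y [Hy Hn]] := H x Hx; exists y.
have [xs xsP] := functional_choice _ Hτn.
exists τ, xs; split=> //; split; first by move=> s; case: (xsP s).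
apply: near_cv => k e He; have [N HN] := inv_S_small e He.
exists (k + N)%nat => n Hn; apply: near_le (proj2 (xsP n)); [lia | apply: Rlt_le; apply: HN; lia].
Qed.

Lemma Xcv_up (u : nat -> Xc) (A : Xc) σ (xs : nat -> Romega) : cv u A -> incr σ ->
  (forall s, elt (u (σ s)) (xs s)) ->
  exists τ x, incr τ /\ elt A x /\ @cv Ec (fun s => xs (τ s)) x.
Proof.
move=> Hu Hσ Hxs.
have Hus k e : 0 < e -> ev (fun s => hnear k e (u (σ s)) A).
  by move=> He; apply: (ev_sub σ (fun s => hnear k e (u s) A)) => //; apply: Hu.
have [i|τ [x [Hτ Hx]]] := bounded_subseq xs.
  have [b Hb] := elt_bounded A i.
  apply: (ev_bounded (fun s => xs s i) (b + 1)); apply: ev_mono (Hus (S i) 1 ltac:(lra)) => s [H _].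
  have [a [Ha Hn]] := H _ (Hxs s); have := Hb a Ha; have := Hn i (Nat.lt_succ_diag_r i).
  by move=> /Rabs_ltE ? /Rabs_leE ?; apply/Rabs_leE; lra.
exists τ, x; split=> //; split=> //; apply: elt_closed => k e He.
have H1 := ev_sub τ _ Hτ (Hus k (e / 2) ltac:(lra)).
have [N HN] := ev_and _ _ H1 (cv_near _ x k (e / 2) Hx ltac:(lra)).
have [[H2 _] H3] := HN N (Nat.le_refl N).
have [a [Ha Hn]] := H2 _ (Hxs (τ N)); exists a; split=> //.
have -> : e = e / 2 + e / 2 by lra.
by apply: near_trans H3; apply: near_sym.
Qed.

Lemma scont_bounded (g : Romega -> R) A : scont Ec Rcs g -> exists M, forall x, elt A x -> g x <= M.
Proof.
move=> Hg; apply: NNPP => Hno.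
have H n : exists x, elt A x /\ INR n < g x.
  apply: NNPP => H; apply: Hno; exists (INR n) => x Hx; apply: Rnot_lt_le => Hlt; apply: H;
    by exists x.
have [x xP] := functional_choice _ H.
have [s [y [Hs [Hy Hc]]]] := compact_subseq _ x (elt_compact A) (fun n => proj1 (xP n)).
have [N HN] := cv_ev _ _ 1 (Hg _ _ Hc) ltac:(lra).
have [M HM] := INR_unbounded (g y + 1).
have := HN (N + M)%nat ltac:(lia) => /Rabs_ltE; have [_ H1] := xP (s (N + M)%nat).
have := le_INR _ _ (incr_ge s Hs (N + M)%nat); rewrite plus_INR; have := pos_INR N; lra.
Qed.

Definition supX (g : Romega -> R) (A : mpcc) := sup (elt A) g.

Lemma supX_cv g : scont Ec Rcs g -> scont Xc Rcs (supX g).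
Proof.
move=> Hg u A Hu.
apply: (sup_conv Ec (fun s => elt (u s)) (elt A) (fun _ => g) g).
- exact: elt_ex.
- by move=> s; exact: elt_ex.
- by move=> σ x Hσ Hx; exact: Xcv_low Hu Hσ Hx.
- by move=> σ xs Hσ Hxs; exact: Xcv_up Hu Hσ Hxs.
- by move=> σ xs x _ _ _ Hc; exact: Hg.
- by move=> s; exact: scont_bounded.
- exact: scont_bounded.
Qed.

Lemma supX_ub g A x : scont Ec Rcs g -> elt A x -> g x <= supX g A.
Proof. by move=> Hg; have [M HM] := scont_bounded g A Hg; apply: sup_ub HM. Qed.

Lemma supX_near g A e : scont Ec Rcs g -> 0 < e -> exists x, elt A x /\ supX g A - e < g x.
Proof. move=> Hg; have [M HM] := scont_bounded g A Hg; exact: sup_near (elt_ex A) HM. Qed.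

(** * A countable dense set *)

Definition rv c : R := let (a, bd) := Cantor.of_nat c in let (b, d) := Cantor.of_nat bd in
  (INR a - INR b) / INR (S d).

Lemma rv_dense x e : 0 < e -> exists c, Rabs (rv c - x) < e.
Proof.
move=> He; have [d Hd] := inv_S_small e He; have {}Hd := Hd d (Nat.le_refl d).
have HD : 0 < INR (S d) by apply: lt_0_INR; lia.
pose z := up (x * INR (S d)).
exists (Cantor.to_nat (Z.to_nat z, Cantor.to_nat (Z.to_nat (- z), d))).
rewrite /rv !Cantor.cancel_of_to.
have -> : INR (Z.to_nat z) - INR (Z.to_nat (- z)) = IZR z.
  by rewrite !INR_IZR_INZ -minus_IZR; congr IZR; lia.
have [H1 H2] := archimed (x * INR (S d)).
have -> : IZR z / INR (S d) - x = (IZR z - x * INR (S d)) * / INR (S d) by field; lra.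
rewrite Rabs_mult (Rabs_pos_eq (/ _)); first exact: Rlt_le (inv_S_pos d).
rewrite Rabs_pos_eq; first by rewrite /z; lra.
have := Rmult_le_compat_r (/ INR (S d)) _ _ (Rlt_le _ _ (inv_S_pos d)) H2.
rewrite -/z; lra.
Qed.

(** Iterated unpairing: every finite list of digits begins the digit sequence of some [n], and
    density in the product topology asks no more. *)
Fixpoint dig i n := match i with
  | 0 => fst (Cantor.of_nat n)
  | S i => dig i (snd (Cantor.of_nat n)) end.

Definition qd n : Romega := fun i => rv (dig i n).

Lemma qd_dense k e x : 0 < e -> exists n, near k e (qd n) x.
Proof.
move=> He; elim: k x => [|k IH] x; first by exists 0%nat => i; lia.
have [n Hn] := IH (fun i => x (S i)); have [c Hc] := rv_dense (x 0%nat) e He.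
set N := Cantor.to_nat (c, n); have HN : Cantor.of_nat N = (c, n) by exact: Cantor.cancel_of_to.
exists N => -[|i] Hi; rewrite /qd /dig -/dig HN; first exact: Hc.
by apply: Hn; lia.
Qed.

(** * A closed embedding of the hyperspace into [Romega] *)

Definition nrm k (x y : Romega) := bmax k (fun i => Rabs (x i - y i)).

Lemma nrm_cv k y : scont Ec Rcs (fun x => nrm k x y).
Proof. by move=> u x Hu; apply: bmax_cv => i _; apply: cv_cvabs;
  exact: CV_minus (Hu i) (cv_const _). Qed.

(* The suprema of [x_i] and [- x_i] bound the set; those of [- |x - q|_k] locate its points. *)
Definition embfun n (x : Romega) : R := match Cantor.of_nat n with
  | (0%nat, i) => x i
  | (1%nat, i) => - x i
  | (_, c) => - nrm (fst (Cantor.of_nat c)) x (qd (snd (Cantor.of_nat c))) end.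

Lemma embfun_cv n : scont Ec Rcs (embfun n).
Proof.
rewrite /embfun; case: (Cantor.of_nat n) => -[|[|_]] i u x Hu; [exact: Hu | exact: cv_opp (Hu i) |].
apply: cv_opp; exact: nrm_cv.
Qed.

Definition embX (A : mpcc) : Romega := fun n => supX (embfun n) A.

Lemma embX_cv : scont Xc Ec embX.
Proof. by move=> u A Hu n; apply: (supX_cv (embfun n)) => //; exact: embfun_cv. Qed.

Section Complete.
Variables (u : nat -> mpcc) (y : Romega).
Hypothesis Hy : @cv Ec (fun s => embX (u s)) y.

Lemma embX_ev_bounded i : exists b, ev (fun s => forall a, elt (u s) a -> Rabs (a i) <= b).
Proof.
pose n0 := Cantor.to_nat (0%nat, i); pose n1 := Cantor.to_nat (1%nat, i).
have H0 := cv_ev _ _ 1 (Hy n0) ltac:(lra); have H1 := cv_ev _ _ 1 (Hy n1) ltac:(lra).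
exists (Rmax (y n0 + 1) (y n1 + 1)).
apply: ev_mono (ev_and _ _ H0 H1) => s [/Rabs_ltE Hs0 /Rabs_ltE Hs1] a Ha.
have := supX_ub (embfun n0) (u s) a (embfun_cv n0) Ha;
  have := supX_ub (embfun n1) (u s) a (embfun_cv n1) Ha.
rewrite -/(embX (u s) n0) -/(embX (u s) n1) /embfun /n0 /n1 !Cantor.cancel_of_to -/n0 -/n1 => ? ?.
have := Rmax_l (y n0 + 1) (y n1 + 1); have := Rmax_r (y n0 + 1) (y n1 + 1) => ? ?.
by apply/Rabs_leE; lra.
Qed.

Lemma embX_subseq σ (xs : nat -> Romega) : incr σ -> (forall s, elt (u (σ s)) (xs s)) ->
  exists τ x, incr τ /\ @cv Ec (fun s => xs (τ s)) x.
Proof.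
move=> Hσ Hxs; apply: bounded_subseq => i; have [b Hb] := embX_ev_bounded i.
apply: (ev_bounded (fun s => xs s i) b).
by apply: ev_mono (ev_sub σ _ Hσ Hb) => s; apply.
Qed.

Definition liminf_set (x : Romega) : Prop :=
  forall k e, 0 < e -> ev (fun s => exists a, elt (u s) a /\ near k e a x).

(** Closeness to a dense point [q] is read off the supremum of [- |x - q|_k]. Since these suprema
    converge along the whole sequence, closeness seen along a subsequence is eventually always
    present. *)
Lemma cluster_liminf σ (xs : nat -> Romega) (x : Romega) : incr σ -> (forall s,
  elt (u (σ s)) (xs s)) ->
  @cv Ec xs x -> liminf_set x.
Proof.
move=> Hσ Hxs Hx k e He.
have [q Hq] := qd_dense k (e / 4) x ltac:(lra).
pose n := Cantor.to_nat (2%nat, Cantor.to_nat (k, q)).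
have gE z : embfun n z = - nrm k z (qd q) by rewrite /embfun /n !Cantor.cancel_of_to.
have Hlow : - (e / 2) <= y n.
  apply: cv_le _ (cv_const _) (cv_sub σ _ _ Hσ (Hy n)).
  apply: ev_mono (cv_near xs x k (e / 4) Hx ltac:(lra)) => s Hs.
  have := supX_ub (embfun n) (u (σ s)) (xs s) (embfun_cv n) (Hxs s);
    rewrite gE -/(embX (u (σ s)) n).
  suff : nrm k (xs s) (qd q) <= e / 2 by lra.
  apply: bmax_le => [|i Hi]; first lra.
  by have := Hs i Hi; have := Hq i Hi => /Rabs_ltE ? /Rabs_ltE ?; apply/Rabs_leE; lra.
(* Error budget: [e / 2] from the limit, [e / 8] from convergence and [e / 8] from a near-maximizer
   put [a] within [3 / 4 * e] of [q], which is within [e / 4] of [x]. *)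
apply: ev_mono (cv_ev _ _ (e / 8) (Hy n) ltac:(lra)) => s /Rabs_ltE Hs.
have [a [Ha Hga]] := supX_near (embfun n) (u s) (e / 8) (embfun_cv n) ltac:(lra).
exists a; split=> // i Hi; rewrite -/(embX (u s) n) gE in Hga.
have := bmax_ub k (fun i => Rabs (a i - qd q i)) i Hi; rewrite -/(nrm k a (qd q)) => H1.
have {}H1 : Rabs (a i - qd q i) < 3 / 4 * e by lra.
by have := Hq i Hi; move: H1 => /Rabs_ltE ? /Rabs_ltE ?; apply/Rabs_ltE; lra.
Qed.

Lemma liminf_mpcc : is_mpcc liminf_set.
Proof.
apply/is_mpccE; split; [|split; [|split]].
- have [xs Hxs] := functional_choice _ (fun s => elt_ex (u s)).
  have [|τ [x [Hτ Hx]]] := embX_subseq (fun s => s) xs _ Hxs; first by move=> n; lia.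
  by exists x; apply: (cluster_liminf τ (fun s => xs (τ s))) => // s; apply: Hxs.
- move=> x Hx k e He; have [z [Hz Hn]] := Hx k (e / 2) ltac:(lra).
  apply: ev_mono (Hz k (e / 2) ltac:(lra)) => s [a [Ha Hna]]; exists a; split=> //.
  have -> : e = e / 2 + e / 2 by lra.
  exact: near_trans Hna Hn.
- move=> i; have [b Hb] := embX_ev_bounded i; exists (b + 1) => x Hx.
  have [N HN] := ev_and _ _ Hb (Hx (S i) 1 ltac:(lra)).
  have [H1 [a [Ha Hn]]] := HN N (Nat.le_refl N).
  have := H1 a Ha; have := Hn i (Nat.lt_succ_diag_r i) => /Rabs_ltE ? /Rabs_leE ?;
    apply/Rabs_leE; lra.
- move=> a b l Hl Ha Hb k e He.
  apply: ev_mono (ev_and _ _ (Ha k (e / 2) ltac:(lra)) (Hb k (e / 2) ltac:(lra))).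
  move=> s [[a' [Ha' Hna]] [b' [Hb' Hnb]]]; exists (mpc l a' b'); split; first exact: elt_mpc.
  move=> i Hi; apply: Rle_lt_trans (_ : e / 2 < e); last lra.
  apply: Rmax_close; first exact: Rlt_le (Hna i Hi).
  have -> : l + b' i - (l + b i) = b' i - b i by ring. exact: Rlt_le (Hnb i Hi).
Qed.

(** The lower limit is the Hausdorff limit: either kind of failure yields a subsequence of bad
    points with a cluster point, and by [cluster_liminf] cluster points of the sets lie in the lower
    limit. Closedness of the image, injectivity and continuity of the inverse all follow from
    this. *)
Lemma embX_complete : exists A : Xc, @cv Xc u A.
Proof.
pose A : mpcc := exist _ _ liminf_mpcc; exists A => k e He; apply: ev_and; apply: NNPP =>
  /not_ev Hno.
- have [σ [Hσ HP]] := frequently_incr _ (fun _ : nat => Hno).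
  have Hch s : exists a, elt (u (σ s)) a /\ ~ exists b, elt A b /\ near k e a b.
    by apply: NNPP => H; apply: (HP s) => a Ha; apply: NNPP => H'; apply: H; exists a.
  have [xs xsP] := functional_choice _ Hch.
  have [τ [x [Hτ Hx]]] := embX_subseq σ xs Hσ (fun s => proj1 (xsP s)).
  have HA : elt A x.
    by apply: (cluster_liminf (fun s => σ (τ s)) (fun s => xs (τ s))) => //;
      [apply: incr_comp | move=> s; case: (xsP (τ s))].
  have [N HN] := cv_near _ x k e Hx He.
  by apply: (proj2 (xsP (τ N))); exists x; split=> //; apply: HN.
- have [σ [Hσ HP]] := frequently_incr _ (fun _ : nat => Hno).
  have Hch s : exists b, elt A b /\ ~ exists a, elt (u (σ s)) a /\ near k e a b.
    by apply: NNPP => H; apply: (HP s) => b Hb; apply: NNPP => H'; apply: H; exists b.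
  have [xs xsP] := functional_choice _ Hch.
  have [τ [x [Hτ [HA Hx]]]] := compact_subseq _ xs (elt_compact A) (fun s => proj1 (xsP s)).
  have H1 := ev_sub (fun s => σ (τ s)) _ (incr_comp _ _ Hσ Hτ) (HA k (e / 2) ltac:(lra)).
  have [N HN] := ev_and _ _ H1 (cv_near _ x k (e / 2) Hx ltac:(lra)).
  have [[a [Ha Hn]] H2] := HN N (Nat.le_refl N).
  apply: (proj2 (xsP (τ N))); exists a; split=> //.
  have -> : e = e / 2 + e / 2 by lra.
  by apply: near_trans Hn _; apply: near_sym.
Qed.

End Complete.

Lemma Ecv_unique (u : nat -> Romega) (x y : Romega) : @cv Ec u x -> @cv Ec u y -> x = y.
Proof. by move=> Hx Hy; apply: functional_extensionality => i; exact: UL_sequence (Hx i) (Hy i).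
  Qed.

(** The alternating sequence [A, B, A, B, ...] has constant image, so it converges, and its limit
    equals both. *)
Lemma embX_inj A B : embX A = embX B -> A = B.
Proof.
move=> E; pose u s := if Nat.even s then A else B.
have Hu : @cv Ec (fun s => embX (u s)) (embX A).
  rewrite (_ : (fun s => embX (u s)) = fun _ => embX A); last exact: Ecv_const.
  by apply: functional_extensionality => s; rewrite /u; case: Nat.even.
have [C HC] := embX_complete u (embX A) Hu.
have HA : A = C.
  apply: hnear_eq => k e /(HC k e) [N HN].
  by have := HN (2 * N)%nat ltac:(lia); rewrite /u Nat.even_mul.
have HB : B = C.
  apply: hnear_eq => k e /(HC k e) [N HN].
  by have := HN (S (2 * N))%nat ltac:(lia); rewrite /u Nat.even_succ Nat.odd_mul.
by rewrite HA.
Qed.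

Lemma embX_cv_inv (u : nat -> Xc) (A : Xc) : @cv Ec (fun s => embX (u s)) (embX A) -> cv u A.
Proof.
move=> H; have [C HC] := embX_complete u _ H.
by have <- : C = A by apply: embX_inj; exact: Ecv_unique (embX_cv _ _ HC) H.
Qed.

(** * Finite max-plus combinations of sets *)

Lemma prod_subseq (A : nat -> mpcc) (as_ : nat -> nat -> Romega) : (forall s n,
  elt (A n) (as_ s n)) ->
  exists τ a, incr τ /\ (forall n, elt (A n) (a n)) /\ forall n, @cv Ec (fun s =>
    as_ (τ s) n) (a n).
Proof.
move=> H.
have [k|τ [z [Hτ Hz]]] := bounded_subseq (fun s k =>
  as_ s (fst (Cantor.of_nat k)) (snd (Cantor.of_nat k))).
  have [b Hb] := elt_bounded (A (fst (Cantor.of_nat k))) (snd (Cantor.of_nat k)).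
  by exists b => s; apply: Hb.
have Hc n : @cv Ec (fun s => as_ (τ s) n) (fun i => z (Cantor.to_nat (n, i))).
  by move=> i; have := Hz (Cantor.to_nat (n, i)); rewrite Cantor.cancel_of_to.
exists τ, (fun n i => z (Cantor.to_nat (n, i))); split=> //; split=> // n.
exact: closed_cv (elt_closed (A n)) (fun s => H (τ s) n) (Hc n).
Qed.

(* [bmax] starts at [0], so exponentiating turns the weight [-oo] into the harmless
   factor [t n = 0]. *)
Definition mpsum L (t : nat -> R) (a : nat -> Romega) : Romega :=
  fun i => ln (bmax L (fun n => t n * exp (a n i)) / bmax L t).

Definition weights L (t : nat -> R) := (forall n, 0 <= t n) /\ 0 < bmax L t.

Lemma mpsum_pos L t (a : nat -> Romega) i : weights L t -> 0 < bmax L (fun n => t n * exp (a n i)).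
Proof.
move=> [Ht HT]; apply: Rnot_le_lt => Hle; apply: (Rlt_irrefl 0).
apply: Rlt_le_trans HT _; apply: bmax_le => [|n Hn]; first lra.
have := bmax_ub L (fun n => t n * exp (a n i)) n Hn; have := exp_pos (a n i) => Hp ?.
by apply: (Rmult_le_reg_r (exp (a n i))) => //; rewrite Rmult_0_l; lra.
Qed.

Lemma exp_mpsum L t (a : nat -> Romega) i : weights L t ->
  exp (mpsum L t a i) * bmax L t = bmax L (fun n => t n * exp (a n i)).
Proof.
move=> H; have Hp := mpsum_pos L t a i H; have [_ HT] := H.
rewrite /mpsum exp_ln; first by apply: Rdiv_lt_0_compat.
by field; lra.
Qed.

Lemma mpsum_unique L t (a : nat -> Romega) i v : weights L t ->
  exp v * bmax L t = bmax L (fun n => t n * exp (a n i)) -> mpsum L t a i = v.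
Proof.
move=> H E; have [_ HT] := H; rewrite /mpsum -E /Rdiv Rmult_assoc Rinv_r; first lra.
by rewrite Rmult_1_r ln_exp.
Qed.

(** After exponentiation the shift [c] becomes a common factor and monotonicity of [bmax] remains;
    entries of weight [0] drop out. *)
Lemma mpsum_le L t (a b : nat -> Romega) i c : weights L t -> (forall n, (n < L)%nat ->
  0 < t n -> a n i <= b n i + c) ->
  mpsum L t a i <= mpsum L t b i + c.
Proof.
move=> H Hab; have [Ht HT] := H.
suff : exp (mpsum L t a i) <= exp (mpsum L t b i + c).
  by move=> Hle; apply: Rnot_lt_le => Hlt; have := exp_increasing _ _ Hlt; lra.
apply: (Rmult_le_reg_r (bmax L t)) => //.
have -> : exp (mpsum L t b i + c) * bmax L t = exp c * (exp (mpsum L t b i) * bmax L t)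
  by rewrite exp_plus; ring.
rewrite !exp_mpsum // -bmax_scale; first exact: Rlt_le (exp_pos c).
apply: bmax_mono => n Hn; case: (Ht n) => [Hp|<-]; last by rewrite !Rmult_0_l Rmult_0_r; lra.
have -> : exp c * (t n * exp (b n i)) = t n * exp (b n i + c) by rewrite exp_plus; ring.
apply: Rmult_le_compat_l; first lra.
by case: (Hab n Hn Hp) => [Hlt|->]; [apply: Rlt_le; apply: exp_increasing | lra].
Qed.

Lemma mpsum_close L t (a b : nat -> Romega) i c : weights L t ->
  (forall n, (n < L)%nat -> 0 < t n -> Rabs (a n i - b n i) <= c) ->
    Rabs (mpsum L t a i - mpsum L t b i) <= c.
Proof.
move=> H Hab.
have H1 := mpsum_le L t a b i c H; have H2 := mpsum_le L t b a i c H.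
apply/Rabs_leE; split.
- suff : mpsum L t b i <= mpsum L t a i + c by lra.
  by apply: H2 => n Hn Hp; have := Hab n Hn Hp => /Rabs_leE; lra.
- suff : mpsum L t a i <= mpsum L t b i + c by lra.
  by apply: H1 => n Hn Hp; have := Hab n Hn Hp => /Rabs_leE; lra.
Qed.

Lemma mpsum_const L t b : weights L t -> mpsum L t (fun _ => b) = b.
Proof.
move=> H; apply: functional_extensionality => i; apply: mpsum_unique => //.
have [Ht HT] := H; rewrite -bmax_scale; first exact: Rlt_le (exp_pos _).
by apply: bmax_ext => n _; ring.
Qed.

Lemma exp_max x y : exp (Rmax x y) = Rmax (exp x) (exp y).
Proof.
case: (Rle_lt_dec x y) => Hxy.
  by rewrite !Rmax_right //; case: Hxy => [Hlt|->]; [apply: Rlt_le; apply: exp_increasing | lra].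
by rewrite !Rmax_left; try lra; apply: Rlt_le; apply: exp_increasing.
Qed.

Lemma mpsum_mpc L t (a b : nat -> Romega) l : weights L t -> mpsum L t (fun n =>
  mpc l (a n) (b n)) = mpc l (mpsum L t a) (mpsum L t b).
Proof.
move=> H; apply: functional_extensionality => i; apply: mpsum_unique => //.
have [Ht HT] := H.
rewrite /mpc exp_max Rmult_comm -RmaxRmult; first lra.
rewrite exp_plus.
have -> : bmax L t * exp (mpsum L t a i) = exp (mpsum L t a i) * bmax L t by ring.
have -> : bmax L t * (exp l * exp (mpsum L t b i)) = exp l * (exp (mpsum L t b i) * bmax L t)
  by ring.
rewrite !exp_mpsum // -bmax_scale; first exact: Rlt_le (exp_pos _).
rewrite -bmax_max; apply: bmax_ext => n _.
rewrite exp_max exp_plus -RmaxRmult //; congr Rmax; ring.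
Qed.

Lemma mpsum_cv L ts t (as_ : nat -> nat -> Romega) a : (forall n, Un_cv (fun s => ts s n) (t n)) ->
  (forall n, @cv Ec (fun s => as_ s n) (a n)) -> weights L t ->
  @cv Ec (fun s => mpsum L (ts s) (as_ s)) (mpsum L t a).
Proof.
move=> Ht Ha H i; have [_ HT] := H; apply: cv_ln.
  by apply: Rdiv_lt_0_compat => //; apply: mpsum_pos.
apply: cv_div; [lra | | by apply: bmax_cv].
by apply: bmax_cv => n _; apply: CV_mult => //; apply: cv_exp; apply: Ha.
Qed.

(** Adding an entry is a single binary combination; the case split decides whether the old sum or
    the new entry gets the coefficient [0]. *)
Lemma mpsum_S L t (a : nat -> Romega) : weights L t -> (forall n, 0 <= t n) ->
  mpsum (S L) t a = if Rlt_dec 0 (t L) then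
    if Rle_dec (t L) (bmax L t) then mpc (ln (t L / bmax L t)) (mpsum L t a) (a L)
    else mpc (ln (bmax L t / t L)) (a L) (mpsum L t a)
  else mpsum L t a.
Proof.
move=> H Ht; have [_ HT] := H; apply: functional_extensionality => i.
have HS : weights (S L) t by split=> //=; apply: Rlt_le_trans HT (Rmax_l _ _).
apply: mpsum_unique => //=; rewrite -(exp_mpsum L t a i H).
have He := exp_pos (mpsum L t a i); have Hea := exp_pos (a L i).
case: Rlt_dec => Hpos /=; last first.
  have -> : t L = 0 by have := Ht L; lra.
  rewrite Rmult_0_l !Rmax_left //; [exact: bmax_pos | by apply: Rmult_le_pos; lra].
case: Rle_dec => Hle /=; rewrite /mpc exp_max exp_plus exp_ln; try by apply: Rdiv_lt_0_compat; lra.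
- rewrite (Rmax_left (bmax L t)) // Rmult_comm -RmaxRmult; first lra.
  congr Rmax; field; lra.
- rewrite (Rmax_right (bmax L t)); first lra.
  rewrite Rmult_comm -RmaxRmult; first lra.
  rewrite Rmax_comm; congr Rmax; field; lra.
Qed.

Lemma mpsum_mem L t (a : nat -> Romega) A : weights L t -> (forall n, (n < L)%nat -> 0 < t n ->
  elt A (a n)) -> elt A (mpsum L t a).
Proof.
move=> [Ht HT]; elim: L HT => [|L IH] HT Ha; first by rewrite /= in HT; lra.
have Ha' n : (n < L)%nat -> 0 < t n -> elt A (a n) by move=> Hn; apply: Ha; lia.
case: (bmax_pos L t) => [HL|HL].
- have IH' := IH HL Ha'; rewrite mpsum_S //.
  have HaL := Ha L (Nat.lt_succ_diag_r L).
  have ln_neg x : 0 < x -> x <= 1 -> ln x <= 0.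
    by move=> Hx [Hlt|->]; [rewrite -ln_1; apply: Rlt_le; apply: ln_increasing | rewrite ln_1; lra].
  case: Rlt_dec => // Hpos; case: Rle_dec => Hle; apply: elt_mpc; auto.
  + by apply: ln_neg; [apply: Rdiv_lt_0_compat | apply: (proj2 (div_unit _ _ _ _)); lra].
  + by apply: ln_neg; [apply: Rdiv_lt_0_compat | apply: (proj2 (div_unit _ _ _ _)); lra].
(* All earlier weights vanish, so the combination is its last entry. *)
- have HtL : 0 < t L by move: HT => /=; rewrite -HL Rmax_right.
  suff -> : mpsum (S L) t a = a L by apply: Ha.
  apply: functional_extensionality => i; apply: mpsum_unique => //=.
  have -> : bmax L (fun n => t n * exp (a n i)) = 0.
    apply: Rle_antisym; last exact: bmax_pos.
    apply: bmax_le => [|n Hn]; first lra.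
    have -> : t n = 0 by have := bmax_ub L t n Hn; have := Ht n; lra.
    lra.
  rewrite -HL !Rmax_right; [exact: Ht | | ring].
  by apply: Rmult_le_pos => //; exact: Rlt_le (exp_pos _).
Qed.

Definition comb L t (A : nat -> mpcc) (x : Romega) := exists a, (forall n, elt (A n) (a n)) /\
  x = mpsum L t a.

Lemma Eclosed_seq (A : Romega -> Prop) :
  (forall (u : nat -> Romega) (x : Romega), (forall n, A (u n)) -> @cv Ec u x -> A x) -> Eclosed A.
Proof.
move=> H x Hx.
have Hch n := Hx n _ (inv_S_pos n).
have [u uP] := functional_choice _ Hch.
apply: (H u) => [n|]; first by case: (uP n).
apply: near_cv => k e He; have [N HN] := inv_S_small e He.
exists (k + N)%nat => n Hn; apply: near_le (proj2 (uP n)); [lia | apply: Rlt_le; apply: HN; lia].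
Qed.

Lemma comb_mpcc L t A : weights L t -> is_mpcc (comb L t A).
Proof.
move=> H; apply/is_mpccE; split; [|split; [|split]].
- have [a Ha] := functional_choice _ (fun n => elt_ex (A n)).
  by exists (mpsum L t a), a.
- apply: Eclosed_seq => u x Hu Hx.
  have [as_ asP] := functional_choice _ Hu.
  have [τ [a [Hτ [Ha Hc]]]] := prod_subseq A as_ (fun s => proj1 (asP s)).
  exists a; split=> //; apply: (Ecv_unique _ _ _ (Ecv_sub u x τ Hτ Hx)).
  rewrite (_ : (fun s => u (τ s)) = fun s => mpsum L t (as_ (τ s))).
    by apply: functional_extensionality => s; case: (asP (τ s)).
  by apply: (mpsum_cv L (fun _ => t)) => // n; exact: cv_const.
- move=> i.
  have [b Hb] := functional_choice _ (fun n => elt_bounded (A n) i).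
  exists (bmax L b) => x [a [Ha ->]].
  (* Writing [0] as a combination of zero vectors turns the bound into an instance of
     [mpsum_close]. *)
  rewrite -[mpsum _ _ _ _]Rminus_0_r -[0]/((fun _ : nat => 0) i) -(mpsum_const L t (fun _ => 0) H).
  apply: mpsum_close => // n Hn _; rewrite Rminus_0_r.
  exact: Rle_trans (Hb n _ (Ha n)) (bmax_ub L b n Hn).
- move=> x y l Hl [a [Ha ->]] [b [Hb ->]]; exists (fun n => mpc l (a n) (b n)).
  by split; [move=> n; apply: elt_mpc | rewrite mpsum_mpc].
Qed.

(** Combinations of points of [B] stay in [B], every point of [B] is a combination of copies of
    itself, and [mpsum] is nonexpansive in its entries. This takes the place of local convexity in
    Dugundji's argument. *)
Lemma hnear_comb_close L t A B k e : weights L t -> 0 < e ->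
  (forall n, (n < L)%nat -> 0 < t n -> hnear k (e / 2) (A n) B) ->
  forall C : mpcc, (forall x, elt C x <-> comb L t A x) -> hnear k e C B.
Proof.
move=> H He HAB C HC; split.
- move=> x /HC [a [Ha ->]].
  have [|b Hb] := functional_choice (fun n y => elt B y /\ ((n < L)%nat -> 0 < t n ->
    near k (e / 2) (a n) y)).
    move=> n; case: (classic ((n < L)%nat /\ 0 < t n)) => [[Hn Hp]|Hno].
      by have [b [Hb Hnr]] := proj1 (HAB n Hn Hp) _ (Ha n); exists b.
    by have [b Hb] := elt_ex B; exists b; split=> // ? ?; exfalso; apply: Hno.
  exists (mpsum L t b); split; first by apply: mpsum_mem => // n _ _; case: (Hb n).
  move=> i Hi; apply: Rle_lt_trans (_ : e / 2 < e); last lra.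
  by apply: mpsum_close => // n Hn Hp; apply: Rlt_le; apply: (proj2 (Hb n)).
- move=> b Hb.
  have [|a Ha] := functional_choice (fun n y => elt (A n) y /\ ((n < L)%nat -> 0 < t n ->
    near k (e / 2) y b)).
    move=> n; case: (classic ((n < L)%nat /\ 0 < t n)) => [[Hn Hp]|Hno].
      by have [a [Ha Hnr]] := proj2 (HAB n Hn Hp) _ Hb; exists a.
    by have [a Ha] := elt_ex (A n); exists a; split=> // ? ?; exfalso; apply: Hno.
  exists (mpsum L t a); split; first by apply/HC; exists a; split=> // n; case: (Ha n).
  move=> i Hi; apply: Rle_lt_trans (_ : e / 2 < e); last lra.
  rewrite -{1}(mpsum_const L t b H).
  by apply: mpsum_close => // n Hn Hp; apply: Rlt_le; apply: (proj2 (Ha n)).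
Qed.

(** The estimate is uniform over all choices of points because the product of the sets [A n] is
    compact: bad choices would have a convergent subsequence, contradicting joint continuity of
    [mpsum]. *)
Lemma hnear_comb_cv L ts t A k e : (forall n, Un_cv (fun s => ts s n) (t n)) -> weights L t ->
  0 < e ->
  ev (fun s => forall C D : mpcc, (forall x, elt C x <-> comb L (ts s) A x) ->
    (forall x, elt D x <-> comb L t A x) -> hnear k e C D).
Proof.
move=> Ht H He.
suff : ev (fun s => forall a, (forall n, elt (A n) (a n)) ->
  near k e (mpsum L (ts s) a) (mpsum L t a)).
{ apply: ev_mono => s Hs C D HC HD; split.
  - move=> x /HC [a [Ha ->]]; exists (mpsum L t a); split; [by apply/HD; exists a | exact: Hs].
  - move=> x /HD [a [Ha ->]]; exists (mpsum L (ts s) a); split; [by apply/HC;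
    exists a | exact: Hs]. }
apply: NNPP => /not_ev Hno; have [σ [Hσ HP]] := frequently_incr _ (fun _ : nat => Hno).
have Hch s : exists a, (forall n, elt (A n) (a n)) /\
  ~ near k e (mpsum L (ts (σ s)) a) (mpsum L t a).
  by apply: NNPP => H'; apply: (HP s) => a Ha; apply: NNPP => H''; apply: H'; exists a.
have [as_ asP] := functional_choice _ Hch.
have [τ [a [Hτ [Ha Hc]]]] := prod_subseq A as_ (fun s => proj1 (asP s)).
have H1 : @cv Ec (fun s => mpsum L (ts (σ (τ s))) (as_ (τ s))) (mpsum L t a).
  by apply: (mpsum_cv L (fun s => ts (σ (τ s)))) => // n;
    exact: cv_sub (incr_comp _ _ Hσ Hτ) (Ht n).
have H2 : @cv Ec (fun s => mpsum L t (as_ (τ s))) (mpsum L t a).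
  by apply: (mpsum_cv L (fun _ => t)) => // n; exact: cv_const.
have [N HN] := ev_and _ _ (cv_near _ _ k (e / 2) H1 ltac:(lra)) (cv_near _ _ k (e / 2) H2 ltac:(lra)).
have [N1 N2] := HN N (Nat.le_refl N).
apply: (proj2 (asP (τ N))); have -> : e = e / 2 + e / 2 by lra.
by apply: near_trans N1 _; apply: near_sym.
Qed.

(** * A metric on [Romega] *)

(** Dugundji's weights compare distances, for which the boxes [near] give no number. The caps
    [/ INR (S i)] let only finitely many coordinates matter at each scale. *)
Definition distE (x y : Romega) := sup (fun _ : nat => True) (fun i =>
  Rmin (Rabs (x i - y i)) (/ INR (S i))).

Lemma nat_ex : exists i : nat, True.
Proof. by exists 0%nat. Qed.

Lemma inv_S_le1 i : / INR (S i) <= 1.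
Proof. by rewrite -Rinv_1; apply: Rinv_le_contravar; [lra | rewrite S_INR; have := pos_INR i;
  lra]. Qed.

Lemma distE_bd x y i : Rmin (Rabs (x i - y i)) (/ INR (S i)) <= 1.
Proof. exact: Rle_trans (Rmin_r _ _) (inv_S_le1 i). Qed.

Lemma distE_ub x y i : Rmin (Rabs (x i - y i)) (/ INR (S i)) <= distE x y.
Proof.
by apply: (sup_ub _ (fun _ => True) (fun i => Rmin (Rabs (x i - y i)) (/ INR (S i))) 1 i) =>
  // *; exact: distE_bd.
Qed.

Lemma distE_pos x y : 0 <= distE x y.
Proof.
apply: Rle_trans (distE_ub x y 0); apply: Rmin_glb; [exact: Rabs_pos | exact: Rlt_le (inv_S_pos 0)].
Qed.

Lemma distE_sym x y : distE x y = distE y x.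
Proof. by apply: sup_ext => i _; rewrite Rabs_minus_sym. Qed.

Lemma distE_self x : distE x x = 0.
Proof.
apply: Rle_antisym; last exact: distE_pos.
apply: sup_le => [|i _]; first exact: nat_ex.
by apply: Rle_trans (Rmin_l _ _) _; rewrite Rminus_diag Rabs_R0; lra.
Qed.

Lemma distE_tri x y z : distE x z <= distE x y + distE y z.
Proof.
apply: sup_le => [|i _]; first exact: nat_ex.
apply: Rle_trans (_ : Rmin (Rabs (x i - y i)) (/ INR (S i)) + Rmin (Rabs (y i - z i)) (/ INR (S i)) <= _).
  have := Rabs_triang (x i - y i) (y i - z i).
  have -> : x i - y i + (y i - z i) = x i - z i by ring.
  have := Rabs_pos (x i - y i); have := Rabs_pos (y i - z i); have := inv_S_pos i.
  rewrite /Rmin; do 3 case: Rle_dec; lra.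
by apply: Rplus_le_compat; exact: distE_ub.
Qed.

Lemma near_distE e : 0 < e -> exists k d, 0 < d /\ forall x y, near k d x y -> distE x y < e.
Proof.
move=> He; have [k Hk] := inv_S_small (e / 2) ltac:(lra).
exists k, (e / 2); split; first lra.
move=> x y Hn; apply: Rle_lt_trans (_ : e / 2 < e); last lra.
apply: sup_le => [|i _]; first exact: nat_ex.
case: (Nat.lt_ge_cases i k) => Hi; first exact: Rle_trans (Rmin_l _ _) (Rlt_le _ _ (Hn i Hi)).
exact: Rle_trans (Rmin_r _ _) (Rlt_le _ _ (Hk i Hi)).
Qed.

Lemma distE_near k e : 0 < e -> exists d, 0 < d /\ forall x y, distE x y < d -> near k e x y.
Proof.
move=> He; exists (Rmin e (/ INR (S k))); split; first by apply: Rmin_pos => //; exact: inv_S_pos.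
move=> x y Hd i Hi; apply: Rnot_le_lt => Hle; apply: (Rlt_irrefl (distE x y)).
apply: Rlt_le_trans Hd _; apply: Rle_trans (distE_ub x y i).
apply: Rmin_glb; first exact: Rle_trans (Rmin_l _ _) Hle.
apply: Rle_trans (Rmin_r _ _) _; apply: Rinv_le_contravar; first by apply: lt_0_INR; lia.
by apply: le_INR; lia.
Qed.

Lemma distE_cv (u : nat -> Romega) (x : Romega) : @cv Ec u x <-> Un_cv (fun s => distE (u s) x) 0.
Proof.
split=> H.
- apply/cvE => e He; have [k [d [Hd Hn]]] := near_distE e He.
  apply: ev_mono (cv_near u x k d H Hd) => s /Hn Hs.
  by rewrite Rminus_0_r Rabs_pos_eq //; exact: distE_pos.
- apply: near_cv => k e He; have [d [Hd Hn]] := distE_near k e He.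
  apply: ev_mono (cv_ev _ _ d H Hd) => s Hs; apply: Hn.
  by move: Hs; rewrite Rminus_0_r Rabs_pos_eq //; exact: distE_pos.
Qed.

Lemma distE_cv1 (u : nat -> Romega) (x y : Romega) : @cv Ec u x -> Un_cv (fun s =>
  distE (u s) y) (distE x y).
Proof.
move=> /distE_cv H; apply/cvE => e He; apply: ev_mono (cv_ev _ _ e H He) => s.
rewrite Rminus_0_r Rabs_pos_eq; first exact: distE_pos.
have := distE_tri (u s) x y; have := distE_tri x (u s) y; rewrite (distE_sym x (u s)) => ? ? ?.
by apply/Rabs_ltE; lra.
Qed.

(** * Dugundji extension *)

(** Separability of the image: for each dense point and radius, a set whose image is that close, if
    there is one, and an arbitrary set otherwise. *)
Definition denseX n : mpcc := let (l, k) := Cantor.of_nat n in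
  epsilon (inhabits (single (fun _ => 0))) (fun A => distE (qd l) (embX A) < / INR (S k)).

Lemma denseX_dense A e : 0 < e -> exists n, distE (embX (denseX n)) (embX A) < e.
Proof.
move=> He; have [k Hk] := inv_S_small (e / 2) ltac:(lra); have {}Hk := Hk k (Nat.le_refl k).
have [j [d [Hd Hn]]] := near_distE _ (inv_S_pos k).
have [l Hl] := qd_dense j d (embX A) Hd.
exists (Cantor.to_nat (l, k)); rewrite /denseX Cantor.cancel_of_to.
have H := epsilon_spec (inhabits (single (fun _ => 0))) (fun A =>
  distE (qd l) (embX A) < / INR (S k))
  (ex_intro _ A (Hn _ _ Hl)).
move: H; set B := epsilon _ _ => H.
have := distE_tri (embX B) (qd l) (embX A); have := Hn _ _ Hl;
  rewrite (distE_sym (embX B) (qd l)); lra.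
Qed.

Definition distn (y : Romega) n := distE y (embX (denseX n)).
Definition distK (y : Romega) := - sup (fun _ : nat => True) (fun n => - distn y n).

Lemma distK_le y n : distK y <= distn y n.
Proof.
suff : - distn y n <= sup (fun _ : nat => True) (fun n => - distn y n) by rewrite /distK; lra.
by apply: (sup_ub _ (fun _ => True) (fun n => - distn y n) 0) => // i _;
  have := distE_pos y (embX (denseX i)); rewrite /distn /=; lra.
Qed.

Lemma distK_near y e : 0 < e -> exists n, distn y n < distK y + e.
Proof.
move=> He; have [i _|n [_ Hn]] := sup_near _ (fun _ : nat => True) (fun n =>
  - distn y n) 0 e nat_ex _ He.
- by have := distE_pos y (embX (denseX i)); rewrite /distn /=; lra.
- by exists n; rewrite /distK; lra.
Qed.

Lemma distK_pos y : 0 <= distK y.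
Proof.
suff : sup (fun _ : nat => True) (fun n => - distn y n) <= 0 by rewrite /distK; lra.
by apply: sup_le => [|i _]; [exact: nat_ex | have := distE_pos y (embX (denseX i));
  rewrite /distn; lra].
Qed.

Lemma distK_embX y A : distK y <= distE y (embX A).
Proof.
apply: le_epsilon => e He; have [n Hn] := denseX_dense A e He.
apply: Rle_trans (distK_le y n) _; have := distE_tri y (embX A) (embX (denseX n)).
rewrite (distE_sym (embX A)) /distn; lra.
Qed.

Lemma distK_cv (u : nat -> Romega) (y : Romega) : @cv Ec u y -> Un_cv (fun s =>
  distK (u s)) (distK y).
Proof.
move=> /distE_cv H; apply/cv_dist; apply: cv_squeeze0 _ H; apply: ev_all => s.
have key x z : distK x <= distK z + distE x z.
  apply: le_epsilon => e He; have [n Hn] := distK_near z e He.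
  have := distK_le x n; have := distE_tri x z (embX (denseX n)); rewrite /distn in Hn *; lra.
have := key (u s) y; have := key y (u s); rewrite (distE_sym y) => ? ?.
by apply/Rabs_leE; lra.
Qed.

(** Closedness of the image enters here, through [embX_complete]. *)
Lemma distK_zero y : distK y = 0 -> exists A, embX A = y.
Proof.
move=> H0.
have Hch k : exists n, distn y n < / INR (S k).
  by have [n Hn] := distK_near y _ (inv_S_pos k); exists n; lra.
have [f fP] := functional_choice _ Hch.
have Hc : @cv Ec (fun k => embX (denseX (f k))) y.
  apply/distE_cv; apply: cv_squeeze0 _ cv_invS; apply: ev_all => k.
  by rewrite Rabs_pos_eq; [exact: distE_pos | rewrite distE_sym; exact: Rlt_le (fP k)].
have [A HA] := embX_complete _ y Hc.
by exists A; exact: Ecv_unique (embX_cv _ _ HA) Hc.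
Qed.

(* The first index with [distn < 3/2 distK] has positive weight, and subtracting [n] times the
   bumps of the earlier indices makes the family locally finite where [distK > 0]. *)
Definition dug_weight y n := Rmax 0 (2 * distK y - distn y n - INR n * bmax n (fun k =>
  3 / 2 * distK y - distn y k)).

Lemma dug_weight_pos y n : 0 <= dug_weight y n.
Proof. exact: Rmax_l. Qed.

Lemma dug_weight_active y n : 0 < dug_weight y n -> distn y n < 2 * distK y.
Proof.
rewrite /dug_weight => H; have := Rmult_le_pos _ _ (pos_INR n) (bmax_pos n (fun k =>
  3 / 2 * distK y - distn y k)).
by move: H; rewrite /Rmax; case: Rle_dec; lra.
Qed.

Lemma dug_weight_cv (u : nat -> Romega) (y : Romega) n : @cv Ec u y -> Un_cv (fun s =>
  dug_weight (u s) n) (dug_weight y n).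
Proof.
move=> H; have Hd := distK_cv u y H; have HD m : Un_cv (fun s => distn (u s) m) (distn y m)
  by exact: distE_cv1.
apply: cv_max (cv_const 0) _; apply: CV_minus; first by apply: CV_minus => //;
  exact: CV_mult (cv_const 2) Hd.
apply: CV_mult (cv_const _) _; apply: bmax_cv => k _; apply: CV_minus => //;
  exact: CV_mult (cv_const _) Hd.
Qed.

Lemma dug_weight_some y : 0 < distK y -> exists n, 0 < dug_weight y n.
Proof.
move=> Hp; have [n Hn] := distK_near y (distK y / 2) ltac:(lra).
have [m [Hm Hmin]] : exists m, distn y m < 3 / 2 * distK y /\ forall k, (k < m)%nat ->
  3 / 2 * distK y <= distn y k.
  have {}Hn : distn y n < 3 / 2 * distK y by lra.
  elim/(well_founded_induction Wf_nat.lt_wf): n Hn => n IH Hn.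
  case: (classic (exists k, (k < n)%nat /\ distn y k < 3 / 2 * distK y)) => [[k [Hk Hlt]]|Hno];
    first exact: IH Hlt.
  by exists n; split=> // k Hk; apply: Rnot_lt_le => Hlt; apply: Hno; exists k.
exists m; apply: Rlt_le_trans (Rmax_r _ _).
have -> : bmax m (fun k => 3 / 2 * distK y - distn y k) = 0.
  apply: Rle_antisym; last exact: bmax_pos.
  by apply: bmax_le => [|k /Hmin]; lra.
lra.
Qed.

Lemma dug_weight_support (u : nat -> Romega) (y : Romega) : @cv Ec u y -> 0 < distK y ->
  exists L, ev (fun s => forall n, (L <= n)%nat -> dug_weight (u s) n = 0).
Proof.
move=> H Hp; have [k Hk] := distK_near y (distK y / 2) ltac:(lra).
(* Half the bump of index [k] at [y], so that along the sequence this bump eventually stays above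
   [η]. Once [n] times [η] exceeds [2 * (distK y + 1)], the subtracted term wins. *)
pose η := (3 / 2 * distK y - distn y k) / 2; have Hη : 0 < η by rewrite /η; lra.
have H1 := CV_minus _ _ _ _ (CV_mult _ _ _ _ (cv_const (3 / 2)) (distK_cv u y H)) (distE_cv1 u y (embX (denseX k)) H).
have [N HN] := INR_unbounded (2 * (distK y + 1) / η).
exists (S (k + N)).
apply: ev_mono (ev_and _ _ (cv_ev _ _ η H1 Hη) (cv_ev _ _ 1 (distK_cv u y H) ltac:(lra))).
move=> s [/Rabs_ltE H2 /Rabs_ltE H3] n Hn; rewrite /dug_weight Rmax_left //.
have Hb : η <= bmax n (fun k => 3 / 2 * distK (u s) - distn (u s) k).
  apply: Rle_trans (bmax_ub n (fun k => 3 / 2 * distK (u s) - distn (u s) k) k ltac:(lia)).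
  by rewrite -/(distn (u s) k) -/(distn y k) in H2; rewrite {1}/η; rewrite /η in H2; lra.
have HnN : INR N <= INR n by apply: le_INR; lia.
have H4 : 2 * (distK y + 1) <= INR n * η.
  apply: (Rmult_le_reg_r (/ η)); first exact: Rinv_0_lt_compat.
  have -> : INR n * η * / η = INR n by field; lra.
  rewrite /Rdiv in HN; lra.
have H5 := Rmult_le_compat_l (INR n) _ _ (pos_INR n) Hb.
have := distE_pos (u s) (embX (denseX n)); rewrite -/(distn (u s) n); lra.
Qed.

Lemma dug_weight_weights L y : 0 < distK y -> (forall n, (L <= n)%nat -> dug_weight y n = 0) ->
  weights L (dug_weight y).
Proof.
move=> Hp HL; split; first exact: dug_weight_pos.
have [n Hn] := dug_weight_some y Hp.
case: (Nat.lt_ge_cases n L) => HnL; last by move: Hn; rewrite (HL n HnL); lra.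
exact: Rlt_le_trans Hn (bmax_ub L (dug_weight y) n HnL).
Qed.

Lemma comb_stab L L' t A : (L <= L')%nat -> (forall n, (L <= n)%nat -> t n = 0) ->
  comb L' t A = comb L t A.
Proof.
move=> HL Ht.
suff E a : mpsum L' t a = mpsum L t a.
  apply: functional_extensionality => x; apply: propositional_extensionality.
  by split=> -[a [Ha ->]]; exists a; rewrite E.
apply: functional_extensionality => i; rewrite /mpsum.
by rewrite !(bmax_stab L L') // => n Hn; rewrite Ht // Rmult_0_l.
Qed.

(** A relation, so that no cutoff [L] has to be singled out; by [comb_stab] any two cutoffs give the
    same set. *)
Definition extX_rel (y : Romega) (B : mpcc) : Prop :=
  embX B = y \/ (~ (exists A, embX A = y)) /\ exists L, (forall n, (L <= n)%nat ->
    dug_weight y n = 0) /\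
    forall x, elt B x <-> comb L (dug_weight y) denseX x.

Definition extX (y : Romega) : mpcc := epsilon (inhabits (single (fun _ => 0))) (extX_rel y).

Lemma distK_out y : ~ (exists A, embX A = y) -> 0 < distK y.
Proof. by move=> H; case: (distK_pos y) => // E; exfalso; apply: H; apply: distK_zero. Qed.

Lemma extX_spec y : extX_rel y (extX y).
Proof.
apply: epsilon_spec; case: (classic (exists A, embX A = y)) => [[A HA]|Hno]; first by exists A;
  left.
have Hp := distK_out y Hno; have [L [N HL]] := dug_weight_support (fun _ => y) y (Ecv_const y) Hp.
have {}HL := HL N (Nat.le_refl N).
exists (exist _ _ (comb_mpcc L (dug_weight y) denseX (dug_weight_weights L y Hp HL))); right;
  split=> //.
by exists L.
Qed.

Lemma extX_embX A : extX (embX A) = A.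
Proof.
case: (extX_spec (embX A)) => [|[H _]]; first exact: embX_inj.
by exfalso; apply: H; exists A.
Qed.

Lemma extX_out y L : 0 < distK y -> (forall n, (L <= n)%nat -> dug_weight y n = 0) ->
  forall x, elt (extX y) x <-> comb L (dug_weight y) denseX x.
Proof.
move=> Hp HL.
case: (extX_spec y) => [E|[_ [L' [HL' H]]]] x.
  by exfalso; have := distK_embX y (extX y); rewrite E distE_self; lra.
rewrite H -(comb_stab L (L + L') _ _ ltac:(lia) HL) -(comb_stab L' (L + L') _ _ ltac:(lia) HL').
by [].
Qed.

Lemma embX_modulus A k e : 0 < e -> exists d, 0 < d /\ forall B, distE (embX B) (embX A) < d ->
  hnear k e B A.
Proof.
move=> He; apply: NNPP => Hno.
have Hch n : exists B, distE (embX B) (embX A) < / INR (S n) /\ ~ hnear k e B A.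
  apply: NNPP => H; apply: Hno; exists (/ INR (S n)); split; first exact: inv_S_pos.
  by move=> B HB; apply: NNPP => HnB; apply: H; exists B.
have [u uP] := functional_choice _ Hch.
have Hu : @cv Xc u A.
  apply: embX_cv_inv; apply/distE_cv; apply: cv_squeeze0 _ cv_invS; apply: ev_all => n.
  by rewrite Rabs_pos_eq; [exact: distE_pos | exact: Rlt_le (proj1 (uP n))].
have [N HN] := Hu k e He.
by apply: (proj2 (uP N)); apply: HN.
Qed.

Lemma extX_cv : scont Ec Xc extX.
Proof.
move=> u y Hu k e He.
case: (classic (exists A, embX A = y)) => [[A HA]|Hno].
- rewrite -HA extX_embX.
  have [d [Hd Hm]] := embX_modulus A k (e / 2) ltac:(lra).
  (* A set of positive weight has its image within [2 * distK (u s)] of [u s], hence within three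
     times [distE (u s) y] of [y]. *)
  apply: ev_mono (cv_ev _ _ (d / 3) (proj1 (distE_cv u y) Hu) ltac:(lra)) => s.
  rewrite Rminus_0_r Rabs_pos_eq; first exact: distE_pos.
  move=> Hs; case: (extX_spec (u s)) => [E|[Hout [L [HL HC]]]].
    have [H1 H2] : hnear k (e / 2) (extX (u s)) A by apply: Hm; rewrite E HA; lra.
    split=> x Hx; [have [z [Hz Hn]] := H1 x Hx | have [z [Hz Hn]] := H2 x Hx];
      exists z; split=> //; apply: near_le Hn; [lia | lra | lia | lra].
  have Hp := distK_out _ Hout.
  apply: (hnear_comb_close L (dug_weight (u s)) denseX A k e (dug_weight_weights L _ Hp HL) He) => //.
  move=> n _ /dug_weight_active Hn; apply: Hm; rewrite HA.
  have := distK_embX (u s) A; rewrite HA => Hdel.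
  have := distE_tri (embX (denseX n)) (u s) y;
    rewrite (distE_sym (embX (denseX n)) (u s)) -/(distn (u s) n); lra.
- have Hp := distK_out _ Hno.
  have [L HL] := dug_weight_support u y Hu Hp.
  (* The common cutoff passes to [y] because the weights are continuous. *)
  have HLy n : (L <= n)%nat -> dug_weight y n = 0.
    move=> Hn; apply: UL_sequence (dug_weight_cv u y n Hu) _.
    apply: cv_ext_ev (cv_const 0); apply: ev_mono HL => s Hs; by rewrite Hs.
  have Hdel := cv_ev _ _ (distK y) (distK_cv u y Hu) Hp.
  have Hcomb := hnear_comb_cv L (fun s => dug_weight (u s)) (dug_weight y) denseX k e (fun n =>
    dug_weight_cv u y n Hu) (dug_weight_weights L y Hp HLy) He.
  apply: ev_mono (ev_and _ _ HL (ev_and _ _ Hdel Hcomb)) => s [H1 [/Rabs_ltE H2 H3]].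
  by apply: H3; apply: extX_out => //; lra.
Qed.

(** * Splitting off translations *)

Lemma coord_cv i : scont Ec Rcs (fun x : Romega => x i).
Proof. by move=> u x H; exact: H. Qed.

Definition top (A : mpcc) : Romega := fun i => supX (fun x => x i) A.

Lemma top_ub A a i : elt A a -> a i <= top A i.
Proof. exact: (supX_ub (fun x => x i) A a (coord_cv i)). Qed.

(** By convexity, the maximum of near-maximizers for the first [k] coordinates is in [A] and nearly
    maximal in all of them; closedness gives the limit. *)
Lemma top_elt A : elt A (top A).
Proof.
apply: elt_closed => k e He.
have [a [Ha H]] : exists a, elt A a /\ forall i, (i < k)%nat -> top A i - e < a i.
{ elim: k => [|k [a [Ha IH]]]; first by have [a Ha] := elt_ex A; exists a; split=> // i; lia.
  have [b [Hb Hbk]] := supX_near (fun x => x k) A e (coord_cv k) He.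
  exists (mpc 0 a b); split; first by apply: elt_mpc => //; lra.
  move=> i Hi; rewrite /mpc; case: (Nat.eq_dec i k) => [->|Hne].
  - apply: Rlt_le_trans (Rmax_r _ _); rewrite Rplus_0_l; exact: Hbk.
  - by apply: Rlt_le_trans (Rmax_l _ _); apply: IH; lia. }
exists a; split=> // i Hi; have := H i Hi; have := top_ub A a i Ha => ? ?; apply/Rabs_ltE; lra.
Qed.

Lemma top_unique A t : elt A t -> (forall a i, elt A a -> a i <= t i) -> top A = t.
Proof.
move=> Ht H; apply: functional_extensionality => i; apply: Rle_antisym; last exact: top_ub.
by apply: H; exact: top_elt.
Qed.

Lemma top_cv : scont Xc Ec top.
Proof. by move=> u A H i; exact: (supX_cv _ (coord_cv i)). Qed.

Lemma tr_mpcc v A : is_mpcc (fun x => elt A (esub x v)).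
Proof.
apply/is_mpccE; split; [|split; [|split]].
- by have [x Hx] := elt_ex A; exists (eadd v x); rewrite esub_eadd.
- apply: Eclosed_seq => u x Hu Hx; apply: (closed_cv _ (fun n => esub (u n) v)) (elt_closed A) Hu _.
  exact: esub_cv Hx (Ecv_const v).
- move=> i; have [b Hb] := elt_bounded A i; exists (b + Rabs (v i)) => x /Hb.
  rewrite /esub => Hx; have := Rabs_triang (x i - v i) (v i).
  have -> : x i - v i + v i = x i by ring. lra.
- move=> a b l Hl Ha Hb.
  have -> : esub (mpc l a b) v = mpc l (esub a v) (esub b v).
    apply: functional_extensionality => i; rewrite /esub /mpc /Rmax.
    by case: Rle_dec => ?; case: Rle_dec => ?; lra.
  exact: elt_mpc.
Qed.

Definition tr v A : mpcc := exist _ _ (tr_mpcc v A).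

Lemma tr_cv (vs : nat -> Romega) (v : Romega) (u : nat -> Xc) (A : Xc) : @cv Ec vs v -> cv u A ->
  @cv Xc (fun s => tr (vs s) (u s)) (tr v A).
Proof.
move=> Hv Hu k e He.
apply: ev_mono (ev_and _ _ (cv_near _ _ k (e / 2) Hv ltac:(lra)) (Hu k (e / 2) ltac:(lra))).
move=> s [H1 [H2 H3]]; split=> x Hx.
- have [b [Hb Hn]] := H2 _ Hx; exists (eadd v b); split; first by rewrite /elt /= esub_eadd.
  move=> i Hi; have := H1 i Hi; have := Hn i Hi; rewrite /esub /eadd => /Rabs_ltE ? /Rabs_ltE ?.
  by apply/Rabs_ltE; lra.
- have [b [Hb Hn]] := H3 _ Hx; exists (eadd (vs s) b); split; first by rewrite /elt /= esub_eadd.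
  move=> i Hi; have := H1 i Hi; have := Hn i Hi; rewrite /esub /eadd => /Rabs_ltE ? /Rabs_ltE ?.
  by apply/Rabs_ltE; lra.
Qed.

Lemma tr_tr v w A : tr v (tr w A) = tr (eadd v w) A.
Proof.
apply: mpcc_ext => x; rewrite /elt /=.
have -> : esub (esub x v) w = esub x (eadd v w); last by [].
by apply: functional_extensionality => i; rewrite /esub /eadd; ring.
Qed.

Definition zero : Romega := fun _ => 0.

Lemma tr_zero A : tr zero A = A.
Proof.
apply: mpcc_ext => x; rewrite {1}/elt /=.
have -> : esub x zero = x; last by [].
by apply: functional_extensionality => i; rewrite /esub /zero; ring.
Qed.

Lemma top_tr v A : top (tr v A) = eadd v (top A).
Proof.
apply: top_unique => [|a i Ha]; first by rewrite /elt /= esub_eadd; exact: top_elt.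
by have := top_ub A _ i Ha; rewrite /esub /eadd; lra.
Qed.

Definition X0c := subc Xc (fun A => top A = zero).

Lemma eopp_add v : eadd (esub zero v) v = zero.
Proof. by apply: functional_extensionality => i; rewrite /esub /eadd /zero; ring. Qed.

Lemma X_split : homeo Xc (prodc X0c Ec).
Proof.
have Hf A : top (tr (esub zero (top A)) A) = zero by rewrite top_tr eopp_add.
exists (fun A => (exist (fun A => top A = zero) _ (Hf A), top A)).
exists (fun Bv => tr (snd Bv) (proj1_sig (fst Bv))).
split; [|split; [|split]].
- move=> u A Hu; have Ht := top_cv u A Hu; split=> //.
  by apply: tr_cv => //; apply: esub_cv => //; exact: Ecv_const.
- by move=> u Bv [H1 H2]; apply: tr_cv.
- by move=> A /=; rewrite tr_tr eaddC eopp_add tr_zero.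
- move=> [[B HB] v]; have E : top (tr v B) = v.
    rewrite top_tr HB; apply: functional_extensionality => i; rewrite /eadd /zero; ring.
  congr pair; last exact: E.
  by apply: sig_eq; rewrite /= E tr_tr eopp_add tr_zero.
Qed.

Lemma X_homeo : homeo Xc Ec.
Proof.
pose r (x : Romega) := embX (extX x).
have r_cont : scont Ec Ec r by move=> u x H; apply: embX_cv; apply: extX_cv.
have r_idem x : r (r x) = r x by rewrite /r extX_embX.
have HK : homeo Xc (Kc r).
{ exists (fun A => exist (fun x => r x = x) (embX A) (f_equal embX (extX_embX A))).
  exists (fun x => extX (proj1_sig x)); split; [|split; [|split]].
  - by move=> u A H; apply: embX_cv.
  - by move=> u x H; apply: extX_cv.
  - by move=> A; apply: extX_embX.
  - by move=> [x Hx]; apply: sig_eq. }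
(* With [X] the hyperspace, the chain reads [X ~ X0 x E ~ X0 x (E x E) ~ (X0 x E) x E ~ X x E ~ K x
   E ~ E], assembled mostly from its right end. *)
apply: homeo_trans _ (retract_absorb r r_cont r_idem).
apply: homeo_trans _ (homeo_prod _ _ _ _ HK (homeo_refl Ec)).
apply: homeo_trans X_split _.
apply: homeo_trans _ (homeo_prod _ _ _ _ (homeo_sym _ _ X_split) (homeo_refl Ec)).
apply: homeo_trans _ (homeo_sym _ _ (homeo_assoc _ _ _)).
exact: homeo_prod (homeo_refl _) (homeo_sym _ _ homeo_Ec_prod).
Qed.

(** * Sequential versus open-set continuity *)

Lemma hnear_le k k' e e' A B : (k' <= k)%nat -> e <= e' -> hnear k e A B -> hnear k' e' A B.
Proof.
move=> Hk He [H1 H2]; split=> x Hx; [have [y [Hy Hn]] := H1 x Hx | have [y [Hy Hn]] := H2 x Hx];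
  exists y; split=> //; exact: near_le Hn.
Qed.

Lemma vietoris_subbase_ev W (u : nat -> Xc) (A : Xc) : vietoris_subbase W -> cv u A -> W A ->
  ev (fun s => W (u s)).
Proof.
move=> [U [/prod_openE HU [HW|HW]]] Hu /HW HA.
- suff H : ev (fun s => forall x, elt (u s) x -> U x) by apply: ev_mono H => s /HW.
  apply: NNPP => /not_ev Hno; have [σ [Hσ HP]] := frequently_incr _ (fun _ : nat => Hno).
  have Hch s : exists x, elt (u (σ s)) x /\ ~ U x.
    by apply: NNPP => H; apply: (HP s) => x Hx; apply: NNPP => Hn; apply: H; exists x.
  have [xs xsP] := functional_choice _ Hch.
  have [τ [x [Hτ [Hx Hc]]]] := Xcv_up u A σ xs Hu Hσ (fun s => proj1 (xsP s)).
  have [k [e [He Hn]]] := HU x (HA x Hx).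
  have [N HN] := cv_near _ x k e Hc He.
  by apply: (proj2 (xsP (τ N))); apply: Hn; apply: near_sym; apply: HN.
- have [x [Hx HUx]] := HA; have [k [e [He Hn]]] := HU x HUx.
  apply: ev_mono (Hu k e He) => s [_ H]; apply/HW.
  by have [a [Ha Hna]] := H x Hx; exists a; split=> //; apply: Hn; apply: near_sym.
Qed.

Lemma vietoris_open_ev W (u : nat -> Xc) (A : Xc) : vietoris_open W -> cv u A -> W A ->
  ev (fun s => W (u s)).
Proof.
move=> HW Hu /HW [l [Hl [HA Hsub]]].
suff H : ev (fun s => forall B, In B l -> B (u s)) by apply: ev_mono H => s; apply: Hsub.
elim: l Hl HA {Hsub} => [|C l IH] Hl HA; first by apply: ev_all.
have HC : vietoris_subbase C by inversion Hl.
have Hl' : Forall vietoris_subbase l by inversion Hl.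
have H1 := vietoris_subbase_ev C u A HC Hu (HA C (or_introl (Logic.eq_refl _))).
have H2 := IH Hl' (fun B HB => HA B (or_intror HB)).
by apply: ev_mono (ev_and _ _ H1 H2) => s [H3 H4] B [<-|HB] //; apply: H4.
Qed.

(** One containment condition, in the [e]-neighbourhood of [A], bounds the set from outside; hitting
    conditions around a finite [e / 2]-net of [A] bound it from inside. *)
Lemma hnear_vietoris k e A : 0 < e -> exists l : list (mpcc -> Prop), Forall vietoris_subbase l /\
  (forall W, In W l -> W A) /\ (forall B, (forall W, In W l -> W B) -> hnear k e B A).
Proof.
move=> He.
have [||l Hl] := elt_compact A {x | elt A x} (fun i => near k (e / 2) (proj1_sig i));
  [by move=> i; apply/prod_openE; apply: Eopen_near
  |by move=> x Hx; exists (exist _ x Hx); apply: near_refl; lra|].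
pose U0 x := exists a, elt A a /\ near k e a x.
pose Win (B : mpcc) := forall x, proj1_sig B x -> U0 x.
pose Whit (i : {x | elt A x}) (B : mpcc) := exists x, proj1_sig B x /\
  near k (e / 2) (proj1_sig i) x.
exists (Win :: map Whit l); split; [|split].
- apply: Forall_cons.
    exists U0; split; last by left.
    apply/prod_openE => x [a [Ha Hn]]; have [j [d [Hd Hnd]]] := Eopen_near k e a x Hn.
    by exists j, d; split=> // y /Hnd Hy; exists a.
  apply/Forall_forall => W /in_map_iff [i [<- _]].
  by exists (near k (e / 2) (proj1_sig i)); split; [apply/prod_openE; exact: Eopen_near | right].
- move=> W [<-|/in_map_iff [i [<- _]]].
    by move=> x Hx; exists x; split=> //; apply: near_refl.
  by exists (proj1_sig i); split; [exact: (proj2_sig i) | apply: near_refl; lra].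
- move=> B HB; split=> x Hx.
  + have [a [Ha Hn]] := HB Win (or_introl (Logic.eq_refl _)) x Hx.
    by exists a; split=> //; apply: near_sym.
  + have [i [Hi Hn]] := Hl x Hx.
    have [y [Hy Hny]] := HB (Whit i) (or_intror (in_map Whit l i Hi)).
    exists y; split=> //; have -> : e = e / 2 + e / 2 by lra.
    by apply: near_trans Hn; apply: near_sym.
Qed.

(** The relations [hnear n (/ INR (S n))] give a countable base of neighbourhoods, so a failure of
    openness is witnessed by a sequence. *)
Lemma seq_vietoris_open (W : mpcc -> Prop) :
  (forall (u : nat -> Xc) (A : Xc), cv u A -> W A -> ev (fun s => W (u s))) -> vietoris_open W.
Proof.
move=> H A HA.
have [k [e [He HW]]] : exists k e, 0 < e /\ forall B, hnear k e B A -> W B.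
  apply: NNPP => Hno.
  have Hch n : exists B, hnear n (/ INR (S n)) B A /\ ~ W B.
    apply: NNPP => Hn; apply: Hno; exists n, (/ INR (S n)); split; first exact: inv_S_pos.
    by move=> B HB; apply: NNPP => HWB; apply: Hn; exists B.
  have [u uP] := functional_choice _ Hch.
  have Hu : @cv Xc u A.
    move=> k e He; have [N HN] := inv_S_small e He; exists (k + N)%nat => n Hn.
    apply: hnear_le (proj1 (uP n)); [lia | apply: Rlt_le; apply: HN; lia].
  have [N HN] := H u A Hu HA.
  by apply: (proj2 (uP N)); apply: HN.
have [l [H1 [H2 H3]]] := hnear_vietoris k e A He.
by exists l; split=> //; split=> // B HB; apply: HW; apply: H3.
Qed.

Theorem theorem4p1 : homeomorphic vietoris_open prod_open.
Proof.
have [f [g [Hf [Hg [Hgf Hfg]]]]] := X_homeo.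
exists f, g; split; [|split=> //].
- move=> V /prod_openE HV; apply: seq_vietoris_open => u A Hu HA.
  have [k [e [He Hn]]] := HV _ HA.
  by apply: ev_mono (cv_near _ _ k e (Hf u A Hu) He) => s Hs; apply: Hn; apply: near_sym.
- move=> W HW; apply/prod_openE => x Hx; apply: NNPP => Hno.
  have Hch n : exists y, near n (/ INR (S n)) x y /\ ~ W (g y).
    apply: NNPP => Hn; apply: Hno; exists n, (/ INR (S n)); split; first exact: inv_S_pos.
    by move=> y Hy; apply: NNPP => HWy; apply: Hn; exists y.
  have [u uP] := functional_choice _ Hch.
  have Hu : @cv Ec u x.
    apply: near_cv => k e He; have [N HN] := inv_S_small e He; exists (k + N)%nat => n Hn.
    apply: near_sym; apply: near_le (proj1 (uP n)); [lia | apply: Rlt_le; apply: HN; lia].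
  have [N HN] := vietoris_open_ev W _ _ HW (Hg u x Hu) Hx.
  by apply: (proj2 (uP N)); apply: HN.
Qed.
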